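(* The parameterized counting problem $p$-#Edge-Induced-Subgraph$^*$ — given a graph $G$ and $k\in\mathbb N$, compute the number of $k$-edge induced subgraphs of $G$ without isolated vertices, with parameter $k$ — is $\#\mathrm W[1]$-hard; specifically, there is an fpt Turing reduction from $p$-#Independent-Set (given $G$ and $k$, count the independent sets of size $k$ in $G$, parameter $k$) to it.
   Context: All graphs are simple. A $k$-edge induced subgraph is an induced subgraph $G[S]$ ($S\ne\emptyset$) with exactly $k$ edges; counted by vertex set. $p$-#Independent-Set is $\#\mathrm W[1]$-complete. An fpt Turing reduction from $(F,\kappa)$ to $(F',\kappa')$ is an algorithm with oracle for $F'$ computing $F$ in time $f(\kappa(x))\cdot|x|^{O(1)}$ ($f$ computable), such that for a computable $g$ every oracle query $y$ on input $x$ satisfies $\kappa'(y)\le g(\kappa(x))$. *)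

(* Defs.v *)
From mathcomp Require Import all_boot.
Set Implicit Arguments. Unset Strict Implicit. Unset Printing Implicit Defensive.

(* Graph notions, for a simple graph given by a symmetric irreflexive  *)
(* relation e on a finite vertex type T.                               *)
Section GraphNotions.
Variables (T : finType) (e : rel T).

Definition independent (S : {set T}) : bool :=
  [forall u in S, forall v in S, ~~ e u v].

Definition count_indep (k : nat) : nat :=
  #|[set S : {set T} | (#|S| == k) && independent S]|.

Definition induced_edges (S : {set T}) : nat :=
  #|[set p : T * T | [&& p.1 \in S, p.2 \in S,
                         (enum_rank p.1 < enum_rank p.2)%N & e p.1 p.2]]|.

Definition no_isolated (S : {set T}) : bool :=
  [forall u in S, exists v in S, e u v].

Definition count_edge_induced_star (k : nat) : nat :=
  #|[set S : {set T} | [&& S != set0, induced_edges S == k & no_isolated S]]|.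
End GraphNotions.

Fixpoint bits_aux (fuel m : nat) : seq bool :=
  match fuel with
  | 0 => [::]
  | f.+1 => if m == 0 then [::] else odd m :: bits_aux f m./2
  end.
Definition bits (m : nat) : seq bool := bits_aux m m.

Fixpoint of_bits (s : seq bool) : nat :=
  match s with [::] => 0 | b :: s' => b + 2 * of_bits s' end.

(* self-delimiting code: bit b is written "1 b", the end is "0 0" *)
Fixpoint dec_sd (s : seq bool) : option (seq bool * seq bool) :=
  match s with
  | true :: b :: s' =>
      match dec_sd s' with Some (p, r) => Some (b :: p, r) | None => None end
  | false :: false :: s' => Some ([::], s')
  | _ => None
  end.

(* An instance (G, k) is encoded as  sd(bin n) sd(bin k) adj  where the
   vertex set of G is {0,...,n-1} and adj is the row-major n*n adjacency
   matrix; it must be symmetric with zero diagonal (simple graph). *)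
Definition dec_inst (s : seq bool) : option (nat * nat * seq bool) :=
  match dec_sd s with
  | Some (bn, r) =>
      match dec_sd r with
      | Some (bk, adj) => Some (of_bits bn, of_bits bk, adj)
      | None => None
      end
  | None => None
  end.

Definition adj_rel (n : nat) (adj : seq bool) : rel 'I_n :=
  fun i j => nth false adj (i * n + j).

Definition valid_graph (n : nat) (adj : seq bool) : bool :=
  (size adj == n * n) &&
  [forall i : 'I_n, forall j : 'I_n,
      (adj_rel adj i j == adj_rel adj j i) && ~~ adj_rel adj i i].

Definition graph_problem (F : forall n : nat, rel 'I_n -> nat -> nat)
  (s : seq bool) : nat :=
  match dec_inst s with
  | Some (n, k, adj) => if valid_graph n adj then F n (adj_rel adj) k else 0
  | None => 0
  end.

Definition graph_param (s : seq bool) : nat :=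
  match dec_inst s with
  | Some (n, k, adj) => if valid_graph n adj then k else 0
  | None => 0
  end.

Definition p_count_IS : seq bool -> nat :=
  graph_problem (fun n e k => @count_indep 'I_n e k).
Definition p_count_EIS_star : seq bool -> nat :=
  graph_problem (fun n e k => @count_edge_induced_star 'I_n e k).

(* Oracle Turing machines: a work tape (holding input and output) and  *)
(* an oracle (query) tape, alphabet {blank, 0, 1}.                     *)
Definition Sym := option bool.  (* None = blank *)
Inductive Move := MoveL | MoveR | Stay.

Record tape := Tape { tleft : seq Sym; thead : Sym; tright : seq Sym }.

Definition tmove (m : Move) (t : tape) : tape :=
  match m with
  | MoveL => match tleft t with
             | [::] => Tape [::] None (thead t :: tright t)
             | a :: l => Tape l a (thead t :: tright t) end
  | MoveR => match tright t with
             | [::] => Tape (thead t :: tleft t) None [::]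
             | a :: r => Tape (thead t :: tleft t) a r end
  | Stay => t
  end.

Definition twrite (a : Sym) (t : tape) : tape := Tape (tleft t) a (tright t).

Fixpoint take_bits (l : seq Sym) : seq bool :=
  match l with Some b :: l' => b :: take_bits l' | _ => [::] end.

Definition tword (t : tape) : seq bool := take_bits (thead t :: tright t).

Definition tape_of (w : seq bool) : tape :=
  match w with
  | [::] => Tape [::] None [::]
  | b :: w' => Tape [::] (Some b) (map Some w')
  end.

Record OTM := {
  state : finType;
  q_start : state;
  q_halt : state;
  q_query : state;
  q_answer : state;
  delta : state -> Sym -> Sym -> state * Sym * Sym * Move * Move }.

Record config (M : OTM) := Cfg { cstate : state M; cwork : tape; cquery : tape }.

Definition step (M : OTM) (O : seq bool -> seq bool) (c : config M) : config M :=
  if cstate c == q_halt M then c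
  else if cstate c == q_query M then
    Cfg (q_answer M) (cwork c) (tape_of (O (tword (cquery c))))
  else
    let: (q, a, b, m1, m2) := delta (cstate c) (thead (cwork c)) (thead (cquery c)) in
    Cfg q (tmove m1 (twrite a (cwork c))) (tmove m2 (twrite b (cquery c))).

Definition init (M : OTM) (x : seq bool) : config M :=
  Cfg (q_start M) (tape_of x) (tape_of [::]).

Definition run (M : OTM) (O : seq bool -> seq bool) (x : seq bool) (n : nat) :=
  iter n (step O) (init M x).

Definition runs_within (M : OTM) (O : seq bool -> seq bool) (x : seq bool)
  (t : nat) (y : seq bool) (P : seq bool -> Prop) : Prop :=
  exists n, (n <= t)%N /\
    cstate (run M O x n) = q_halt M /\
    tword (cwork (run M O x n)) = y /\
    (forall i, (i < n)%N -> cstate (run M O x i) = q_query M ->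
               P (tword (cquery (run M O x i)))).

(* f : nat -> nat is computable (binary input/output, no oracle use
   needed: the oracle is the trivial constant one). *)
Definition computable (f : nat -> nat) : Prop :=
  exists M : OTM, forall m, exists t,
    runs_within M (fun _ => [::]) (bits m) t (bits (f m)) (fun _ => True).

Definition fpt_turing_reduction (F kappa F' kappa' : seq bool -> nat) : Prop :=
  exists (M : OTM) (f g : nat -> nat) (c : nat),
    computable f /\ computable g /\
    forall x : seq bool,
      runs_within M (fun w => bits (F' w)) x
        (f (kappa x) * (size x).+1 ^ c) (bits (F x))
        (fun y => (kappa' y <= g (kappa x))%N).

(* Main.v *)
(** Let [G_T] be the graph [G] with [j] additional vertices, those in [T] being
    adjacent to all of [V(G)] and the others isolated, and let [N(T)] be the
    number of [j * k]-edge induced subgraphs of [G_T] without isolated vertices.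
    As isolated vertices are never selected, inclusion-exclusion over [T] leaves
    exactly the sets containing all [j] new vertices, i.e. (for [j] even)
      sum_T (-1)^|T| N(T) = #{S : e(S) + j |S| = j k}     ([k > 0]).
    If [j > k^2], then [|S| < k] would force [e(S) >= j > |S|^2], so these [S] are
    the independent sets of size [k].  The choice [j = 4 ^ size (bits k)] is even
    and makes [j * k] and [n + j] easy to write in binary.

    The signed sum is computed modulo [2 ^ (n + 1)] by a machine that enumerates
    all [2 ^ j] masks [T].  A malformed instance turns into malformed queries, for
    which the oracle answers 0; since the allotted time depends on [k] only for
    well-formed instances, the machine first runs the algorithm with [k = 1],
    which gives [n] or 0, and continues only after a nonzero outcome.

    The machine is obtained by compiling a language of bounded loops over binary
    stacks: stack 0 is the oracle tape (its top is under the head), the others are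
    interleaved on the work tape. *)
From mathcomp Require Import all_boot zify.
From Stdlib Require Import FunctionalExtensionality.
Require Import Defs.
Set Implicit Arguments. Unset Strict Implicit. Unset Printing Implicit Defensive.

(** The oracle prescribes the number of edges, not of vertices. The new vertices are pairwise
    nonadjacent, so each vertex of S brings j extra edges once they are all selected, and a large j
    lets the edge count control |S|. They also settle the condition on isolated vertices: if all are
    selected and attached, it holds for every nonempty S. For k = 0 they would themselves be
    isolated, hence the separate treatment of that case.

    Partial signed sums may be negative and an answer may have more than n + 1 bits, but the final
    count is at most 2^n, so two's complement arithmetic on n + 1 bits determines it.

    An oracle machine has a single query state, so [Query] may occur only once in the text of the
    program; both phases therefore run the same loop body. A phase makes 2^j queries, where j = 4^l
    and l is the length of its target; the time bounds round all factors depending on l up to powers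
    of 2^(4^(l+1)). *)

(* A machine fragment; exiting is signalled by the state [None], and [fqry] is the
   query state, if any, together with the state entered when the answer arrives. *)
Record frag := Frag {
  fstate : finType;
  fent : fstate;
  fdel : fstate -> Sym -> Sym -> option fstate * Sym * Sym * Move * Move;
  fqry : option (fstate * fstate) }.

(** * Machine fragments and the composition of their runs *)

Section Runs.
Variables (O : seq bool -> seq bool) (P : seq bool -> Prop).

(** Mirrors [step]: the last index is the exact number of machine steps, a query takes one of them,
    and [P] is required at every query. [FStep] excludes the query state because [step] tests for it
    before consulting [delta]. *)
Inductive frun (F : frag) :
    option (fstate F) -> tape -> tape -> tape -> tape -> nat -> Prop :=
| FDone w q : frun None w q w q 0
| FStep s w q s' a b m1 m2 w' q' n :
    omap (fun u => u.1) (fqry F) != Some s ->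
    fdel s (thead w) (thead q) = (s', a, b, m1, m2) ->
    frun s' (tmove m1 (twrite a w)) (tmove m2 (twrite b q)) w' q' n ->
    frun (Some s) w q w' q' n.+1
| FQuery s a w q w' q' n :
    fqry F = Some (s, a) -> P (tword q) ->
    frun (Some a) w (tape_of (O (tword q))) w' q' n ->
    frun (Some s) w q w' q' n.+1.

Definition fok F := frun (Some (fent F)).

(** Simulation behind all combinators: [h] embeds the states of [F] into [G], and an exit of [F]
    becomes a jump to [k]. The jump costs no step, so the run from [k] is simply appended. *)
Lemma frun_lift F G (h : fstate F -> fstate G) (k : option (fstate G)) :
  (forall s x y, fdel (h s) x y =
     let: (s', a, b, m1, m2) := fdel s x y in
     (if s' is Some u then Some (h u) else k, a, b, m1, m2)) ->
  (forall s, omap (fun u => u.1) (fqry F) != Some s ->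
             omap (fun u => u.1) (fqry G) != Some (h s)) ->
  (forall s a, fqry F = Some (s, a) -> fqry G = Some (h s, h a)) ->
  forall so w q w1 q1 n1 w2 q2 n2,
  frun so w q w1 q1 n1 -> frun k w1 q1 w2 q2 n2 ->
  frun (if so is Some u then Some (h u) else k) w q w2 q2 (n1 + n2).
Proof.
move=> hd hq1 hq2 so w q w1 q1 n1 w2 q2 n2 H; elim: H w2 q2 n2 => {so w q w1 q1 n1}.
- by [].
- move=> s w q s' a b m1 m2 w' q' n ns del _ IH w2 q2 n2 H2.
  apply: FStep (IH _ _ _ H2); first exact: hq1.
  by rewrite hd del.
- move=> s a w q w' q' n fq Pq _ IH w2 q2 n2 H2.
  exact: FQuery (hq2 _ _ fq) Pq (IH _ _ _ H2).
Qed.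

End Runs.

Definition fact (a : Sym -> Sym -> Sym * Sym * Move * Move) : frag :=
  @Frag unit tt (fun _ x y => let: (u, v, m1, m2) := a x y in (None, u, v, m1, m2)) None.

(** If both parts had a query state, that of [G] would be lost, hence the side conditions on [fqry]
    below. *)
Definition fseq (F G : frag) : frag :=
  @Frag (fstate F + fstate G)%type (inl (fent F))
    (fun s x y => match s with
      | inl u => let: (s', a, b, m1, m2) := fdel u x y in
                 (if s' is Some v then Some (inl v) else Some (inr (fent G)), a, b, m1, m2)
      | inr u => let: (s', a, b, m1, m2) := fdel u x y in
                 (omap inr s', a, b, m1, m2) end)
    (match fqry F, fqry G with
     | Some (s, a), _ => Some (inl s, inl a)
     | None, Some (s, a) => Some (inr s, inr a)
     | None, None => None end).

Definition fbr (p : Sym -> Sym -> bool) (F G : frag) : frag :=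
  @Frag (option (fstate F + fstate G)) None
    (fun s x y => match s with
      | None => (Some (Some (if p x y then inl (fent F) else inr (fent G))), x, y, Stay, Stay)
      | Some (inl u) => let: (s', a, b, m1, m2) := fdel u x y in
                 (if s' is Some v then Some (Some (inl v)) else None, a, b, m1, m2)
      | Some (inr u) => let: (s', a, b, m1, m2) := fdel u x y in
                 (if s' is Some v then Some (Some (inr v)) else None, a, b, m1, m2) end)
    (match fqry F, fqry G with
     | Some (s, a), _ => Some (Some (inl s), Some (inl a))
     | None, Some (s, a) => Some (Some (inr s), Some (inr a))
     | None, None => None end).

(** [None] is the loop head. An exit [None] of the body is turned into [Some None], which leads back
    to it; only the head can exit. *)
Definition fwh (p : Sym -> Sym -> bool) (F : frag) : frag :=
  @Frag (option (fstate F)) None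
    (fun s x y => match s with
      | None => (if p x y then Some (Some (fent F)) else None, x, y, Stay, Stay)
      | Some u => let: (s', a, b, m1, m2) := fdel u x y in
                 (Some s', a, b, m1, m2) end)
    (omap (fun u => (Some u.1, Some u.2)) (fqry F)).

Lemma fqry_seq0 F G : fqry F = None -> fqry G = None -> fqry (fseq F G) = None.
Proof. by move=> /= -> ->. Qed.

Lemma fqry_br0 p F G : fqry F = None -> fqry G = None -> fqry (fbr p F G) = None.
Proof. by move=> /= -> ->. Qed.

Lemma fqry_wh0 p F : fqry F = None -> fqry (fwh p F) = None.
Proof. by move=> /= ->. Qed.

Lemma twrite_id t : twrite (thead t) t = t. Proof. by case: t. Qed.

Section Combinators.
Variables (O : seq bool -> seq bool) (P : seq bool -> Prop).
Notation fok := (fok O P).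

Lemma fok_act a w q u v m1 m2 : a (thead w) (thead q) = (u, v, m1, m2) ->
  fok (fact a) w q (tmove m1 (twrite u w)) (tmove m2 (twrite v q)) 1.
Proof.
move=> H; apply: FStep; [by []| by rewrite /= H |exact: FDone].
Qed.

Lemma fok_seq F G w q w1 q1 n1 w2 q2 n2 :
  fqry F = None \/ fqry G = None ->
  fok F w q w1 q1 n1 -> fok G w1 q1 w2 q2 n2 ->
  fok (fseq F G) w q w2 q2 (n1 + n2).
Proof.
move=> hq H1 H2.
apply: (@frun_lift O P F (fseq F G) inl (Some (inr (fent G))) _ _ _ (Some (fent F)) _ _ _ _ _ _ _ _ H1).
- by move=> s x y /=; case: fdel => [[[[? ?] ?] ?] ?].
- by move=> s /=; case: (fqry F) => [[u v]|] //=; case: (fqry G) => [[u v]|].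
- by move=> s a /= ->.
rewrite -[n2]addn0.
apply: (@frun_lift O P G (fseq F G) inr None _ _ _ (Some (fent G)) _ _ _ _ _ _ _ _ H2 (FDone _ _ _ _ _)).
- by move=> s x y /=; case: fdel => [[[[? ?] ?] ?] ?].
- by move=> s /=; case: (fqry F) => [[u v]|] //=; case: (fqry G) => [[u v]|].
- by move=> s a /=; case: hq => -> // ->.
Qed.

Lemma fok_br_true (p : Sym -> Sym -> bool) F G w q w1 q1 n1 : p (thead w) (thead q) ->
  fok F w q w1 q1 n1 -> fok (fbr p F G) w q w1 q1 n1.+1.
Proof.
move=> hp H1; apply: FStep.
- by rewrite /=; case: (fqry F) => [[u v]|] //=; case: (fqry G) => [[u v]|].
- by rewrite /= hp.
rewrite /= !twrite_id -[n1]addn0.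
apply: (@frun_lift O P F (fbr p F G) (fun u => Some (inl u)) None _ _ _ (Some (fent F)) _ _ _ _ _ _ _ _ H1 (FDone _ _ _ _ _)).
- by move=> s x y /=; case: fdel => [[[[? ?] ?] ?] ?].
- by move=> s /=; case: (fqry F) => [[u v]|] //=; case: (fqry G) => [[u v]|].
- by move=> s a /= ->.
Qed.

Lemma fok_br_false (p : Sym -> Sym -> bool) F G w q w1 q1 n1 : ~~ p (thead w) (thead q) ->
  fqry F = None \/ fqry G = None ->
  fok G w q w1 q1 n1 -> fok (fbr p F G) w q w1 q1 n1.+1.
Proof.
move=> hp hq H1; apply: FStep.
- by rewrite /=; case: (fqry F) => [[u v]|] //=; case: (fqry G) => [[u v]|].
- by rewrite /= (negbTE hp).
rewrite /= !twrite_id -[n1]addn0.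
apply: (@frun_lift O P G (fbr p F G) (fun u => Some (inr u)) None _ _ _ (Some (fent G)) _ _ _ _ _ _ _ _ H1 (FDone _ _ _ _ _)).
- by move=> s x y /=; case: fdel => [[[[? ?] ?] ?] ?].
- by move=> s /=; case: (fqry F) => [[u v]|] //=; case: (fqry G) => [[u v]|].
- by move=> s a /=; case: hq => -> // ->.
Qed.

Lemma fok_wh_done (p : Sym -> Sym -> bool) F w q : ~~ p (thead w) (thead q) ->
  fok (fwh p F) w q w q 1.
Proof.
move=> hp; apply: FStep.
- by rewrite /=; case: (fqry F) => [[u v]|].
- by rewrite /= (negbTE hp).
by rewrite /= !twrite_id; exact: FDone.
Qed.

Lemma fok_wh_step (p : Sym -> Sym -> bool) F w q w1 q1 n1 w2 q2 n2 : p (thead w) (thead q) ->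
  fok F w q w1 q1 n1 -> fok (fwh p F) w1 q1 w2 q2 n2 ->
  fok (fwh p F) w q w2 q2 (n1 + n2).+1.
Proof.
move=> hp H1 H2; apply: FStep.
- by rewrite /=; case: (fqry F) => [[u v]|].
- by rewrite /= hp.
rewrite /= !twrite_id.
apply: (@frun_lift O P F (fwh p F) Some (Some None) _ _ _ (Some (fent F)) _ _ _ _ _ _ _ _ H1 H2).
- by move=> s x y /=; case: fdel => [[[[[?|] ?] ?] ?] ?].
- by move=> s /=; case: (fqry F) => [[u v]|].
- by move=> s a /= ->.
Qed.
End Combinators.

(** [None] is the halting state. A fragment without query gets the unreachable state [Some None] as
    its query and answer state. *)
Definition otm_of (F : frag) : OTM :=
  @Build_OTM (option (option (fstate F))) (Some (Some (fent F))) None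
   (Some (omap (fun u => u.1) (fqry F)))
   (Some (omap (fun u => u.2) (fqry F)))
   (fun s x y => if s is Some (Some u) then
        let: (s', a, b, m1, m2) := fdel u x y in
        (if s' is Some v then Some (Some v) else None, a, b, m1, m2)
      else (None, x, y, Stay, Stay)).

Lemma otm_of_run O P F x w q n :
  fok O P F (tape_of x) (tape_of [::]) w q n ->
  runs_within (otm_of F) O x n (tword w) P.
Proof.
move=> H; exists n; split=> //.
pose emb (so : option (fstate F)) : state (otm_of F) :=
  if so is Some v then Some (Some v) else None.
suff G : forall so w q w' q' n, frun O P so w q w' q' n ->
    iter n (step O) (@Cfg (otm_of F) (emb so) w q) = @Cfg (otm_of F) None w' q' /\
    forall i, i < n ->
      cstate (iter i (step O) (@Cfg (otm_of F) (emb so) w q)) = q_query (otm_of F) ->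
      P (tword (cquery (iter i (step O) (@Cfg (otm_of F) (emb so) w q)))).
  have [G1 G2] := G _ _ _ _ _ _ H.
  by rewrite /run /init G1.
move=> {x w q n H} so w q w' q' n; elim => {so w q w' q' n}.
- by [].
- move=> s w q s' a b m1 m2 w' q' n ns del _ [IH1 IH2].
  have st : step O (@Cfg (otm_of F) (emb (Some s)) w q) =
     @Cfg (otm_of F) (emb s') (tmove m1 (twrite a w)) (tmove m2 (twrite b q)).
    rewrite /step /=.
    have -> : (Some (Some s) == Some (omap (fun u => u.1) (fqry F))) = false.
      by apply/negbTE; apply: contraNneq ns => -[<-].
    by rewrite del.
  split; first by rewrite iterSr st.
  case=> [|i] hi; last by rewrite iterSr st; apply: IH2.
  by rewrite /= => -[E]; case/eqP: ns; rewrite -E.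
- move=> s a w q w' q' n fq Pq _ [IH1 IH2].
  have st : step O (@Cfg (otm_of F) (emb (Some s)) w q) =
     @Cfg (otm_of F) (emb (Some a)) w (tape_of (O (tword q))).
    by rewrite /step /= fq /= eqxx.
  split; first by rewrite iterSr st.
  by case=> [|i] hi; [|rewrite iterSr st; apply: IH2].
Qed.

(** * A language of stack programs *)

(* [Case i ce c0 c1] pops stack [i] and branches on the popped bit, [ce] being the
   branch for an empty stack.  [For i c0 c1 c] repeats, until stack [i] is empty:
   pop a bit, run [c0] or [c1] accordingly, then run [c]. *)
Inductive cmd :=
| Skip
| Push (i : nat) (b : bool)
| Case (i : nat) (ce c0 c1 : cmd)
| Seq (c1 c2 : cmd)
| For (i : nat) (c0 c1 c : cmd)
| Query.

Notation "c ;; d" := (Seq c d) (at level 62, right associativity).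

Notation sO := 0 (only parsing).
Notation sX := 1 (only parsing).
Notation sT1 := 2 (only parsing).
Notation sT2 := 3 (only parsing).
Notation sT3 := 4 (only parsing).
Notation sAct := 5 (only parsing).
Notation sErr := 6 (only parsing).
Notation sN := 7 (only parsing).
Notation sK := 8 (only parsing).
Notation sA := 9 (only parsing).
Notation sL := 10 (only parsing).
Notation sC := 11 (only parsing).
Notation sD := 12 (only parsing).
Notation sU1 := 13 (only parsing).
Notation sU2 := 14 (only parsing).
Notation sKB := 15 (only parsing).
Notation sJ := 16 (only parsing).
Notation sM := 17 (only parsing).
Notation sJ2 := 18 (only parsing).
Notation sNP := 19 (only parsing).
Notation sAcc := 20 (only parsing).
Notation sCt := 21 (only parsing).
Notation sSg := 22 (only parsing).
Notation sD2 := 23 (only parsing).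
Notation sA2 := 24 (only parsing).
Notation sPh := 25 (only parsing).
Notation sLive := 26 (only parsing).
Notation sM2 := 27 (only parsing).
Notation sY := 28 (only parsing).
Notation sZ := 29 (only parsing).

Definition store := nat -> seq bool.

Definition upd (s : store) (i : nat) (v : seq bool) : store :=
  fun k => if k == i then v else s k.

Section Exec.
Variables (O : seq bool -> seq bool) (P : seq bool -> Prop).

(* The last argument is only an upper bound for the cost. *)
Inductive exec : cmd -> store -> store -> nat -> Prop :=
| ESkip s t : 0 < t -> exec Skip s s t
| EPush i b s t : 0 < t -> exec (Push i b) s (upd s i (b :: s i)) t
| ECase0 i ce c0 c1 s s' t0 t : s i = [::] -> exec ce s s' t0 -> t0 < t ->
    exec (Case i ce c0 c1) s s' t
| ECase1 i ce c0 c1 s s' b l t0 t : s i = b :: l ->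
    exec (if b then c1 else c0) (upd s i l) s' t0 -> t0 < t ->
    exec (Case i ce c0 c1) s s' t
| ESeq c1 c2 s s1 s2 t1 t2 t : exec c1 s s1 t1 -> exec c2 s1 s2 t2 ->
    t1 + t2 <= t -> exec (c1 ;; c2) s s2 t
| EFor0 i c0 c1 c s t : s i = [::] -> 0 < t -> exec (For i c0 c1 c) s s t
| EFor1 i c0 c1 c s b l s1 s2 s3 t1 t2 t3 t : s i = b :: l ->
    exec (if b then c1 else c0) (upd s i l) s1 t1 -> exec c s1 s2 t2 ->
    exec (For i c0 c1 c) s2 s3 t3 -> t1 + t2 + t3 < t ->
    exec (For i c0 c1 c) s s3 t
| EQuery s t : P (s 0) -> 0 < t -> exec Query s (upd s 0 (O (s 0))) t.
End Exec.

(** Counts occurrences in the text, not executions: only one query state survives compilation, but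
    loops may pass through it any number of times. *)
Fixpoint queries (c : cmd) : nat :=
  match c with
  | Skip | Push _ _ => 0
  | Case _ c1 c2 c3 => queries c1 + queries c2 + queries c3
  | Seq c1 c2 => queries c1 + queries c2
  | For _ c1 c2 c3 => queries c1 + queries c2 + queries c3
  | Query => 1
  end.

Fixpoint stacks_below (B : nat) (c : cmd) : bool :=
  match c with
  | Skip | Query => true
  | Push i _ => i < B
  | Case i c1 c2 c3 | For i c1 c2 c3 =>
      [&& i < B, stacks_below B c1, stacks_below B c2 & stacks_below B c3]
  | Seq c1 c2 => stacks_below B c1 && stacks_below B c2
  end.

(** * Compilation to one work tape *)

(** Tapes have no coordinates; [f] supplies them, cell [p] being under the head. Everything left of
    cell 0 is blank, and [nth None] ignores how many outer blanks the two lists store explicitly. *)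
Definition at_pos (t : tape) (f : nat -> Sym) (p : nat) :=
  (forall i, nth None (thead t :: tright t) i = f (p + i)) /\
  (forall i, nth None (tleft t) i = if i < p then f (p - i.+1) else None).

Lemma at_pos_head t f p : at_pos t f p -> thead t = f p.
Proof. by case=> /(_ 0) /= -> _; rewrite addn0. Qed.

Lemma at_pos_right t f p : at_pos t f p -> at_pos (tmove MoveR t) f p.+1.
Proof.
case: t => l h r [/= H1 H2]; split=> i.
  rewrite addSnnS -H1; case: (r) => [|x r'] //=.
  by case: i => [|i] //=; rewrite nth_nil.
have H0 : nth None (h :: l) i = if i < p.+1 then f (p.+1 - i.+1) else None.
  case: i => [|i] /=; first by have := H1 0; rewrite /= addn0 subn1.
  by rewrite H2 ltnS subSS.
by case: (r).
Qed.

Lemma at_pos_left t f p : at_pos t f p.+1 -> at_pos (tmove MoveL t) f p.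
Proof.
case: t => l h r [/= H1 H2]; split=> i.
  case: i => [|i].
    by have := H2 0; rewrite subn1 addn0 => /= <-; case: (l).
  by rewrite addnS -addSn -H1; case: (l).
have := H2 i.+1; rewrite ltnS subSS.
by move=> <-; case: (l) => [|x l'] //=; rewrite nth_nil.
Qed.

Lemma at_pos_write t f p a :
  at_pos t f p -> at_pos (twrite a t) (fun k => if k == p then a else f k) p.
Proof.
case: t => l h r [H1 H2]; split=> i /=.
  case: i => [|i] /=; first by rewrite addn0 eqxx.
  have -> : (p + i.+1 == p) = false by lia.
  by have := H1 i.+1.
rewrite H2; case: ltnP => // hi.
by have -> : (p - i.+1 == p) = false by lia.
Qed.

Lemma at_pos_ext t f g p : f =1 g -> at_pos t f p -> at_pos t g p.
Proof. by move=> E [H1 H2]; split=> i; rewrite -?E // H2; case: ltnP; rewrite ?E. Qed.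

Lemma tword_head t : thead t = ohead (tword t).
Proof. by case: t => ? [?|] ?. Qed.

Lemma tword_push b t : tword (twrite (Some b) (tmove MoveL t)) = b :: tword t.
Proof. by case: t => [[|? ?] ? ?]. Qed.

Lemma tword_pop b l t :
  tword t = b :: l -> tword (tmove MoveR (twrite None t)) = l.
Proof. by case: t => ? [?|] [|x r] //= [_ <-]. Qed.

Section Compile.
Variable B : nat.

(* Stack [i > 0] occupies the cells [q * B + i]; cell 0 marks the home position. *)
Definition cell (s : store) (p : nat) : Sym :=
  if p %% B == 0 then (if p == 0 then Some true else None)
  else nth None (map Some (rev (s (p %% B)))) (p %/ B).

Definition rep (p : nat) (s : store) (w q : tape) : Prop :=
  at_pos w (cell s) p /\ tword q = s 0.

Fixpoint moves (n : nat) (m : Move) : frag :=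
  if n is n'.+1 then fseq (fact (fun x y => (x, y, m, Stay))) (moves n' m)
  else fact (fun x y => (x, y, Stay, Stay)).

Definition write (v : Sym) : frag := fact (fun x y => (v, y, Stay, Stay)).
Definition opush (b : bool) : frag :=
  fseq (fact (fun x y => (x, y, Stay, MoveL))) (fact (fun x y => (x, Some b, Stay, Stay))).
Definition opop : frag := fact (fun x y => (x, None, Stay, MoveR)).
Definition skip : frag := fact (fun x y => (x, y, Stay, Stay)).
(** Strides of [B] stay on the track of one stack. Bits are stored from the bottom up, so the first
    blank lies just above the top. On the track of cell 0 all other cells are blank, so [home] stops
    exactly there. *)
Definition to_top : frag := fwh (fun x _ => x != None) (moves B MoveR).
Definition home : frag := fwh (fun x _ => x == None) (moves B MoveL).

Definition cpush (i : nat) (b : bool) : frag :=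
  if i == 0 then opush b else
  fseq (moves i MoveR) (fseq to_top (fseq (write (Some b)) (fseq (moves i MoveL) home))).

(** [to_top] stops one stride beyond the top, hence the stride back. The top of stack 0 is always
    under the oracle head. *)
Definition seek (i : nat) : frag :=
  if i == 0 then skip else fseq to_top (moves B MoveL).
Definition take1 (i : nat) : frag :=
  if i == 0 then opop else fseq (write None) (fseq (moves i MoveL) home).
Definition look (i : nat) (x y : Sym) : Sym := if i == 0 then y else x.
Definition fetch (i : nat) (F0 F1 : frag) : frag :=
  fseq (seek i) (fbr (fun x y => look i x y == Some true)
                     (fseq (take1 i) F1) (fseq (take1 i) F0)).

(** Between commands the work head is on the home cell. Emptiness of stack [i] is read off its
    bottom cell, [i] moves to the right; a loop performs its test there, so its body ends by
    returning to that cell. *)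
Fixpoint comp (c : cmd) : frag :=
  match c with
  | Skip => skip
  | Push i b => cpush i b
  | Case i ce c0 c1 =>
      fseq (moves i MoveR) (fbr (fun x y => look i x y == None)
        (fseq (moves i MoveL) (comp ce)) (fetch i (comp c0) (comp c1)))
  | Seq c1 c2 => fseq (comp c1) (comp c2)
  | For i c0 c1 c =>
      fseq (moves i MoveR)
        (fseq (fwh (fun x y => look i x y != None)
          (fseq (fetch i (comp c0) (comp c1)) (fseq (comp c) (moves i MoveR))))
        (moves i MoveL))
  | Query => @Frag bool true (fun s x y => (None, x, y, Stay, Stay)) (Some (true, false))
  end.

Lemma fqry_moves n m : fqry (moves n m) = None.
Proof. by elim: n => //= n ->. Qed.

Lemma fqry_seek i : fqry (seek i) = None.
Proof. by rewrite /seek; case: eqP => // _; rewrite /= !fqry_moves. Qed.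
Lemma fqry_take1 i : fqry (take1 i) = None.
Proof. by rewrite /take1; case: eqP => // _; rewrite /= !fqry_moves. Qed.
Lemma fqry_cpush i b : fqry (cpush i b) = None.
Proof. by rewrite /cpush; case: eqP => // _; rewrite /= !fqry_moves. Qed.

Lemma fqry_comp c : queries c = 0 -> fqry (comp c) = None.
Proof.
elim: c => //=.
- by move=> i b _; rewrite fqry_cpush.
- by move=> i ce IHe c0 IH0 c1 IH1 H; rewrite !fqry_moves fqry_seek fqry_take1 IHe ?IH0 ?IH1 //; lia.
- by move=> c1 IH1 c2 IH2 H; rewrite IH1 ?IH2 //; lia.
- by move=> i c0 IH0 c1 IH1 c IH H; rewrite !fqry_moves fqry_seek fqry_take1 IH ?IH0 ?IH1 //; lia.
Qed.

Section Correct.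
Variables (O : seq bool -> seq bool) (P : seq bool -> Prop).
Notation fok := (fok O P).
Notation exec := (exec O P).

Lemma fok_skip w q : fok skip w q w q 1.
Proof.
have := @fok_act O P (fun x y => (x, y, Stay, Stay)) w q _ _ _ _ erefl.
by rewrite /= !twrite_id.
Qed.

Lemma fok_right k w q f p : at_pos w f p ->
  exists2 w', fok (moves k MoveR) w q w' q k.+1 & at_pos w' f (p + k).
Proof.
elim: k w p => [|k IH] w p H; first by exists w; [exact: fok_skip | rewrite addn0].
have [w' H1 H2] := IH _ _ (at_pos_right H).
exists w'; last by rewrite addnS -addSn.
apply: (@fok_seq _ _ _ _ _ _ (tmove MoveR w) q 1 _ _ _) => //; first by left.
have := @fok_act O P (fun x y => (x, y, MoveR, Stay)) w q _ _ _ _ erefl.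
by rewrite !twrite_id.
Qed.

Lemma fok_left k w q f p : at_pos w f (p + k) ->
  exists2 w', fok (moves k MoveL) w q w' q k.+1 & at_pos w' f p.
Proof.
elim: k w p => [|k IH] w p H; first by exists w; [exact: fok_skip | rewrite addn0 in H].
rewrite addnS in H.
have [w' H1 H2] := IH _ _ (at_pos_left H).
exists w' => //.
apply: (@fok_seq _ _ _ _ _ _ (tmove MoveL w) q 1 _ _ _) => //; first by left.
have := @fok_act O P (fun x y => (x, y, MoveL, Stay)) w q _ _ _ _ erefl.
by rewrite !twrite_id.
Qed.

Lemma fok_write v w q f p : at_pos w f p ->
  exists2 w', fok (write v) w q w' q 1 &
    at_pos w' (fun k => if k == p then v else f k) p.
Proof.
move=> H; exists (twrite v w); last exact: at_pos_write.
have := @fok_act O P (fun x y => (v, y, Stay, Stay)) w q _ _ _ _ erefl.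
by rewrite /= !twrite_id.
Qed.

Lemma cellE s q i : 0 < i < B -> cell s (q * B + i) = nth None (map Some (rev (s i))) q.
Proof.
move=> /andP[i0 iB]; rewrite /cell modnMDl modn_small // divnMDl ?(ltn_trans i0) //.
by rewrite divn_small // addn0 (gtn_eqF i0).
Qed.

Lemma fok_to_top s i w q k : 0 < i < B -> k <= size (s i) -> at_pos w (cell s) (k * B + i) ->
  exists2 w', fok to_top w q w' q ((size (s i) - k) * B.+2).+1 &
    at_pos w' (cell s) (size (s i) * B + i).
Proof.
move=> hi; move En: (size (s i) - k) => n; elim: n k w En => [|n IH] k w En hk H.
  have -> : size (s i) = k by lia.
  exists w => //; apply: fok_wh_done.
  by rewrite (at_pos_head H) cellE // nth_default // size_map size_rev; lia.
have [w1 H1 H2] := fok_right B q H.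
have [||| w2 H3 H4] := IH k.+1 w1; rewrite ?mulSn; try lia.
  by move: H2; congr at_pos; lia.
exists w2 => //.
have -> : (n.+1 * B.+2).+1 = (B.+1 + (n * B.+2).+1).+1 by lia.
apply: fok_wh_step H1 H3.
rewrite (at_pos_head H) cellE // (nth_map true) ?size_rev //; lia.
Qed.

Lemma fok_home s w q k : 0 < B -> at_pos w (cell s) (k * B) ->
  exists2 w', fok home w q w' q (k * B.+2).+1 & at_pos w' (cell s) 0.
Proof.
move=> B0; elim: k w => [|k IH] w H.
  exists w => //; apply: fok_wh_done.
  by rewrite (at_pos_head H) /cell mod0n.
have [|w1 H1 H2] := @fok_left B w q (cell s) (k * B); first by move: H; congr at_pos; lia.
have [w2 H3 H4] := IH _ H2.
exists w2 => //.
have -> : (k.+1 * B.+2).+1 = (B.+1 + (k * B.+2).+1).+1 by lia.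
apply: fok_wh_step H1 H3.
by rewrite (at_pos_head H) /cell modnMl eqxx muln_eq0 /= (gtn_eqF B0).
Qed.

Lemma cell_upd0 s v : cell (upd s 0 v) =1 cell s.
Proof. by move=> p; rewrite /cell /upd; case: eqP. Qed.

Lemma cell_push s i b : 0 < i < B -> 
  (fun k => if k == size (s i) * B + i then Some b else cell s k) =1 cell (upd s i (b :: s i)).
Proof.
move=> hi p; have B0 : 0 < B by lia.
case: eqP => [->|ne].
  by rewrite cellE // /upd eqxx rev_cons map_rcons nth_rcons size_map size_rev ltnn eqxx.
rewrite /cell /upd; case: eqP => // _; case: eqP => // E.
rewrite E rev_cons map_rcons nth_rcons size_map size_rev.
case: ltnP => // hs; rewrite nth_default ?size_map ?size_rev //.
case: eqP => // E2; case: ne.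
by rewrite [LHS](divn_eq p B) E E2.
Qed.

(** A pop undoes a push: [cell_push], applied to the store after the pop, gives the contents before
    it. *)
Lemma cell_pop s i b l : 0 < i < B -> s i = b :: l ->
  (fun k => if k == size l * B + i then None else cell s k) =1 cell (upd s i l).
Proof.
move=> hi Es p; have B0 : 0 < B by lia.
have -> : s = upd (upd s i l) i (b :: upd s i l i).
  by apply: functional_extensionality => k; rewrite /upd eqxx; case: eqP => // ->.
set s' := upd s i l.
have -> : l = s' i by rewrite /s' /upd eqxx.
rewrite -[in RHS](_ : s' = upd (upd s' i (b :: s' i)) i (s' i)); last first.
  by apply: functional_extensionality => k; rewrite /upd; case: eqP => // ->.
rewrite -cell_push //; case: eqP => // ->.
by rewrite cellE // nth_default // size_map size_rev.
Qed.

(** The work tape is traversed up to the top of the stack, hence a cost linear in its height. Stack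
    0 takes constant time, whatever height an oracle answer has given it. *)
Lemma fok_cpush i b s w q m : i < B -> (0 < i -> size (s i) <= m) -> rep 0 s w q ->
  exists w' q' n, [/\ fok (cpush i b) w q w' q' n, rep 0 (upd s i (b :: s i)) w' q' &
    n <= (4 * B + 20) * m.+1].
Proof.
move=> hi hm [H1 H2]; rewrite /cpush; case: posnP => [i0|i0].
  subst i; exists w, (twrite (Some b) (tmove MoveL q)), 2; split; last by nia.
    apply: (@fok_seq O P _ _ _ _ w (tmove MoveL q) 1 _ _ 1); first by left.
      have := @fok_act O P (fun x y => (x, y, Stay, MoveL)) w q _ _ _ _ erefl.
      by rewrite /= !twrite_id.
    have := @fok_act O P (fun x y => (x, Some b, Stay, Stay)) w (tmove MoveL q) _ _ _ _ erefl.
    by rewrite /= !twrite_id.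
  split; first by apply: at_pos_ext H1 => p; rewrite cell_upd0.
  by rewrite tword_push H2.
have hi' : 0 < i < B by rewrite i0.
have {}hm := hm i0.
have [w1 R1 A1] := fok_right i q H1.
have [||w2 R2 A2] := @fok_to_top s i w1 q 0 hi' => //.
have [w3 R3 A3] := fok_write (Some b) q A2.
have [w4 R4 A4] := fok_left q A3.
have [||w5 R5 A5] := @fok_home (upd s i (b :: s i)) w4 q (size (s i)); first by lia.
  by apply: at_pos_ext A4; apply: cell_push.
exists w5, q; eexists; split.
- apply: fok_seq R1 _; first by left; rewrite fqry_moves.
  apply: fok_seq R2 _; first by left; rewrite /= fqry_moves.
  apply: fok_seq R3 _; first by left.
  apply: fok_seq R4 R5; first by left; rewrite fqry_moves.
- by split=> //; rewrite /upd (ltn_eqF i0).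
- nia.
Qed.

(** The popped bit survives only in the control state, so the branch is not a separate sequential
    fragment: its run is quantified over and inserted into the run of the whole. *)
Lemma fok_fetch i b l s w q F0 F1 m : i < B -> (0 < i -> size (s i) <= m) ->
  s i = b :: l -> rep i s w q ->
  fqry F0 = None \/ fqry F1 = None ->
  exists w1 q1, rep 0 (upd s i l) w1 q1 /\ forall w' q' n,
    fok (if b then F1 else F0) w1 q1 w' q' n ->
    exists2 n', fok (fetch i F0 F1) w q w' q' n' & n' <= (4 * B + 20) * m.+1 + n.
Proof.
move=> hi hm Es [H1 H2] hF; rewrite /fetch.
have [w1 [n1 [R1 hn1 L1 T1]]] : exists w1 n1, [/\ fok (seek i) w q w1 q n1,
    n1 <= (2 * B + 7) * m.+1,
    look i (thead w1) (thead q) = Some b &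
    exists w2 q2 n2, [/\ fok (take1 i) w1 q w2 q2 n2, rep 0 (upd s i l) w2 q2 &
      n2 <= (2 * B + 7) * m.+1]].
  rewrite /seek /take1 /look; case: posnP => [i0|i0].
    subst i; exists w, 1; split; [exact: fok_skip | nia | |].
      by rewrite /= tword_head H2 Es.
    exists w, (tmove MoveR (twrite None q)), 1; split; last by nia.
      have := @fok_act O P (fun x y => (x, None, Stay, MoveR)) w q _ _ _ _ erefl.
      by rewrite /= !twrite_id.
    split; first by apply: at_pos_ext H1 => p; rewrite cell_upd0.
    by rewrite /upd eqxx; apply: (@tword_pop b); rewrite H2.
  have hi' : 0 < i < B by rewrite i0.
  have {}hm := hm i0; rewrite Es /= in hm.
  have [||w1 R1 A1] := @fok_to_top s i w q 0 hi' => //.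
  have [|w2 R2 A2] := @fok_left B w1 q (cell s) (size l * B + i).
    by move: A1; congr at_pos; rewrite Es /=; lia.
  exists w2; eexists; split.
  - by apply: fok_seq R1 R2; left; rewrite /= fqry_moves.
  - rewrite Es /=; nia.
  - rewrite (at_pos_head A2) cellE // Es rev_cons map_rcons nth_rcons size_map size_rev.
    by rewrite ltnn eqxx.
  have [w3 R3 A3] := fok_write None q A2.
  have [w4 R4 A4] := fok_left q A3.
  have [||w5 R5 A5] := @fok_home (upd s i l) w4 q (size l); first by lia.
    by apply: at_pos_ext A4; apply: cell_pop Es.
  exists w5, q; eexists; split.
  - apply: fok_seq R3 _; first by left.
    by apply: fok_seq R4 R5; left; rewrite fqry_moves.
  - by split=> //; rewrite /upd (ltn_eqF i0).
  - nia.
have [w2 [q2 [n2 [R2 A2 hn2]]]] := T1.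
exists w2, q2; split=> // w' q' n R3.
exists (n1 + (n2 + n).+1); last by nia.
apply: fok_seq R1 _; first by left; rewrite fqry_seek.
case: b Es L1 R3 => Es L1 R3.
  apply: fok_br_true; first by rewrite L1.
  by apply: fok_seq R2 R3; left; rewrite fqry_take1.
apply: fok_br_false; first by rewrite L1.
  by case: hF => hF; [right|left]; rewrite /= fqry_take1 hF.
by apply: fok_seq R2 R3; left; rewrite fqry_take1.
Qed.

Lemma look_empty i s w q : i < B -> rep i s w q ->
  (look i (thead w) (thead q) == None) = nilp (s i).
Proof.
move=> hi [H1 H2]; rewrite /look; case: posnP => [i0|i0].
  by subst i; rewrite tword_head H2; case: (s 0).
have hi' : 0 < i < B by rewrite i0.
rewrite (at_pos_head H1) -[X in cell s X]add0n -(mul0n B) cellE //.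
rewrite /nilp -(size_rev (s i)).
by case: (rev (s i)).
Qed.

(** One unit of cost adds at most one bit to a stack of the work tape. Stack 0 is exempt, since a
    query replaces it by an answer of any length. *)
Lemma exec_size c s s' t : exec c s s' t -> forall m, (forall i, 0 < i -> size (s i) <= m) ->
  forall i, 0 < i -> size (s' i) <= m + t.
Proof.
elim=> {c s s' t}.
- by move=> s t ht m H i hi; apply: leq_trans (H _ hi) _; lia.
- move=> j b s t ht m H i hi; rewrite /upd; have := H _ hi.
  by case: eqP => [->|] /=; lia.
- by move=> j ce c0 c1 s s' t0 t Es _ IH ht m H i hi; have := IH _ H i hi; lia.
- move=> j ce c0 c1 s s' b l t0 t Es _ IH ht m H i hi.
  suff : size (s' i) <= m + t0 by lia.
  apply: IH => // k hk; rewrite /upd; case: eqP => [E|_]; last exact: H.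
  by have := H _ hk; rewrite E Es /=; lia.
- move=> c1 c2 s s1 s2 t1 t2 t _ IH1 _ IH2 ht m H i hi.
  by have := IH2 (m + t1) (IH1 _ H) i hi; lia.
- by move=> j c0 c1 c s t Es ht m H i hi; apply: leq_trans (H _ hi) _; lia.
- move=> j c0 c1 c s b l s1 s2 s3 t1 t2 t3 t Es _ IH1 _ IH2 _ IH3 ht m H i hi.
  have H1 : forall i, 0 < i -> size (s1 i) <= m + t1.
    apply: IH1 => // k hk; rewrite /upd; case: eqP => [E|_]; last exact: H.
    by have := H _ hk; rewrite E Es /=; lia.
  by have := IH3 (m + t1 + t2) (IH2 _ H1) i hi; lia.
- by move=> s t _ ht m H i hi; rewrite /upd (gtn_eqF hi); apply: leq_trans (H _ hi) _; lia.
Qed.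
Definition step_cost := 6 * B + 40.
(** Each of [t] abstract steps is charged for traversals of the tallest stack, whose height never
    exceeds [m + t] by [exec_size]. *)
Definition time_bound m t := step_cost * (m + t).+1 * t.

Lemma time_bound_gt0 m t : 0 < t -> step_cost * m.+1 <= time_bound m t.
Proof. by move=> ht; rewrite /time_bound; case: t ht => // t _; nia. Qed.

Lemma time_boundD m t1 t2 t : t1 + t2 <= t ->
  time_bound m t1 + time_bound (m + t1) t2 <= time_bound m t.
Proof.
move=> ht; rewrite /time_bound -addnA.
apply: leq_trans (_ : step_cost * (m + (t1 + t2)).+1 * (t1 + t2) <= _).
  rewrite mulnDr leq_add2r; apply: leq_mul => //; apply: leq_mul => //; lia.
by apply: leq_mul => //; apply: leq_mul => //; lia.
Qed.

Lemma time_boundS m t0 t : t0 < t -> step_cost * m.+1 + time_bound m t0 <= time_bound m t.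
Proof.
move=> ht; apply: leq_trans (@time_boundD m t0 1 t _); last by rewrite addn1.
by rewrite addnC leq_add2l /time_bound muln1; apply: leq_mul => //; lia.
Qed.

Lemma step_costE m : (4 * B + 20) * m.+1 + (2 * B + 20) <= step_cost * m.+1.
Proof. by rewrite /step_cost; nia. Qed.

(** The second conjunct makes the induction work: the premise of [EFor1] on the remaining iterations
    starts inside the loop, with the head on the bottom cell of stack [i] instead of home. The slack
    [2 * B + 4] pays for reaching that cell and returning. *)
Lemma comp_ok c s s' t : exec c s s' t ->
  queries c <= 1 -> stacks_below B c ->
  forall m, (forall i, 0 < i -> size (s i) <= m) ->
  (forall w q, rep 0 s w q -> exists w' q' n, [/\ fok (comp c) w q w' q' n,
    rep 0 s' w' q' & n <= time_bound m t]) /\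
  (if c is For i c0 c1 c then forall w q, rep i s w q ->
    exists w' q' n, [/\ fok (fwh (fun x y => look i x y != None)
        (fseq (fetch i (comp c0) (comp c1)) (fseq (comp c) (moves i MoveR)))) w q w' q' n,
      rep i s' w' q' & n + (2 * B + 4) <= time_bound m t] else True).
Proof.
have for_ok i c0 c1 d s0 s0' t0 m : i < B ->
  (forall w q, rep i s0 w q ->
    exists w' q' n, [/\ fok (fwh (fun x y => look i x y != None)
        (fseq (fetch i (comp c0) (comp c1)) (fseq (comp d) (moves i MoveR)))) w q w' q' n,
      rep i s0' w' q' & n + (2 * B + 4) <= time_bound m t0]) ->
  forall w q, rep 0 s0 w q -> exists w' q' n, [/\ fok (comp (For i c0 c1 d)) w q w' q' n,
     rep 0 s0' w' q' & n <= time_bound m t0].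
  move=> hi H w q [A1 E1]; have [w1 R1 B1] := fok_right i q A1.
  have [w2 [q2 [n2 [R2 [A2 E2] hn2]]]] := H w1 q (conj B1 E1).
  have [w3 R3 A3] := @fok_left i w2 q2 _ 0 A2.
  exists w3, q2; eexists; split.
  - apply: fok_seq R1 _; first by left; rewrite fqry_moves.
    by apply: fok_seq R2 R3; right; rewrite fqry_moves.
  - by split.
  - by lia.
have hupd (s0 : store) m i b l : (forall i, 0 < i -> size (s0 i) <= m) -> s0 i = b :: l ->
    forall k, 0 < k -> size (upd s0 i l k) <= m.
  move=> hm Es k hk; rewrite /upd; case: eqP => [E|_]; last exact: hm.
  by have := hm _ hk; rewrite E Es /=; lia.
elim=> {c s s' t} /=.
- move=> s t ht _ _ m hm; split=> // w q hr; exists w, q, 1; split=> //; first exact: fok_skip.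
  have := time_bound_gt0 m ht; have := step_costE m; nia.
- move=> i b s t ht _ hi m hm; split=> // w q hr.
  have [w' [q' [n [H1 H2 H3]]]] := fok_cpush b hi (hm i) hr.
  exists w', q', n; split=> //; have := time_bound_gt0 m ht; have := step_costE m; lia.
- move=> i ce c0 c1 s s' t0 t Es _ IH ht hq /and4P[hi he h0 h1] m hm; split=> // w q [A1 E1].
  have [w1 R1 A2] := fok_right i q A1.
  have [w2 R2 A3] := @fok_left i w1 q _ 0 A2.
  have [IH1 _] := IH (leq_trans (leq_addr _ _) (leq_trans (leq_addr _ _) hq)) he m hm.
  have [w3 [q3 [n3 [R3 A4 hn]]]] := IH1 w2 q (conj A3 E1).
  exists w3, q3; eexists; split.
  + apply: fok_seq R1 _; first by left; rewrite fqry_moves.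
    apply: fok_br_true; first by rewrite (@look_empty i s) ?Es.
    by apply: fok_seq R2 R3; left; rewrite fqry_moves.
  + exact: A4.
  + have := time_boundS m ht; have := step_costE m; lia.
- move=> i ce c0 c1 s s' b l t0 t Es _ IH ht hq /and4P[hi he h0 h1] m hm; split=> // w q [A1 E1].
  have [w1 R1 A1'] := fok_right i q A1.
  have [||IH1 _] := IH _ _ m (hupd _ _ _ _ _ hm Es); first by case: (b); lia.
    by case: (b).
  have hq2 : fqry (comp c0) = None \/ fqry (comp c1) = None.
    by case E: (queries c0) => [|k]; [left; apply: fqry_comp | right; apply: fqry_comp; lia].
  have [w2 [q2 [A2 R2]]] := fok_fetch hi (hm i) Es (conj A1' E1) hq2.
  have [w3 [q3 [n3 [R3 A3 hn3]]]] := IH1 _ _ A2.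
  have [n4 R4 hn4] : exists2 n4, fok (fetch i (comp c0) (comp c1)) w1 q w3 q3 n4 &
      n4 <= (4 * B + 20) * m.+1 + n3 by apply: R2; case: (b) R3.
  exists w3, q3, (i.+1 + n4.+1); split=> //.
  + apply: fok_seq R1 _; first by left; rewrite fqry_moves.
    apply: fok_br_false R4; first by rewrite (@look_empty i s) ?Es.
    case E: (queries ce) => [|k]; first by left; rewrite /= fqry_moves fqry_comp.
    by right; rewrite /= fqry_seek fqry_take1 !fqry_comp //; lia.
  + have := time_boundS m ht; have := step_costE m; lia.
- move=> c1 c2 s s1 s2 t1 t2 t H1 IH1 _ IH2 ht hq /andP[h1 h2] m hm; split=> // w q hr.
  have [||{}IH1 _] := IH1 _ _ m hm; [lia|by []|].
  have [||{}IH2 _] := IH2 _ _ (m + t1) (exec_size H1 hm); [lia|by []|].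
  have [w1 [q1 [n1 [R1 A1 hn1]]]] := IH1 _ _ hr.
  have [w2 [q2 [n2 [R2 A2 hn2]]]] := IH2 _ _ A1.
  exists w2, q2, (n1 + n2); split=> //.
  + apply: fok_seq R1 R2.
    by case E: (queries c1) => [|k]; [left|right]; apply: fqry_comp => //; lia.
  + have := time_boundD m ht; lia.
- move=> i c0 c1 c s t Es ht hq /and4P[hi h0 h1 h2] m hm.
  suff H : forall w q, rep i s w q -> exists w' q' n, [/\ fok (fwh (fun x y => look i x y != None)
        (fseq (fetch i (comp c0) (comp c1)) (fseq (comp c) (moves i MoveR)))) w q w' q' n,
      rep i s w' q' & n + (2 * B + 4) <= time_bound m t].
    by split=> //; apply: for_ok hi H.
  move=> w q hr; exists w, q, 1; split=> //.
    by apply: fok_wh_done; rewrite (@look_empty i s) ?Es.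
  have := time_bound_gt0 m ht; have := step_costE m; lia.
- move=> i c0 c1 c s b l s1 s2 s3 t1 t2 t3 t Es H1 IH1 H2 IH2 _ IH3 ht hq hw m hm.
  have /and4P[hi h0 h1 h2] := hw.
  suff H : forall w q, rep i s w q -> exists w' q' n, [/\ fok (fwh (fun x y => look i x y != None)
        (fseq (fetch i (comp c0) (comp c1)) (fseq (comp c) (moves i MoveR)))) w q w' q' n,
      rep i s3 w' q' & n + (2 * B + 4) <= time_bound m t].
    by split=> //; apply: for_ok hi H.
  have hm1 := exec_size H1 (hupd _ _ _ _ _ hm Es).
  have hm2 := exec_size H2 hm1.
  have [||{}IH1 _] := IH1 _ _ m (hupd _ _ _ _ _ hm Es); [by case: (b); lia|by case: (b)|].
  have [||{}IH2 _] := IH2 _ _ (m + t1) hm1; [by lia|by []|].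
  have [_ {}IH3] := IH3 hq hw (m + t1 + t2) hm2.
  have hq2 : fqry (comp c0) = None \/ fqry (comp c1) = None.
    by case E: (queries c0) => [|k]; [left; apply: fqry_comp | right; apply: fqry_comp; lia].
  move=> w q A0; have [w1 [q1 [A1 R1]]] := fok_fetch hi (hm i) Es A0 hq2.
  have [w2 [q2 [n2 [R2 A2 hn2]]]] := IH1 _ _ A1.
  have [n4 R4 hn4] : exists2 n4, fok (fetch i (comp c0) (comp c1)) w q w2 q2 n4 &
      n4 <= (4 * B + 20) * m.+1 + n2 by apply: R1; case: (b) R2.
  have [w3 [q3 [n3 [R3 [A3 E3] hn3]]]] := IH2 _ _ A2.
  have [w4 R5 A4] := fok_right i q3 A3.
  have [w5 [q5 [n5 [R6 A5 hn5]]]] := IH3 _ _ (conj A4 E3).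
  exists w5, q5, ((n4 + (n3 + i.+1)) + n5).+1; split=> //.
  + apply: fok_wh_step R6; first by rewrite (@look_empty i s) ?Es.
      apply: fok_seq R4 _; last first.
        by apply: fok_seq R3 R5; right; rewrite fqry_moves.
      case E: (queries c) => [|k]; first by right; rewrite /= fqry_moves fqry_comp.
      by left; rewrite /= fqry_seek fqry_take1 !fqry_comp //; lia.
  + have B1 := @time_boundD m t1 t2 _ (leqnn _).
    have B2 := @time_boundD m (t1 + t2) t3 _ (leqnn _).
    have B3 := time_boundS m ht; rewrite !addnA in B1 B2 B3.
    have := step_costE m; lia.
- move=> s t Ps ht _ _ m hm; split=> // w q [A E].
  exists w, (tape_of (O (tword q))), 2; split.
  + rewrite E in Ps *; apply: FQuery => //; first by rewrite E.
    rewrite -E; apply: FStep => //.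
    by rewrite /= !twrite_id; apply: FDone.
  + split; first by apply: at_pos_ext A => p; rewrite cell_upd0.
    by rewrite /upd eqxx E; case: (O _) => [|b l] //=; rewrite /tword /=; congr cons; elim: l => //= ? ? ->.
  + have := time_bound_gt0 m ht; have := step_costE m; lia.
Qed.
End Correct.
End Compile.

(** * Input and output of the compiled machine *)

Definition load_loop : frag :=
  fwh (fun x _ => x != None)
    (fseq (fbr (fun x _ => x == Some true) (opush true) (opush false))
          (fact (fun x y => (None, y, MoveR, Stay)))).

(** The input has been erased while it was copied, so the tape is blank and the cell reached can be
    marked as home. *)
Definition load_frag : frag := fseq load_loop (write (Some true)).

Definition unload_bit (b : bool) : frag :=
  fseq (fact (fun x y => (x, None, MoveL, MoveR))) (write (Some b)).

Definition unload_loop : frag :=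
  fwh (fun _ y => y != None)
    (fbr (fun _ y => y == Some true) (unload_bit true) (unload_bit false)).

(* The output is written to the left of the home cell, with one blank in between, so
   it is the reverse of stack 0 and the stacks on the right need not be erased. *)
Definition unload_frag : frag :=
  fseq (fact (fun x y => (x, y, MoveL, Stay))) unload_loop.

Lemma fqry_opush b : fqry (opush b) = None.
Proof. exact: fqry_seq0. Qed.

Lemma fqry_load_loop : fqry load_loop = None.
Proof.
by apply: fqry_wh0; apply: fqry_seq0 => //; apply: fqry_br0; exact: fqry_opush.
Qed.

Lemma fqry_load : fqry load_frag = None.
Proof. by apply: fqry_seq0; first exact: fqry_load_loop. Qed.

Lemma fqry_unload_bit b : fqry (unload_bit b) = None.
Proof. exact: fqry_seq0. Qed.

Lemma fqry_unload : fqry unload_frag = None.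
Proof.
apply: fqry_seq0 => //; apply: fqry_wh0; apply: fqry_br0; exact: fqry_unload_bit.
Qed.

Definition empty_store : store := fun _ => [::].
Definition start_store (x : seq bool) : store := upd empty_store 0 (rev x).

Section Machine.
Variables (B : nat) (O : seq bool -> seq bool) (P : seq bool -> Prop).
Hypothesis B_gt0 : 0 < B.
Notation fok := (fok O P).

Lemma fok_opush b w q : fok (opush b) w q w (twrite (Some b) (tmove MoveL q)) 2.
Proof.
have := @fok_seq O P (fact (fun x y => (x, y, Stay, MoveL)))
  (fact (fun x y => (x, Some b, Stay, Stay))) w q w (tmove MoveL q) 1 _ _ 1 (or_introl erefl).
apply.
  have := @fok_act O P (fun x y => (x, y, Stay, MoveL)) w q _ _ _ _ erefl.
  by rewrite /= !twrite_id.
have := @fok_act O P (fun x y => (x, Some b, Stay, Stay)) w (tmove MoveL q) _ _ _ _ erefl.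
by rewrite /= !twrite_id.
Qed.

Lemma fok_load x : exists w q, fok load_frag (tape_of x) (tape_of [::]) w q (5 * size x + 2)
   /\ rep B 0 (start_store x) w q.
Proof.
pose blank := fun _ : nat => None : Sym.
have main : forall x w q, (forall i, nth None (tleft w) i = None) ->
   thead w = ohead x -> tright w = map Some (behead x) ->
   exists w' q', [/\ fok load_loop w q w' q' (5 * size x).+1,
      at_pos w' blank 0 & tword q' = rev x ++ tword q].
  elim=> [|b {}x IH] w q H1 H2 H3.
    exists w, q; split=> //.
      by apply: fok_wh_done; rewrite H2.
    split=> i; last by rewrite H1.
    rewrite H2 H3 /=; case: i => //= i; exact: nth_nil.
  pose w1 := tmove MoveR (twrite None w).
  pose q1 := twrite (Some b) (tmove MoveL q).
  have [|||w2 [q2 [R A E]]] := IH w1 q1.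
  - by move=> i; rewrite /w1 /=; case: (tright w) => [|? ?]; case: i.
  - by rewrite /w1 /= H3 /=; case: (x).
  - by rewrite /w1 /= H3 /=; case: (x).
  exists w2, q2; split=> //; last by rewrite E tword_push rev_cons cat_rcons.
  have -> : (5 * size (b :: x)).+1 = (4 + (5 * size x).+1).+1 by rewrite /=; lia.
  apply: fok_wh_step R; first by rewrite H2.
  apply: (@fok_seq _ _ _ _ _ _ w q1 3 _ _ 1); first by left.
    rewrite /q1; case: (b) H2 => H2.
      by apply: fok_br_true; rewrite ?H2 //; exact: fok_opush.
    by apply: fok_br_false; rewrite ?H2 //; [left; exact: fqry_opush | exact: fok_opush].
  have := @fok_act O P (fun x y => (None, y, MoveR, Stay)) w q1 _ _ _ _ erefl.
  by rewrite !twrite_id.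
have [|||w [q [R A E]]] := main x (tape_of x) (tape_of [::]).
- by case: x => [|? ?] i; rewrite nth_nil.
- by case: (x).
- by case: (x).
have [w' R' A'] := fok_write O P (Some true) q A.
exists w', q; split.
  have -> : 5 * size x + 2 = (5 * size x).+1 + 1 by lia.
  by apply: (fok_seq _ R R'); left; exact: fqry_load_loop.
split; last by rewrite E cats0 /start_store /upd.
apply: at_pos_ext A' => p; rewrite /cell /start_store /upd /empty_store.
have [->|p0] := eqVneq p 0; first by rewrite mod0n.
by have [//|pB] := eqVneq (p %% B) 0; rewrite nth_nil.
Qed.

Lemma fok_unload s w q : rep B 0 s w q ->
  exists w' q', fok unload_frag w q w' q' (4 * size (s 0) + 2) /\ tword w' = rev (s 0).
Proof.
move=> [A E].
have main : forall l w q r, tword q = l -> tword w = r ->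
   exists w' q', fok unload_loop w q w' q' (4 * size l).+1
    /\ tword w' = rev l ++ r.
  elim=> [|b l IH] {A E}w {}q r El Er.
    exists w, q; split=> //; apply: fok_wh_done.
    by rewrite tword_head El.
  pose w1 := twrite (Some b) (tmove MoveL w); pose q1 := tmove MoveR (twrite None q).
  have [||w2 [q2 [R E2]]] := IH w1 q1 (b :: r); first exact: (@tword_pop b).
    by rewrite tword_push Er.
  exists w2, q2; split; last by rewrite E2 rev_cons cat_rcons.
  have -> : (4 * size (b :: l)).+1 = (3 + (4 * size l).+1).+1 by rewrite /=; lia.
  have R3 : fok (unload_bit b) w q w1 q1 2.
    apply: (@fok_seq _ _ _ _ _ _ (tmove MoveL w) q1 1 _ _ 1); first by left.
      have := @fok_act O P (fun x y => (x, None, MoveL, MoveR)) w q _ _ _ _ erefl.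
      by rewrite !twrite_id.
    have := @fok_act O P (fun x y => (Some b, y, Stay, Stay)) (tmove MoveL w) q1 _ _ _ _ erefl.
    by rewrite !twrite_id.
  apply: fok_wh_step R; first by rewrite tword_head El.
  case: (b) El R3 => El R3.
    by apply: fok_br_true; rewrite ?tword_head ?El.
  by apply: fok_br_false; rewrite ?tword_head ?El //; left; exact: fqry_unload_bit.
have w0 : tword (tmove MoveL w) = [::].
  case: A => _ /(_ 0) /=; case: (w) => [[|x l] h r] //= ->.
  by [].
have [w' [q' [R Ew]]] := main _ _ _ _ E w0.
exists w', q'; split; last by rewrite Ew cats0.
have -> : 4 * size (s 0) + 2 = 1 + (4 * size (s 0)).+1 by lia.
apply: (@fok_seq _ _ _ _ _ _ (tmove MoveL w) q) R; first by left.
have := @fok_act O P (fun x y => (x, y, MoveL, Stay)) w q _ _ _ _ erefl.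
by rewrite !twrite_id.
Qed.
End Machine.

Lemma runs_within_le M O x t t' y (P Q : seq bool -> Prop) : t <= t' ->
  (forall q, P q -> Q q) -> runs_within M O x t y P -> runs_within M O x t' y Q.
Proof.
move=> ht PQ [n [hn [h1 [h2 h3]]]]; exists n; split; first exact: leq_trans hn ht.
by do 2!split=> //; move=> i hi /h3 H; apply: PQ; apply: H.
Qed.

Definition machine_of (B : nat) (c : cmd) : OTM :=
  otm_of (fseq load_frag (fseq (comp B c) unload_frag)).

Definition machine_cost (B : nat) := step_cost B + 10.

Lemma machine_ok B c O P x s' t : 0 < B -> queries c <= 1 -> stacks_below B c ->
  exec O P c (start_store x) s' t ->
  runs_within (machine_of B c) O x (machine_cost B * (size x + size (s' 0) + t).+1 ^ 2) (rev (s' 0)) P.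
Proof.
move=> hB hq hs hE.
have [w [q [R1 A1]]] := fok_load O P hB x.
(* At the start only stack 0 is occupied, so all heights on the work tape are 0. *)
have [|H _] := comp_ok hE hq hs (m := 0).
  by case=> // i _; rewrite /start_store /upd.
have [w1 [q1 [n1 [R2 A2 hn1]]]] := H _ _ A1.
have [w2 [q2 [R3 E2]]] := fok_unload O P hB A2.
have R : fok O P (fseq load_frag (fseq (comp B c) unload_frag)) (tape_of x) (tape_of [::]) w2 q2
   (5 * size x + 2 + (n1 + (4 * size (s' 0) + 2))).
  apply: fok_seq R1 _; first by left; exact: fqry_load.
  by apply: fok_seq R2 R3; right; exact: fqry_unload.
have := otm_of_run R; rewrite E2; apply: runs_within_le => //.
move: hn1; rewrite /time_bound /machine_cost; set K := step_cost B; set a := size x; set b := size _ => hn.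
have h1 : K * (0 + t).+1 * t <= K * (a + b + t).+1 ^ 2.
  by rewrite expnS expn1 -mulnA; apply: leq_mul => //; apply: leq_mul; lia.
have h2 : 10 * (a + b + t).+1 <= 10 * (a + b + t).+1 ^ 2.
  by rewrite leq_mul // expnS expn1 leq_pmulr.
rewrite mulnDl; lia.
Qed.


(** * Subroutines *)

Definition Mv (i j : nat) := For i (Push j false) (Push j true) Skip.
Definition Clr (i : nat) := For i Skip Skip Skip.
Definition pushes (o : nat) (w : seq bool) := foldr (fun b c => Push o b ;; c) Skip w.
(** Reading a stack destroys it, so its bits are saved on [d]; [Mv] restores them in order. Each
    word is pushed bit by bit and thus appears reversed on [o]. *)
Definition Emit (i d o : nat) (w0 w1 : seq bool) :=
  For i (Push d false ;; pushes o w0) (Push d true ;; pushes o w1) Skip ;; Mv d i.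
Definition Mult (i d k : nat) := For i Skip Skip (pushes d (nseq k true)) ;; Mv d i.

Lemma updE s i v : upd s i v i = v. Proof. by rewrite /upd eqxx. Qed.
Lemma upd_ne s i v k : k != i -> upd s i v k = s k.
Proof. by rewrite /upd => /negbTE ->. Qed.

Lemma store_ext (s s' : store) : (forall k, s k = s' k) -> s = s'.
Proof. exact: functional_extensionality. Qed.

Ltac upds := rewrite /upd /= ?eqxx; repeat match goal with
  | H : is_true (?a != ?b) |- context [?a == ?b] => rewrite (negbTE H)
  | H : is_true (?a != ?b) |- context [?b == ?a] => rewrite (eq_sym b a) (negbTE H)
  end; rewrite /=.

Ltac steq := let k := fresh "k" in apply: store_ext => k; upds;
  repeat (match goal with |- context [k == ?i] =>
     case: (eqVneq k i) => ? ; [subst k; upds | upds] end); try done.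

(** Ripple-carry addition, least significant bit first, cut off at the length of [X]. The zero
    padding of [Y] is complemented along with it, as two's complement requires. *)
Fixpoint addb (fl c : bool) (X Y : seq bool) : seq bool :=
  if X is x :: X' then
    let y := head false Y (+) fl in
    odd (y + x + c) :: addb fl (1 < y + x + c) X' (behead Y)
  else [::].

Fixpoint carry (fl c : bool) (X Y : seq bool) : bool :=
  if X is x :: X' then
    carry fl (1 < (head false Y (+) fl) + x + c) X' (behead Y)
  else c.

(** The adder pops [X] from its low end, so its loop invariant speaks of a prefix that grows at the
    high end. *)
Lemma addb_rcons fl c X x Y : addb fl c (rcons X x) Y =
  rcons (addb fl c X Y)
    (odd ((head false (drop (size X) Y) (+) fl) + x + carry fl c X Y)).
Proof.
by elim: X c Y => [|z X IH] c Y /=; rewrite ?drop0 // IH -drop1 drop_drop addn1.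
Qed.

Lemma carry_rcons fl c X x Y : carry fl c (rcons X x) Y =
  (1 < (head false (drop (size X) Y) (+) fl) + x + carry fl c X Y).
Proof.
by elim: X c Y => [|z X IH] c Y /=; rewrite ?drop0 // IH -drop1 drop_drop addn1.
Qed.

Lemma size_addb fl c X Y : size (addb fl c X Y) = size X.
Proof. by elim: X c Y => //= x X IH c Y; rewrite IH. Qed.

Fixpoint dropz (w : seq bool) : seq bool :=
  if w is false :: w' then dropz w' else w.

Lemma dropz_rcons w b : dropz (rcons w b) =
  if b || (dropz w != [::]) then rcons (dropz w) b else [::].
Proof. by elim: w b => [|[] w IH] [] //=; rewrite IH ?orbT. Qed.

Lemma size_dropz w : size (dropz w) <= size w.
Proof. by elim: w => [|[] w IH] //=; apply: leq_trans IH _. Qed.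

Section Macros.
Variables (O : seq bool -> seq bool) (P : seq bool -> Prop).
Notation exec := (exec O P).

Lemma exec_le c s s' t t' : exec c s s' t -> t <= t' -> exec c s s' t'.
Proof.
case=> {c s s' t}.
- by move=> *; apply: ESkip; lia.
- by move=> *; apply: EPush; lia.
- by move=> i ce c0 c1 s s' t0 t H H1 H2 H3; apply: ECase0 H H1 _; lia.
- by move=> i ce c0 c1 s s' b l t0 t H H1 H2 H3; apply: ECase1 H H1 _; lia.
- by move=> c1 c2 s s1 s2 t1 t2 t H1 H2 H3 H4; apply: ESeq H1 H2 _; lia.
- by move=> *; apply: EFor0 => //; lia.
- by move=> i c0 c1 c s b l s1 s2 s3 t1 t2 t3 t H H1 H2 H3 H4 H5; apply: EFor1 H H1 H2 H3 _; lia.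
- by move=> *; apply: EQuery => //; lia.
Qed.

Lemma exec_conv c s s1 s' t t' : exec c s s1 t -> s1 = s' -> t <= t' -> exec c s s' t'.
Proof. by move=> H <-; apply: exec_le. Qed.

Lemma exec_conv2 c s0 s s1 s' t t' :
  exec c s0 s1 t -> s = s0 -> s1 = s' -> t <= t' -> exec c s s' t'.
Proof. by move=> H -> <-; apply: exec_le. Qed.

Lemma exec_skip s : exec Skip s s 1. Proof. exact: ESkip. Qed.
Lemma exec_push i b s : exec (Push i b) s (upd s i (b :: s i)) 1. Proof. exact: EPush. Qed.
Lemma exec_seq c1 c2 s s1 s2 t1 t2 : exec c1 s s1 t1 -> exec c2 s1 s2 t2 ->
  exec (c1 ;; c2) s s2 (t1 + t2).
Proof. by move=> H1 H2; apply: ESeq H1 H2 _. Qed.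
Lemma exec_case0 i ce c0 c1 s s' t : s i = [::] -> exec ce s s' t ->
  exec (Case i ce c0 c1) s s' t.+1.
Proof. by move=> H1 H2; apply: ECase0 H1 H2 _. Qed.
Lemma exec_case1 i ce c0 c1 s s' b l t : s i = b :: l ->
  exec (if b then c1 else c0) (upd s i l) s' t -> exec (Case i ce c0 c1) s s' t.+1.
Proof. by move=> H1 H2; apply: ECase1 H1 H2 _. Qed.

(** [I p l] is the store once [p] has been popped and [l] remains. The step is stated for a [Seq] so
    that [T] bounds branch and body together; the pop costs one more. *)
Lemma exec_for i c0 c1 c T (L : seq bool) (I : seq bool -> seq bool -> store) :
  (forall p l, p ++ l = L -> I p l i = l) ->
  (forall p b l, p ++ b :: l = L ->
     exec ((if b then c1 else c0) ;; c) (upd (I p (b :: l)) i l) (I (rcons p b) l) T) ->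
  exec (For i c0 c1 c) (I [::] L) (I L [::]) (T.+1 * size L + 1).
Proof.
move=> hi hstep; rewrite -{1}[L]cat0s.
suff H : forall l p, p ++ l = L -> exec (For i c0 c1 c) (I p l) (I L [::]) (T.+1 * size l + 1).
  by apply: H.
elim=> [|b l IH] p E.
  have E' := E; rewrite cats0 in E'; subst p; apply: EFor0; [exact: hi _ _ E | lia].
have H := hstep _ _ _ E.
inversion H as [| | | |? ? ? s1 ? t1 t2 ? H1 H2 Ht| | |]; subst.
apply: (EFor1 (hi _ _ erefl) H1 H2 (IH (rcons p b) _)); first by rewrite cat_rcons.
by rewrite /=; nia.
Qed.

Lemma exec_mv (i j : nat) (s : store) : i != j ->
  exec (Mv i j) s (upd (upd s i [::]) j (rev (s i) ++ s j)) (3 * size (s i) + 1).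
Proof.
move=> ij.
apply: exec_conv2 (@exec_for i (Push j false) (Push j true) Skip 2 (s i)
  (fun p l => upd (upd s i l) j (rev p ++ s j)) _ _) _ _ _ => //.
- by move=> p l _; upds.
- by move=> p [] l E; apply: exec_conv (exec_seq (exec_push _ _ _) (exec_skip _)) _ _ => //;
    rewrite rev_rcons; steq.
- by steq.
Qed.

Lemma exec_pushes o w s : exec (pushes o w) s (upd s o (rev w ++ s o)) (size w).+1.
Proof.
elim: w s => [|b w IH] s /=; first by apply: exec_conv (exec_skip _) _ _ => //; steq.
apply: exec_conv (exec_seq (exec_push _ _ _) (IH _)) _ _; last by [].
by rewrite rev_cons cat_rcons; steq.
Qed.

Lemma exec_clr i s : exec (Clr i) s (upd s i [::]) (3 * size (s i) + 1).
Proof.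
apply: exec_conv2 (@exec_for i Skip Skip Skip 2 (s i) (fun p l => upd s i l) _ _) _ _ _ => //.
- by move=> p l _; upds.
- by move=> p [] l E; apply: exec_conv (exec_seq (exec_skip _) (exec_skip _)) _ _ => //; steq.
- by steq.
Qed.

Lemma exec_emit (i d o : nat) w0 w1 (s : store) : i != d -> i != o -> d != o -> s d = [::] ->
  exec (Emit i d o w0 w1) s
    (upd s o (rev (flatten [seq if b then w1 else w0 | b <- s i]) ++ s o))
    ((size w0 + size w1 + 10) * size (s i) + 2).
Proof.
move=> hid hio hdo hd.
have H : exec (For i (Push d false ;; pushes o w0) (Push d true ;; pushes o w1) Skip) s
    (upd (upd (upd s i [::]) d (rev (s i))) o
     (rev (flatten [seq if b then w1 else w0 | b <- s i]) ++ s o))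
    ((size w0 + size w1 + 4) * size (s i) + 1).
  apply: exec_conv2 (@exec_for i _ _ _ (size w0 + size w1 + 3) (s i)
    (fun p l => upd (upd (upd s i l) d (rev p)) o
     (rev (flatten [seq if b then w1 else w0 | b <- p]) ++ s o)) _ _) _ _ _ => //.
  - by move=> p l _; upds.
  - by move=> p [] l E; apply: exec_conv (exec_seq (exec_seq (exec_push _ _ _)
      (exec_pushes _ _ _)) (exec_skip _)) _ _; try lia;
    rewrite map_rcons flatten_rcons rev_cat rev_rcons -catA; steq.
  - by steq.
  - by lia.
apply: exec_conv (exec_seq H (exec_mv _ _)) _ _.
- by rewrite eq_sym.
- by upds; rewrite revK cats0; steq.
- by upds; rewrite size_rev; lia.
Qed.

Lemma exec_mult (i d k n : nat) (s : store) : i != d -> s d = [::] -> s i = nseq n true ->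
  exec (Mult i d k) s (upd s i (nseq (k * n) true)) ((4 * k + 10) * n + 2).
Proof.
move=> hid hd hi.
have H : exec (For i Skip Skip (pushes d (nseq k true))) s
    (upd (upd s i [::]) d (nseq (k * n) true)) (k.+3 * n + 1).
  apply: exec_conv2 (@exec_for i _ _ _ k.+2 (nseq n true)
    (fun p l => upd (upd s i l) d (nseq (k * size p) true)) _ _) _ _ _ => //.
  - by move=> p l _; upds.
  - move=> p b l E; apply: (@exec_conv _ _ _ _ (1 + k.+1)); last by [].
      have hb u : exec (if b then Skip else Skip) u u 1 by case: (b); exact: exec_skip.
      apply: exec_seq (hb _) _; apply: exec_conv (exec_pushes _ _ _) (erefl _) _.
      by rewrite size_nseq.
    by rewrite rev_nseq size_rcons mulnS nseqD; steq.
  - by rewrite muln0; steq.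
  - by rewrite size_nseq.
  - by rewrite size_nseq.
apply: exec_conv (exec_seq H (exec_mv _ _)) _ _.
- by rewrite eq_sym.
- by upds; rewrite rev_nseq cats0; steq.
- by upds; rewrite size_nseq; lia.
Qed.

End Macros.

Arguments exec_skip {O P}.
Arguments exec_push {O P}.
Arguments exec_for {O P}.
Arguments exec_mv {O P} [i j].
Arguments exec_pushes {O P}.
Arguments exec_clr {O P}.
Arguments exec_emit {O P} [i d o].
Arguments exec_mult {O P} [i d].

Ltac xrun := repeat match goal with
  | |- exec _ _ Skip _ _ _ => apply: exec_skip
  | |- exec _ _ (Push _ _) _ _ _ => apply: exec_push
  | |- exec _ _ (Seq _ _) _ _ _ => apply: exec_seq
  | |- exec _ _ (Case _ _ _ _) _ _ _ => first
     [ apply: exec_case0; [by upds | ]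
     | apply: exec_case1; [by upds; first [eassumption | reflexivity] | lazy iota beta ] ]
  end.

(** * Binary arithmetic and decoding on stacks *)

Section Subroutines.
Variables (O : seq bool -> seq bool) (P : seq bool -> Prop).
Notation exec := (exec O P).

(* The stack [ct] counts in unary the ones of a column of an addition; its sum digit
   goes to [d] and the carry stays in [ct]. *)
Definition digit (d ct : nat) :=
  Case ct (Push d false) Skip (Case ct (Push d true) Skip
    (Case ct (Push d false ;; Push ct true) Skip (Push ct true ;; Push d true))).

Lemma exec_digit (d ct k : nat) (s : store) : d != ct -> s ct = nseq k true -> k <= 3 ->
  exec (digit d ct) s (upd (upd s ct (nseq (1 < k) true)) d (odd k :: s d)) 5.
Proof.
move=> hd; case: k => [|[|[|[|k]]]] // hct _; rewrite /digit;
  (apply: exec_conv; [by xrun | by steq | by []]).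
Qed.

(* [X := X + Y + c] modulo [2 ^ size X], where [c] is the carry stored in [ct]; with
   [fl] the bits of [Y] are complemented, so [fl = c = true] subtracts [Y]. *)
Definition adder_loop (fl : bool) (X Y d ct : nat) :=
  For X Skip (Push ct true)
    (Case Y (if fl then Push ct true else Skip) (if fl then Push ct true else Skip)
            (if fl then Skip else Push ct true) ;; digit d ct).
Definition adder fl X Y d ct := adder_loop fl X Y d ct ;; Mv d X ;; Clr ct.

Lemma exec_ybit fl (Y ct : nat) (s : store) : Y != ct ->
  exec (Case Y (if fl then Push ct true else Skip) (if fl then Push ct true else Skip)
               (if fl then Skip else Push ct true)) s
    (upd (upd s Y (behead (s Y))) ct (nseq (head false (s Y) (+) fl) true ++ s ct)) 2.
Proof.
move=> hY; case E: (s Y) => [|[] l]; case: fl;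
  (apply: exec_conv; [by xrun | by steq | by []]).
Qed.

Lemma exec_adder (fl c : bool) (X Y d ct : nat) (s : store) :
  X != Y -> X != d -> X != ct -> Y != d -> Y != ct -> d != ct ->
  s d = [::] -> s ct = nseq c true ->
  exec (adder fl X Y d ct) s
    (upd (upd (upd s X (addb fl c (s X) (s Y))) Y (drop (size (s X)) (s Y))) ct [::])
    (20 * size (s X) + 10).
Proof.
move=> hXY hXd hXc hYd hYc hdc hd hct.
have H : exec (adder_loop fl X Y d ct) s
   (upd (upd (upd (upd s X [::]) Y (drop (size (s X)) (s Y))) d
     (rev (addb fl c (s X) (s Y)))) ct (nseq (carry fl c (s X) (s Y)) true))
   (10 * size (s X) + 1).
  apply: exec_conv2 (@exec_for _ _ X _ _ _ 9 (s X)
    (fun p l => upd (upd (upd (upd s X l) Y (drop (size p) (s Y))) d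
     (rev (addb fl c p (s Y)))) ct (nseq (carry fl c p (s Y)) true)) _ _) _ _ _ => //.
  - by move=> p l _; upds.
  - move=> p b l E.
    have Hb u : exec (if b then Push ct true else Skip) u (upd u ct (nseq b true ++ u ct)) 1.
      by case: (b); apply: exec_conv; [by xrun | by steq | by [] | by xrun | by steq | by []].
    apply: exec_conv; first apply: exec_seq (Hb _) (exec_seq (exec_ybit _ _ _)
      (@exec_digit d ct ((head false (drop (size p) (s Y)) (+) fl) + b + carry fl c p (s Y)) _ hdc _ _)) => //.
    + by upds; rewrite catA -!nseqD.
    + by case: (b); case: (carry _ _ _ _); case: (_ (+) _).
    + rewrite addb_rcons carry_rcons rev_rcons size_rcons; steq.
      by rewrite -drop1 drop_drop add1n.
    + by [].
  - by rewrite /= drop0; steq.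
apply: exec_conv (exec_seq H (exec_seq (exec_mv _ _) (exec_clr _ _))) _ _.
- by rewrite eq_sym.
- by upds; rewrite revK cats0; steq.
- by upds; rewrite size_rev size_addb size_nseq; case: (carry _ _ _ _); lia.
Qed.

(** [f] records that a one has been seen. As [Case] pops, the mark is pushed back, and once more for
    the bit kept, so the height of [f] is the number of bits kept. *)
Definition strip_loop (i d f : nat) :=
  For i (Case f Skip Skip (Push d false ;; Push f true ;; Push f true)) (Push f true ;; Push d true) Skip.
Definition strip (i d f : nat) := strip_loop i d f ;; Mv d i ;; Clr f.

Lemma exec_strip (i d f : nat) (s : store) : i != d -> i != f -> d != f ->
  s d = [::] -> s f = [::] ->
  exec (strip i d f) s (upd s i (dropz (s i))) (20 * size (s i) + 10).
Proof.
move=> hid hif hdf hd hf.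
have H : exec (strip_loop i d f) s
   (upd (upd (upd s i [::]) d (rev (dropz (s i)))) f (nseq (size (dropz (s i))) true))
   (8 * size (s i) + 1).
  apply: exec_conv2 (@exec_for _ _ i _ _ _ 7 (s i)
    (fun p l => upd (upd (upd s i l) d (rev (dropz p))) f (nseq (size (dropz p)) true)) _ _) _ _ _ => //.
  - by move=> p l _; upds.
  - move=> p b l E; rewrite dropz_rcons; case: b E => E /=.
      rewrite rev_rcons size_rcons.
      by apply: exec_conv; [by xrun | by steq | by []].
    case Ez: (dropz p) => [|z w].
      by apply: exec_conv; [by xrun | by steq | by []].
    change (if z :: w != [::] then rcons (z :: w) false else [::]) with (rcons (z :: w) false).
    rewrite rev_rcons size_rcons.
    by apply: exec_conv; [by xrun | by steq | by []].
  - by steq.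
apply: exec_conv (exec_seq H (exec_seq (exec_mv _ _) (exec_clr _ _))) _ _.
- by rewrite eq_sym.
- by upds; rewrite revK cats0; steq.
- by upds; rewrite size_rev size_nseq; have := size_dropz (s i); lia.
Qed.

(** Loops are bounded by the height of a stack, so [T] is a clock with more ticks than there are
    bits. An empty [sAct] means that the code has ended or is malformed; the remaining ticks are
    idle. *)
Definition parse_loop (dst T : nat) :=
  For T Skip Skip (Case sAct Skip Skip
    (Case sX (Push sErr true)
      (Case sX (Push sErr true) Skip (Push sErr true))
      (Case sX (Push sErr true) (Push dst false ;; Push sAct true) (Push dst true ;; Push sAct true)))).

Definition parse (dst T : nat) := Push sAct true ;; Push T true ;; parse_loop dst T.

Lemma exec_parse_idle (dst T : nat) (s : store) : T != sAct -> s sAct = [::] ->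
  exec (parse_loop dst T) s (upd s T [::]) (4 * size (s T) + 1).
Proof.
move=> hT h5.
apply: exec_conv2 (@exec_for _ _ T _ _ _ 3 (s T) (fun p l => upd s T l) _ _) _ _ _ => //.
- by move=> p l _; upds.
- by move=> p [] l E; apply: exec_conv; [by xrun | by steq | by [] | by xrun | by steq | by []].
- by steq.
Qed.

(** On failure two facts matter: the error flag stops the program, and stack 0, which holds the
    output, is untouched. *)
Lemma exec_parse_loop n (dst T : nat) (s : store) : 
  T != dst -> T != sX -> T != sAct -> T != sErr -> dst != sX -> dst != sAct -> dst != sErr ->
  s T = nseq n true -> s sAct = [:: true] -> size (s sX) < n ->
  match dec_sd (s sX) with
  | Some (p, r) => exec (parse_loop dst T) s
      (upd (upd (upd (upd s T [::]) sX r) dst (rev p ++ s dst)) sAct [::]) (10 * n + 1)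
  | None => exists s', [/\ exec (parse_loop dst T) s s' (10 * n + 1), s' sErr <> [::] &
      (sO != T -> sO != dst -> s' sO = s sO)]
  end.
Proof.
move=> hTd hT1 hT5 hT6 hd1 hd5 hd6.
elim: n s => // n IH s hT h5 hX.
have step s1 s2 t1 t2 : exec (Case sAct Skip Skip
    (Case sX (Push sErr true)
      (Case sX (Push sErr true) Skip (Push sErr true))
      (Case sX (Push sErr true) (Push dst false ;; Push sAct true) (Push dst true ;; Push sAct true))))
    (upd s T (nseq n true)) s1 t1 -> t1 <= 8 ->
    exec (parse_loop dst T) s1 s2 t2 -> t2 <= 10 * n + 1 -> exec (parse_loop dst T) s s2 (10 * n.+1 + 1).
  move=> H1 ht1 H2 ht2.
  by apply: (@EFor1 _ _ _ _ _ _ _ _ _ _ _ _ 1 _ _ _ hT (exec_skip _) H1 H2); lia.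
have idle s1 : s1 T = nseq n true -> s1 sAct = [::] -> 
    exec (parse_loop dst T) s1 (upd s1 T [::]) (4 * n + 1).
  by move=> h1 h2; apply: exec_conv (exec_parse_idle _ _ _) _ _ => //; rewrite h1 size_nseq.
case EX: (s sX) hX => [|[] [|b X]] hX.
- eexists; split.
  + apply: step; [by xrun | by [] | apply: idle; by upds | lia].
  + by upds.
  + by move=> ? ?; upds.
- eexists; split.
  + apply: step; [by xrun | by [] | apply: idle; by upds | lia].
  + by upds.
  + by move=> ? ?; upds.
- rewrite /=.
  pose s1 := upd (upd (upd (upd s T (nseq n true)) sX X) dst (b :: s dst)) sAct [:: true].
  have H1 : exec (Case sAct Skip Skip
    (Case sX (Push sErr true)
      (Case sX (Push sErr true) Skip (Push sErr true))
      (Case sX (Push sErr true) (Push dst false ;; Push sAct true) (Push dst true ;; Push sAct true))))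
    (upd s T (nseq n true)) s1 8.
    by rewrite /s1; case: (b) EX => EX; (apply: exec_conv; [by xrun | by steq | by []]).
  have := IH s1; rewrite /s1; upds => /(_ erefl erefl _).
  case: (dec_sd X) => [[p r]|] H2.
    apply: exec_conv (step _ _ _ _ H1 _ (H2 _) _) _ _ => //; first by rewrite /= in hX; lia.
    by rewrite rev_cons cat_rcons; steq.
  have [|s' [H3 H4 H5]] := H2; first by rewrite /= in hX; lia.
  exists s'; split=> //.
  + by apply: step H1 _ H3 _.
  + by move=> h1 h2; rewrite H5 // ; upds.
- eexists; split.
  + apply: step; [by xrun | by [] | apply: idle; by upds | lia].
  + by upds.
  + by move=> ? ?; upds.
case: b EX hX => EX hX /=.
- eexists; split.
  + apply: step; [by xrun | by [] | apply: idle; by upds | lia].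
  + by upds.
  + by move=> ? ?; upds.
- apply: exec_conv; first (apply: step; [by xrun | by [] | apply: idle; by upds | lia]).
  + by steq.
  + by [].
Qed.

End Subroutines.

(** * The reduction program *)

(* Subtracts 1, 3, 5, ... from the length of the matrix: this computes the number of
   vertices in unary, or raises the error flag if that length is not a square.  The
   binary number of vertices given in the instance is never compared with it: a
   mismatch makes every query malformed. *)
Definition sqrt_inner := For sC Skip (Push sD true) (Case sL (Push sErr true) Skip Skip).
Definition sqrt_body := sqrt_inner ;; Mv sD sC ;; Push sC true ;; Push sC true ;;
  Push sU1 true ;; Push sU2 true.
Definition sqrt_loop := For sT3 Skip Skip (Case sL Skip Skip sqrt_body).

Definition read_input :=
  For sO (Push sX false) (Push sX true) (Push sT1 true ;; Push sT2 true).
Definition read_matrix :=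
  For sX (Push sA false) (Push sA true) (Push sL true ;; Push sT3 true).

Definition grow (i k cnt d2 : nat) :=
  For cnt (Push d2 false) (Push d2 true) (Mult i sD k) ;; Mv d2 cnt.

(* Builds, for a target [k], the unary [j = 4 ^ size (bits k)], the zero mask of
   length [j], the unary [2 ^ j], the binary number [n + j] and a zero accumulator. *)
Definition setup :=
  Clr sJ ;; Push sJ true ;;
  grow sJ 4 sKB sD2 ;;
  Clr sM ;; Emit sJ sD sM [::] [:: false] ;;
  Push sJ2 true ;; grow sJ2 2 sJ sD2 ;;
  Clr sNP ;; Emit sJ sD sNP [::] [:: false] ;; Emit sN sD sNP [:: false] [:: true] ;;
  Push sY true ;; Emit sKB sD sY [:: false; false] [:: false; false] ;;
  adder false sNP sY sD sCt ;;
  Clr sAcc ;; Push sAcc false ;; Emit sU1 sD sAcc [::] [:: false].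

(* Stack 0 grows at its front, so a query is written from its end: the rows of the
   new vertices, those of [G], the binary [j * k] and finally the binary [n + j]. *)
Definition apex_row b := Push sM2 b ;; Emit sJ sD sO [::] [:: false] ;; Emit sU1 sD sO [::] [:: b].
Definition apex_rows :=
  For sM (apex_row false) (apex_row true ;; Case sSg (Push sSg true) Skip Skip) Skip ;; Mv sM2 sM.

Definition copy_row :=
  For sU2 Skip (Push sD true)
    (Case sA Skip (Push sA2 false ;; Push sO false) (Push sA2 true ;; Push sO true)) ;; Mv sD sU2.
Definition vertex_rows :=
  For sU1 Skip (Push sD2 true) (Emit sM sD sO [:: false] [:: true] ;; copy_row) ;;
  Mv sD2 sU1 ;; Mv sA2 sA.

(** The code is written backwards: the end mark comes first, and a pair [1 b] is pushed as [b], then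
    1. As j = 4^l, the product j * k consists of 2 * l low zeros, two for each bit on [sKB],
    followed by the bits of k. *)
Definition headers :=
  pushes sO [:: false; false] ;; Emit sKB sD sO [:: false; true] [:: true; true] ;;
  Emit sKB sD sO [:: false; true; false; true] [:: false; true; false; true] ;;
  pushes sO [:: false; false] ;; Mv sNP sD2 ;; Emit sD2 sD sO [:: false; true] [:: true; true] ;;
  Mv sD2 sNP.

Definition build_query := apex_rows ;; vertex_rows ;; headers.

(** Adding the empty stack [sZ] with an initial carry increments the mask. An answer may be longer
    than the accumulator; [Clr] drops what the adder has not consumed. *)
Definition mask_loop := For sJ2 Skip Skip
  (build_query ;; Query ;;
   Case sSg (adder false sAcc sO sD sCt) Skip (Push sCt true ;; adder true sAcc sO sD sCt) ;;
   Clr sO ;; Push sCt true ;; adder false sM sZ sD sCt).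

Definition phase_end :=
  For sAcc (Push sD false) (Push sD true ;; Clr sLive ;; Push sLive true) Skip ;; Mv sD sAcc ;;
  Clr sKB ;; Emit sK sD sD2 [:: false] [:: true] ;; Mv sD2 sKB.

(* The targets of the two phases are 1 and [k]; for [k = 0] there is only the first. *)
Definition phases :=
  Push sPh true ;; Case sK Skip Skip (Push sK true ;; Push sPh true) ;;
  Push sKB true ;; Push sLive true ;;
  For sPh Skip Skip (Case sLive Skip Skip (setup ;; mask_loop ;; phase_end)).

(* For [k = 0] the answer is 1 on well-formed instances, that is if the first phase
   was successful, or if there are no vertices and the number of vertices is 0. *)
Definition output :=
  Case sK
    (Case sU1 (For sN Skip (Push sErr true) Skip ;; Case sErr (Push sO true) Skip Skip) Skip
       (Case sLive Skip Skip (Push sO true)))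
    Skip (Mv sAcc sO ;; strip sO sD sCt).

Definition main_prog :=
  read_input ;; parse sN sT1 ;; Case sErr (parse sK sT2 ;; Case sErr (read_matrix ;; sqrt_loop ;;
     Case sErr (strip sK sD sCt ;; phases ;; output) Skip Skip) Skip Skip) Skip Skip.

Lemma main_prog_wf : stacks_below 30 main_prog && (queries main_prog <= 1).
Proof. by []. Qed.

Ltac rd := repeat first [rewrite updE | rewrite upd_ne; [|by []]].
Tactic Notation "xseq" tactic(t) := apply: exec_seq; [by t | rd].

Ltac seqc := let k := fresh "k" in apply: store_ext => k; rewrite /upd;
  repeat match goal with |- context [k == ?i] =>
    case: (eqVneq k i) => [?|_]; [subst k; rewrite /= | ] end; try done.

(** * Reading the matrix and preparing a phase *)

Section ProgramParts.
Variables (O : seq bool -> seq bool) (P : seq bool -> Prop).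
Notation exec := (exec O P).

Lemma exec_sqrt_inner c l e (s : store) :
  s sC = nseq c true -> s sL = nseq l true -> s sD = [::] -> s sErr = nseq e true ->
  exec sqrt_inner s
    (upd (upd (upd (upd s sC [::]) sL (nseq (l - c) true)) sD (nseq c true))
       sErr (nseq (c - l + e) true)) (5 * c + 1).
Proof.
move=> hC hL hD hE.
apply: exec_conv2 (@exec_for _ _ sC _ _ _ 4 (nseq c true)
  (fun p q => upd (upd (upd (upd s sC q) sL (nseq (l - size p) true)) sD (nseq (size p) true))
       sErr (nseq (size p - l + e) true)) _ _) _ _ _ => //.
- move=> p b q E; rewrite size_rcons.
  have -> : b = true.
    have : b \in nseq c true by rewrite -E mem_cat inE eqxx orbT.
    by rewrite mem_nseq => /andP[_ /eqP].
  case El: (l - size p) => [|m].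
    have -> : l - (size p).+1 = 0 by lia.
    have -> : (size p).+1 - l + e = ((size p) - l + e).+1 by lia.
    by apply: exec_conv; [by xrun | by steq | by []].
  have -> : l - (size p).+1 = m by lia.
  have -> : (size p).+1 - l + e = size p - l + e by lia.
  by apply: exec_conv; [by xrun | by steq | by []].
- by rewrite subn0 sub0n; steq.
- by rewrite size_nseq; steq.
- by rewrite size_nseq.
Qed.

(** [Case] and the inner loop together remove 2u + 1 = (u + 1)^2 - u^2, so [l + u ^ 2] is invariant.
    An underflow shows that it lies strictly between two consecutive squares; [sL] is then empty and
    later rounds are idle. *)
Lemma exec_sqrt n : forall l u e (s : store), l <= n ->
  s sT3 = nseq n true -> s sC = nseq (2 * u) true -> s sL = nseq l true -> s sD = [::] ->
  s sU1 = nseq u true -> s sU2 = nseq u true -> s sErr = nseq e true ->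
  exists v e', exec sqrt_loop s
    (upd (upd (upd (upd (upd (upd s sT3 [::]) sC (nseq (2 * v) true)) sL [::])
      sU1 (nseq v true)) sU2 (nseq v true)) sErr (nseq e' true)) (n * (20 * (u + n) + 30) + 1) /\
    [/\ e <= e', e' = e -> l + u ^ 2 = v ^ 2 & e < e' -> forall w, l + u ^ 2 <> w ^ 2].
Proof.
elim: n => [|n IH] l u e s hl hT hC hL hD hU1 hU2 hE.
  have l0 : l = 0 by lia.
  subst l; exists u, e; split; last by split=> //; lia.
  by apply: exec_conv; [exact: (EFor0 _ _ _ _ _ hT (ltn0Sn 0)) | steq | lia].
case: l hl hL => [|l] hl hL.
  have [||||||||v [e' [H1 H2]]] := IH 0 u e (upd s sT3 (nseq n true)); try by upds.
  exists v, e'; split=> //.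
  apply: exec_conv; first apply: (EFor1 hT (exec_skip _) _ H1 (leqnn _)).
  - by apply: exec_case0; [upds | exact: exec_skip].
  - by steq.
  - nia.
pose s1 := upd (upd (upd (upd (upd (upd s sT3 (nseq n true)) sC (nseq (2 * u).+2 true))
  sL (nseq (l - 2 * u) true)) sU1 (nseq u.+1 true)) sU2 (nseq u.+1 true))
  sErr (nseq (2 * u - l + e) true).
have H : exec (Case sL Skip Skip sqrt_body) (upd s sT3 (nseq n true)) s1 (20 * u + 20).
  apply: exec_conv.
  - apply: exec_case1; first by upds; exact: hL.
    lazy iota beta; apply: exec_seq; first by apply: (@exec_sqrt_inner (2 * u) l e); upds.
    apply: exec_seq; first exact: exec_mv.
    by xrun.
  - rewrite /s1; upds; rewrite rev_nseq cats0 hU1 hU2; steq.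
  - by upds; rewrite size_nseq; lia.
have [||||||||v [e' [H1 [H2 H3 H4]]]] := IH (l - 2 * u) u.+1 (2 * u - l + e) s1; try by rewrite /s1; upds.
- by lia.
- by rewrite /s1 mulnS; upds.
exists v, e'; split.
  apply: exec_conv; first apply: (EFor1 hT (exec_skip _) H H1 (leqnn _)).
  - by rewrite /s1; steq.
  - nia.
case: (leqP (2 * u) l) => hul.
  have h0 : 2 * u - l = 0 by lia.
  have h1 : (l - 2 * u) + u.+1 ^ 2 = l.+1 + u ^ 2 by rewrite !expnS !expn0; lia.
  by rewrite -h1; move: H2 H3 H4; rewrite h0 add0n; split.
split; [lia | lia |].
move=> _ w; rewrite !expnS !expn0 !muln1 => E.
have /orP[h|h] : (w <= u) || (u < w) by lia.
  nia.
nia.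
Qed.


Lemma exec_emit_ticks i d o n c (s : store) : i != d -> i != o -> d != o -> s d = [::] ->
  s i = nseq n true ->
  exec (Emit i d o [::] [:: c]) s (upd s o (nseq n c ++ s o)) (11 * n + 2).
Proof.
move=> h1 h2 h3 hd hi; apply: exec_conv (exec_emit _ _ _ h1 h2 h3 hd) _ _.
  rewrite hi (_ : flatten _ = nseq n c) ?rev_nseq //.
  by elim: (n) => //= k ->.
by rewrite hi size_nseq.
Qed.

Lemma flatten_bits (w : seq bool) : flatten [seq if b then [:: true] else [:: false] | b <- w] = w.
Proof. by elim: w => //= b w ->; case: b. Qed.

Lemma exec_emit_bits i d o (s : store) : i != d -> i != o -> d != o -> s d = [::] ->
  exec (Emit i d o [:: false] [:: true]) s (upd s o (rev (s i) ++ s o)) (12 * size (s i) + 2).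
Proof.
by move=> h1 h2 h3 hd; apply: exec_conv (exec_emit _ _ _ h1 h2 h3 hd) _ _; rewrite ?flatten_bits.
Qed.

Lemma exec_read_input (s : store) : exec read_input s
  (upd (upd (upd (upd s sO [::]) sX (rev (s sO) ++ s sX)) sT1 (nseq (size (s sO)) true ++ s sT1))
     sT2 (nseq (size (s sO)) true ++ s sT2)) (4 * size (s sO) + 1).
Proof.
apply: exec_conv2 (exec_for sO _ _ _ 3 (s sO) (fun p l => 
  (upd (upd (upd (upd s sO l) sX (rev p ++ s sX)) sT1 (nseq (size p) true ++ s sT1))
     sT2 (nseq (size p) true ++ s sT2))) _ _) _ _ _ => //.
- by move=> p [] l E; rewrite rev_rcons size_rcons;
   (apply: exec_conv; [by xrun | by steq | by []]).
- by steq.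
Qed.

Lemma exec_read_matrix (s : store) : exec read_matrix s
  (upd (upd (upd (upd s sX [::]) sA (rev (s sX) ++ s sA)) sL (nseq (size (s sX)) true ++ s sL))
     sT3 (nseq (size (s sX)) true ++ s sT3)) (4 * size (s sX) + 1).
Proof.
apply: exec_conv2 (exec_for sX _ _ _ 3 (s sX) (fun p l => 
  (upd (upd (upd (upd s sX l) sA (rev p ++ s sA)) sL (nseq (size p) true ++ s sL))
     sT3 (nseq (size p) true ++ s sT3))) _ _) _ _ _ => //.
- by move=> p [] l E; rewrite rev_rcons size_rcons;
   (apply: exec_conv; [by xrun | by steq | by []]).
- by steq.
Qed.

Lemma exec_grow (i k cnt d2 : nat) (s : store) : 1 < k ->
  uniq [:: i; cnt; d2; sD] -> s i = [:: true] -> s d2 = [::] -> s sD = [::] ->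
  exec (grow i k cnt d2) s (upd s i (nseq (k ^ size (s cnt)) true))
    (((4 * k + 10) * k ^ size (s cnt) + 10) * size (s cnt) + 2).
Proof.
move=> k1 /=; rewrite !inE !negb_or -!andbA => /and4P[h1 h2 h3 /and4P[h4 h5 h6 _]] hi hd2 hD.
have H : exec (For cnt (Push d2 false) (Push d2 true) (Mult i sD k)) s
   (upd (upd (upd s cnt [::]) d2 (rev (s cnt))) i (nseq (k ^ size (s cnt)) true))
   (((4 * k + 10) * k ^ size (s cnt) + 4) * size (s cnt) + 1).
  apply: exec_conv2 (exec_for cnt _ _ _ ((4 * k + 10) * k ^ size (s cnt) + 3) (s cnt) (fun p l => 
    (upd (upd (upd s cnt l) d2 (rev p)) i (nseq (k ^ size p) true))) _ _) _ _ _ => //.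
  - by move=> p l E; upds.
  - move=> p b l E; rewrite rev_rcons size_rcons.
    have Hb u : exec (if b then Push d2 true else Push d2 false) u (upd u d2 (b :: u d2)) 1.
      by case: (b); exact: exec_push.
    apply: exec_conv (exec_seq (Hb _) (@exec_mult _ _ i sD k (k ^ size p) _ _ _ _)) _ _; try by upds.
      by rewrite expnS; steq.
    suff : k ^ size p <= k ^ size (s cnt) by nia.
    by rewrite leq_exp2l // -E size_cat leq_addr.
  - by rewrite expn0; steq.
  - by lia.
apply: exec_conv (exec_seq H (exec_mv _ _)) _ _.
- by rewrite eq_sym.
- by upds; rewrite revK cats0; steq.
- by upds; rewrite size_rev; lia.
Qed.


Definition setup_store (s : store) (n : nat) (bn : seq bool) : store :=
  let l := size (s sKB) in let j := 4 ^ l in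
  upd (upd (upd (upd (upd s sJ (nseq j true)) sM (nseq j false)) sJ2 (nseq (2 ^ j) true))
    sNP (addb false false (bn ++ nseq j false) (rcons (nseq (2 * l) false) true)))
    sAcc (nseq n.+1 false).

Lemma flatten_zeros l (w : seq bool) : size w = l ->
  flatten [seq if b then [:: false; false] else [:: false; false] | b <- w] = nseq (2 * l) false.
Proof.
move=> <-; elim: w => // b w IH.
rewrite (_ : 2 * size (b :: w) = (2 * size w).+2); last by rewrite /=; lia.
by rewrite map_cons /= IH; case: b.
Qed.

Lemma exec_setup n bn m (s : store) :
  s sU1 = nseq n true -> s sN = rev bn -> s sD = [::] -> s sD2 = [::] -> s sY = [::] ->
  s sCt = [::] -> s sJ2 = [::] ->
  size (s sJ) <= m -> size (s sM) <= m -> size (s sNP) <= m -> size (s sAcc) <= m ->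
  exec setup s (setup_store s n bn)
   (12 * m + 26 * 4 ^ size (s sKB) * size (s sKB) + 40 * size (s sKB) + 
    18 * 2 ^ (4 ^ size (s sKB)) * 4 ^ size (s sKB) + 60 * 4 ^ size (s sKB) +
    40 * size bn + 20 * n + 100).
Proof.
move=> hU hN hD hD2 hY hCt hJ2 mJ mM mNP mA.
(* The addend has 2 * l + 1 <= j bits, so the adder uses up [sY] and leaves it empty for the next
   phase. *)
have hj : 2 * size (s sKB) < 4 ^ size (s sKB).
  elim: (size _) => // k; rewrite expnS; lia.
apply: exec_conv.
- rewrite /setup.
  xseq exact: exec_clr.
  xseq exact: exec_push.
  xseq (apply: exec_grow; rd).
  xseq exact: exec_clr.
  xseq (apply: exec_emit_ticks; rd).
  xseq exact: exec_push.
  xseq (apply: exec_grow; rd; rewrite ?hJ2).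
  xseq exact: exec_clr.
  xseq (apply: exec_emit_ticks; rd).
  xseq (apply: exec_emit_bits; rd).
  xseq exact: exec_push.
  xseq (apply: exec_emit; rd).
  xseq (apply: (@exec_adder _ _ false false); rd).
  xseq exact: exec_clr.
  xseq exact: exec_push.
  by apply: exec_emit_ticks; rd; try exact: hU.
- rd; rewrite hN hY hJ2 (flatten_zeros (erefl _)) revK rev_nseq !cats0 cats1 size_nseq.
  rewrite drop_oversize; last by rewrite size_rcons !(size_nseq, size_cat); lia.
  rewrite /setup_store (_ : nseq n false ++ [:: false] = nseq n.+1 false); last first.
    by rewrite -(nseqD n 1) addn1.
  by seqc; rewrite ?hY ?hCt.
- rd; rewrite hN.
  rewrite !(size_cat, size_nseq, size_rcons, size_rev) [size [::]]/= [size [:: _; _]]/=.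
  set l := size (s 15); set j := 4 ^ l; set J := 2 ^ j; lia.
Qed.
End ProgramParts.

(** * Writing the queries and looping over the masks *)

Definition apex_matrix (n : nat) (m : seq bool) : seq bool :=
  flatten [seq nseq n b ++ nseq (size m) false | b <- m].

Definition vertex_matrix (n : nat) (adj m : seq bool) : seq bool :=
  flatten [seq take n (drop (i * n) adj) ++ m | i <- iota 0 n].

Definition sd_bits (w : seq bool) : seq bool := flatten [seq [:: true; b] | b <- w].
Definition sd (w : seq bool) : seq bool := sd_bits w ++ [:: false; false].

Definition query_word (np kb adj m : seq bool) (n : nat) : seq bool :=
  sd np ++ sd (nseq (2 * size kb) false ++ rev kb) ++
  vertex_matrix n adj m ++ apex_matrix n m.

Section Phases.
Variables (O : seq bool -> seq bool) (P : seq bool -> Prop).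
Notation exec := (exec O P).

Lemma exec_apex_row b n j (s : store) :
  s sU1 = nseq n true -> s sJ = nseq j true -> s sD = [::] ->
  exec (apex_row b) s (upd (upd s sM2 (b :: s sM2)) sO (nseq n b ++ nseq j false ++ s sO))
    (11 * (n + j) + 5).
Proof.
move=> hU hJ hD; apply: exec_conv.
- rewrite /apex_row.
  xseq exact: exec_push.
  xseq (apply: exec_emit_ticks; rd; try exact: hJ).
  by apply: exec_emit_ticks; rd; try exact: hU.
- by rd; seqc.
- by lia.
Qed.

Lemma exec_apex_rows n j (s : store) :
  s sU1 = nseq n true -> s sJ = nseq j true -> s sD = [::] -> s sM2 = [::] -> s sSg = [::] ->
  size (s sM) = j ->
  exec apex_rows s
    (upd (upd s sO (apex_matrix n (rev (s sM)) ++ s sO)) sSg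
      (nseq (odd (count id (s sM))) true)) ((11 * (n + j) + 20) * j + 2).
Proof.
move=> hU hJ hD hM2 hSg hj.
apply: exec_conv.
- rewrite /apex_rows; apply: exec_seq; last exact: exec_mv.
  apply: exec_conv2 (exec_for sM _ _ _ (11 * (n + j) + 9) (s sM) (fun p l =>
    upd (upd (upd (upd s sM l) sM2 (rev p)) sO
      (flatten [seq nseq n b ++ nseq j false | b <- rev p] ++ s sO))
      sSg (nseq (odd (count id p)) true)) _ _) _ (erefl _) (leqnn _).
  + by move=> p l E; rd.
  + move=> p b l E; rewrite rev_rcons map_cons /= -cats1 count_cat.
    have Hs u : u sSg = nseq (odd (count id p)) true -> exec (Case sSg (Push sSg true) Skip Skip) u
        (upd u sSg (nseq (odd (count id p + 1)) true)) 2.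
      rewrite addn1 /=; case: (odd _) => hu.
        by apply: exec_conv; [apply: exec_case1; [exact: hu | exact: exec_skip] | seqc | ].
      by apply: exec_conv; [apply: exec_case0; [exact: hu | exact: exec_push] | seqc; rewrite hu | ].
    have -> : flatten [seq nseq n b0 ++ nseq j false | b0 <- b :: rev p] ++ s sO =
       nseq n b ++ nseq j false ++ flatten [seq nseq n b ++ nseq j false | b <- rev p] ++ s sO.
      by rewrite /= -!catA.
    case: b E => E.
      apply: exec_conv.
      * apply: exec_seq; last exact: exec_skip.
        xseq (apply: exec_apex_row; rd; [exact: hU | exact: hJ | exact: hD]).
        by apply: Hs; rd.
      * by rd; seqc.
      * lia.
    apply: exec_conv.
    * apply: exec_seq; last exact: exec_skip.
      by apply: exec_apex_row; rd; [exact: hU | exact: hJ | exact: hD].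
    * by rd; rewrite addn0; seqc.
    * lia.
  + by seqc.
- rd; rewrite !revK !cats0 /apex_matrix size_rev hj; seqc.
- rd; rewrite size_rev hj; lia.
Qed.

Lemma exec_copy_row n (s : store) :
  s sU2 = nseq n true -> s sD = [::] -> n <= size (s sA) ->
  exec copy_row s
    (upd (upd (upd s sA (drop n (s sA))) sA2 (rev (take n (s sA)) ++ s sA2)) sO
       (rev (take n (s sA)) ++ s sO)) (12 * n + 2).
Proof.
move=> hU hD hA; apply: exec_conv.
- rewrite /copy_row; apply: exec_seq; last exact: exec_mv.
  apply: exec_conv2 (exec_for sU2 _ _ _ 6 (nseq n true) (fun p l =>
    upd (upd (upd (upd (upd s sU2 l) sD (nseq (size p) true)) sA (drop (size p) (s sA)))
      sA2 (rev (take (size p) (s sA)) ++ s sA2)) sO (rev (take (size p) (s sA)) ++ s sO)) _ _)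
    _ (erefl _) (leqnn _).
  + by move=> p l E; rd.
  + move=> p b l E; rewrite size_rcons.
    have -> : b = true.
      have : b \in nseq n true by rewrite -E mem_cat inE eqxx orbT.
      by rewrite mem_nseq => /andP[_ /eqP].
    have hp : size p < size (s sA).
      by apply: leq_trans hA; rewrite -(size_nseq n true) -E size_cat /=; lia.
    rewrite (take_nth false hp) (drop_nth false hp) rev_rcons.
    by case: (nth _ _ _); apply: exec_conv; [by xrun | by rd; seqc | by [] | by xrun | by rd; seqc | ].
  + by rewrite take0 drop0; rd; seqc.
- by rd; rewrite !size_nseq rev_nseq cats0; seqc.
- by rd; rewrite !size_nseq; lia.
Qed.

Lemma exec_vertex_rows n adj (s : store) :
  s sU1 = nseq n true -> s sU2 = nseq n true -> s sD = [::] -> s sD2 = [::] -> s sM2 = [::] ->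
  s sA2 = [::] -> s sA = rev adj -> size adj = n * n ->
  exec vertex_rows s (upd s sO (vertex_matrix n adj (rev (s sM)) ++ s sO))
    ((12 * size (s sM) + 20 * n + 20) * n + 4).
Proof.
move=> hU1 hU2 hD hD2 hM2 hA2 hA hs.
(* The matrix lies reversed on [sA], so its last row is copied first: after [k] rounds the last [k]
   rows are in place. *)
pose rows k := flatten [seq take n (drop (i * n) adj) ++ rev (s sM) | i <- iota (n - k) k].
apply: exec_conv.
- rewrite /vertex_rows.
  apply: exec_seq.
    apply: exec_conv2 (exec_for sU1 _ _ _ (12 * size (s sM) + 12 * n + 10) (nseq n true) (fun p l =>
      upd (upd (upd (upd (upd s sU1 l) sD2 (nseq (size p) true)) sA (drop (size p * n) (s sA)))
      sA2 (rev (take (size p * n) (s sA)) ++ s sA2)) sO (rows (size p) ++ s sO)) _ _)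
    _ (erefl _) (leqnn _).
    + by move=> p l E; rd.
    + move=> p b l E; rewrite size_rcons.
      have Eb : b = true.
        have : b \in nseq n true by rewrite -E mem_cat inE eqxx orbT.
        by rewrite mem_nseq => /andP[_ /eqP].
      have hp : size p < n by rewrite -(size_nseq n true) -E size_cat /=; lia.
      rewrite {}Eb in E *; lazy iota.
      apply: exec_conv.
      * xseq exact: exec_push.
        xseq (apply: exec_emit_bits; rd; try exact: hD).
        apply: exec_copy_row; rd; [exact: hU2 | exact: hD |].
        by rewrite hA size_drop size_rev hs; nia.
      * rd; rewrite drop_drop.
        have -> : rows (size p).+1 ++ s sO = rev (take n (drop (size p * n) (s sA))) ++
            rev (s sM) ++ rows (size p) ++ s sO.
          rewrite /rows (_ : n - (size p) = (n - (size p).+1).+1); last by lia.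
          rewrite /= -!catA; congr (_ ++ _).
          rewrite hA drop_rev take_rev revK take_drop size_takel; last by rewrite hs; lia.
          rewrite hs; congr (drop _ (take _ _)); nia.
        rewrite mulSn [in RHS]addnC takeD rev_cat -catA addnC; seqc.
      * by rd; lia.
    + by rewrite take0 drop0 /rows /=; rd; seqc.
  xseq exact: exec_mv.
  exact: exec_mv.
- rd; rewrite !size_nseq !rev_nseq !cats0 hA2 cats0 revK cat_take_drop /rows subnn; seqc.
- rd; rewrite !size_nseq hA2 cats0 size_rev size_take hA size_rev hs ltnn; nia.
Qed.

Lemma rev_sd_pairs (w : seq bool) :
  rev (flatten [seq if b then [:: true; true] else [:: false; true] | b <- w]) = sd_bits (rev w).
Proof.
elim: w => //= b w IH; rewrite rev_cat IH rev_cons -cats1 /sd_bits map_cat flatten_cat /=.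
by case: b.
Qed.

Lemma rev_sd_zeros (w : seq bool) : rev (flatten [seq if b then [:: false; true; false; true]
    else [:: false; true; false; true] | b <- w]) = sd_bits (nseq (2 * size w) false).
Proof.
elim: w => // b w IH.
rewrite (_ : 2 * size (b :: w) = 2 * size w + 2); last by rewrite /=; lia.
rewrite nseqD /sd_bits map_cat flatten_cat -/(sd_bits _) -IH map_cons /= rev_cat.
by case: b.
Qed.

Lemma exec_headers (s : store) : s sD = [::] -> s sD2 = [::] ->
  exec headers s (upd s sO (sd (s sNP) ++ sd (nseq (2 * size (s sKB)) false ++ rev (s sKB)) ++ s sO))
    (40 * size (s sKB) + 30 * size (s sNP) + 30).
Proof.
move=> hD hD2; apply: exec_conv.
- rewrite /headers.
  xseq exact: exec_pushes.
  xseq (apply: exec_emit; rd).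
  xseq (apply: exec_emit; rd).
  xseq exact: exec_pushes.
  xseq exact: exec_mv.
  xseq (apply: exec_emit; rd).
  exact: exec_mv.
- rd; rewrite hD2 !cats0 !revK !rev_sd_pairs rev_sd_zeros revK.
  rewrite /sd /sd_bits map_cat flatten_cat -/(sd_bits _) -!catA /=; seqc.
- by rd; rewrite hD2 cats0 !size_rev /=; lia.
Qed.

Lemma exec_build_query n j adj np (s : store) :
  s sO = [::] -> s sU1 = nseq n true -> s sU2 = nseq n true -> s sJ = nseq j true ->
  s sD = [::] -> s sD2 = [::] -> s sM2 = [::] -> s sA2 = [::] -> s sSg = [::] ->
  size (s sM) = j -> s sA = rev adj -> size adj = n * n -> s sNP = np ->
  exec build_query s
    (upd (upd s sO (query_word np (s sKB) adj (rev (s sM)) n)) sSg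
      (nseq (odd (count id (s sM))) true))
    ((11 * (n + j) + 20) * j + (12 * j + 20 * n + 20) * n + 40 * size (s sKB) + 30 * size np + 36).
Proof.
move=> hO hU1 hU2 hJ hD hD2 hM2 hA2 hSg hj hA hs hnp; apply: exec_conv.
- rewrite /build_query.
  xseq apply: (@exec_apex_rows n j).
  xseq (apply: (@exec_vertex_rows n adj); rd).
  apply: exec_headers; rd => //.
- rd; rewrite /query_word hO hnp cats0; seqc.
- rd; rewrite hj hnp; lia.
Qed.

Definition next_mask (m : seq bool) := addb false true m [::].

(** The query contains [rev m] because emission onto stack 0 reverses the mask, in the new rows and
    the new columns alike. *)
Definition next_acc (q : seq bool -> seq bool) (m a : seq bool) :=
  if odd (count id m) then addb true true a (O (q (rev m))) else addb false false a (O (q (rev m))).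

Fixpoint loop_state (q : seq bool -> seq bool) (m a : seq bool) (i : nat) : seq bool * seq bool :=
  if i is i'.+1 then
    let: (m', a') := loop_state q m a i' in (next_mask m', next_acc q m' a')
  else (m, a).

Lemma size_loop_state q m a i : size (loop_state q m a i).1 = size m /\
  size (loop_state q m a i).2 = size a.
Proof.
elim: i => //= i; case: (loop_state _ _ _ _) => m' a' /= [<- <-].
by rewrite /next_acc; case: ifP; rewrite !size_addb.
Qed.

(** [R] bounds the length of the answers, since erasing the rest of an answer takes linear time. *)
Lemma exec_mask_loop N n j adj np R (s : store) (q := fun m => query_word np (s sKB) adj m n) :
  s sO = [::] -> s sU1 = nseq n true -> s sU2 = nseq n true -> s sJ = nseq j true ->
  s sD = [::] -> s sD2 = [::] -> s sM2 = [::] -> s sA2 = [::] -> s sSg = [::] ->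
  s sCt = [::] -> s sZ = [::] ->
  size (s sM) = j -> s sA = rev adj -> size adj = n * n -> s sNP = np ->
  s sJ2 = nseq N true ->
  (forall m, size m = j -> P (q m) /\ size (O (q m)) <= R) ->
  exec mask_loop s
    (let: (m, a) := loop_state q (s sM) (s sAcc) N in
     upd (upd (upd s sJ2 [::]) sM m) sAcc a)
    (((11 * (n + j) + 20) * j + (12 * j + 20 * n + 20) * n + 40 * size (s sKB) + 30 * size np +
      20 * size (s sAcc) + 20 * j + 3 * R + 100) * N + 1).
Proof.
move=> hO hU1 hU2 hJ hD hD2 hM2 hA2 hSg hCt hZ hj hA hs hnp hJ2 hq.
apply: exec_conv2 (exec_for sJ2 _ _ _ (((11 * (n + j) + 20) * j + (12 * j + 20 * n + 20) * n +
   40 * size (s sKB) + 30 * size np + 20 * size (s sAcc) + 20 * j + 3 * R + 99)) (nseq N true) 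
  (fun p l => upd (upd (upd s sJ2 l) sM (loop_state q (s sM) (s sAcc) (size p)).1)
                 sAcc (loop_state q (s sM) (s sAcc) (size p)).2) _ _) _ _ _.
- by move=> p l E; rd.
- move=> p b l E; rewrite size_rcons /=.
  have [] := size_loop_state q (s sM) (s sAcc) (size p).
  case: (loop_state _ _ _ _) => m a /= hm ha.
  have hsk u : exec (if b then Skip else Skip) u u 1 by case: (b); exact: exec_skip.
  have [hP hR] := hq (rev m) (etrans (size_rev _) (etrans hm hj)).
  apply: exec_conv.
  + xseq apply: hsk.
    xseq (apply: (@exec_build_query n j adj np); rd => //; rewrite ?hm ?hj).
    xseq (apply: (@EQuery _ _ _ 1) => //; rd).
    apply: (@exec_seq _ _ _ _ _ 
      (upd (upd (upd (upd s sJ2 l) sM m) sAcc (next_acc q m a)) sO (drop (size a) (O (q (rev m)))))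
      _ (20 * size a + 14)).
      rewrite /next_acc; case: (odd _).
        apply: exec_conv.
        * apply: exec_case1; first by rd.
          lazy iota; xseq exact: exec_push.
          by apply: (@exec_adder _ _ true true); rd => //; rewrite hCt.
        * by rd; seqc; rewrite ?hSg ?hCt.
        * by rd; lia.
      apply: exec_conv.
      * apply: exec_case0; first by rd.
        by apply: (@exec_adder _ _ false false); rd => //; rewrite hCt.
      * by rd; seqc; rewrite ?hSg ?hCt.
      * by rd; lia.
    rd.
    xseq exact: exec_clr.
    xseq exact: exec_push.
    by apply: (@exec_adder _ _ false true); rd => //; rewrite hCt.
  + by rd; rewrite hZ; seqc; rewrite ?hSg ?hCt.
  + rd. rewrite hm hj ha size_drop.
    set X1 := (11 * (n + j) + 20) * j; set X2 := (12 * j + 20 * n + 20) * n.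
    lia.
- by rewrite /=; seqc.
- by rewrite size_nseq; case: (loop_state _ _ _ _) => m a.
- rewrite size_nseq; set X1 := (11 * (n + j) + 20) * j; set X2 := (12 * j + 20 * n + 20) * n.
  by rewrite -addSn; apply: leq_trans (leqnn _); rewrite leq_add2r leq_mul2r; lia.
Qed.

Lemma exec_phase_end (s : store) : s sD = [::] -> s sD2 = [::] -> s sLive = [::] ->
  exec phase_end s
    (upd (upd s sLive (nseq (has id (s sAcc)) true)) sKB (s sK))
    (20 * size (s sAcc) + 20 * size (s sK) + 3 * size (s sKB) + 20).
Proof.
move=> hD hD2 hL; apply: exec_conv.
- rewrite /phase_end; apply: exec_seq.
    apply: exec_conv2 (exec_for sAcc _ _ _ 11 (s sAcc) (fun p l =>
      upd (upd (upd s sAcc l) sD (rev p)) sLive (nseq (has id p) true)) _ _) _ (erefl _) (leqnn _).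
    + by move=> p l E; rd.
    + move=> p [] l E; rewrite rev_rcons has_rcons /=.
        apply: exec_conv.
        * apply: exec_seq; last exact: exec_skip.
          xseq exact: exec_push.
          xseq exact: exec_clr.
          exact: exec_push.
        * by rd; seqc.
        * by rd; rewrite size_nseq; case: (has _ _).
      apply: exec_conv.
      * apply: exec_seq; last exact: exec_skip.
        exact: exec_push.
      * by rd; seqc.
      * by [].
    + by seqc.
  xseq exact: exec_mv.
  xseq exact: exec_clr.
  xseq (apply: exec_emit_bits; rd).
  exact: exec_mv.
- by rd; rewrite hD2 !cats0 !revK; seqc.
- by rd; rewrite hD2 cats0 !size_rev; lia.
Qed.

Section Phase.
Variables (n : nat) (bn adj kk : seq bool).

(** The state between phases. The stacks bounded by [m] may hold leftovers of the previous phase,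
    which [setup] erases at a cost linear in [m]. *)
Definition ready (m : nat) (s : store) : Prop :=
  [/\ s sO = [::], s sU1 = nseq n true, s sU2 = nseq n true, s sA = rev adj & s sN = rev bn] /\
  [/\ s sD = [::], s sD2 = [::], s sM2 = [::], s sA2 = [::] & s sSg = [::]] /\
  [/\ s sCt = [::], s sZ = [::], s sY = [::], s sJ2 = [::] & s sK = kk] /\
  [/\ s sErr = [::], size (s sJ) <= m, size (s sM) <= m, size (s sNP) <= m & size (s sAcc) <= m].

Definition total_bits (l : nat) : seq bool :=
  addb false false (bn ++ nseq (4 ^ l) false) (rcons (nseq (2 * l) false) true).

Definition phase_query (kb m : seq bool) := query_word (total_bits (size kb)) kb adj m n.

Definition phase_result (kb : seq bool) : seq bool :=
  (loop_state (phase_query kb) (nseq (4 ^ size kb) false) (nseq n.+1 false) (2 ^ (4 ^ size kb))).2.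

Definition phase_time (m R l : nat) : nat :=
  let j := 4 ^ l in let J := 2 ^ j in let b := size bn in
  (12 * m + 26 * j * l + 40 * l + 18 * J * j + 60 * j + 40 * b + 20 * n + 100) +
  (((11 * (n + j) + 20) * j + (12 * j + 20 * n + 20) * n + 40 * l + 30 * (b + j) +
      20 * n.+1 + 20 * j + 3 * R + 100) * J + 1) +
  (20 * n.+1 + 20 * size kk + 3 * l + 20).

Lemma exec_phase kb m R (s : store) : ready m s -> size adj = n * n ->
  s sKB = kb -> s sLive = [::] ->
  (forall m, size m = 4 ^ size kb -> P (phase_query kb m) /\ size (O (phase_query kb m)) <= R) ->
  exists s', [/\ exec (setup ;; mask_loop ;; phase_end) s s' (phase_time m R (size kb)),
    ready (n.+1 + size bn + 4 ^ size kb) s',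
    s' sAcc = phase_result kb,
    s' sKB = kk & (s' sLive = nseq (has id (phase_result kb)) true /\ s' sPh = s sPh)].
Proof.
move=> [[h1 h2 h3 h4 h5] [[h6 h7 h8 h9 h10] [[h11 h12 h13 h14 h15] [h16 h17 h18 h19 h20]]]] hs hkb hl hq.
have [] := size_loop_state (phase_query kb) (nseq (4 ^ size kb) false) (nseq n.+1 false) (2 ^ (4 ^ size kb)).
move=> hsz1 hsz2; rewrite -/(phase_result kb) !size_nseq in hsz1 hsz2.
eexists; split.
- apply: exec_le.
    apply: exec_seq; first exact: (@exec_setup _ _ n bn m).
    rewrite /setup_store hkb /=; rd.
    apply: exec_seq.
      apply: (@exec_mask_loop (2 ^ (4 ^ size kb)) n (4 ^ size kb) adj (total_bits (size kb)) R);
        rd => //; rewrite ?hkb ?size_nseq //.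
    rd; rewrite hkb -/(phase_query kb); rewrite [loop_state _ _ _ _]surjective_pairing -/(phase_result kb).
    by apply: exec_phase_end; rd.
  rewrite /phase_time; rd; rewrite h15 hkb hsz2 !(size_nseq, size_addb, size_cat) [size (_ :: _)]/= size_nseq.
  set j := 4 ^ _; set J := 2 ^ j; set Y := (X in X * J); lia.
- by do !split; rd; rewrite ?hsz1 ?hsz2 ?size_addb ?size_cat ?size_nseq //; lia.
- by rd.
- by rd.
- by rd.
Qed.
End Phase.
End Phases.

Lemma dec_sd_size m w p r : size w <= m -> dec_sd w = Some (p, r) -> size p + size r <= size w.
Proof.
elim: m w p r => [|m IH] [|[] [|b w]] p r //= hs.
  case E: (dec_sd w) => [[p' r']|] // [<- <-].
  by have /= := IH _ _ _ _ E; lia.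
by case: b hs => // _ [<- <-] /=; lia.
Qed.

(** * The complete program on undecodable and decodable inputs *)

Section MainProgram.
Variables (O : seq bool -> seq bool) (P : seq bool -> Prop).
Notation exec := (exec O P).

Section Program.
Variables (n : nat) (bn adj kk : seq bool).
Hypothesis adj_size : size adj = n * n.
Notation ready := (ready n bn adj kk).
Notation phase_query := (phase_query n bn adj).
Notation phase_result := (phase_result O n bn adj).
Notation phase_time := (phase_time n bn kk).
Let r1 := phase_result [:: true].

Hypothesis query1 : forall m, size m = 4 -> 
  P (phase_query [:: true] m) /\ size (O (phase_query [:: true] m)) <= n + 6.
Hypothesis query2 : has id r1 -> kk <> [::] -> forall m, size m = 4 ^ size kk -> 
  P (phase_query kk m) /\ size (O (phase_query kk m)) <= n + 4 ^ size kk + 2.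

(** The second phase is charged only if it takes place: a malformed instance has parameter 0
    whatever [kk] is, so [4 ^ size kk] must not enter its bound. *)
Definition phases_time :=
  phase_time 0 (n + 6) 1 +
  (if has id r1 && (kk != [::])
   then phase_time (n.+1 + size bn + 4) (n + 4 ^ size kk + 2) (size kk) else 0) + 30.

Lemma exec_phases (s : store) : ready 0 s ->
  s sPh = [::] -> s sKB = [::] -> s sLive = [::] -> head true kk ->
  exists m s', [/\ exec phases s s' phases_time, 
    m <= n.+1 + size bn + 4 + (if has id r1 && (kk != [::]) then 4 ^ size kk else 0), ready m s',
    s' sAcc = (if has id r1 && (kk != [::]) then phase_result kk else r1) &
    kk = [::] -> s' sLive = nseq (has id r1) true].
Proof.
move=> hr hph hkb hl hh.
have hK : s sK = kk by case: hr => _ [_ [[]]].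
pose ph := if kk == [::] then [:: true] else [:: true; true].
pose s1 := upd (upd (upd s sPh ph) sKB [:: true]) sLive [:: true].
have H1 u t : exec (For sPh Skip Skip (Case sLive Skip Skip (setup ;; mask_loop ;; phase_end))) s1 u t ->
    exec phases s u (t + 6).
  move=> H; apply: exec_le.
    rewrite /phases; xseq exact: exec_push.
    apply: (@exec_seq _ _ _ _ _ (upd s sPh ph) _ 3).
      rewrite /ph; case: kk hK hh => [|[] k'] // E _.
        apply: exec_conv; first by apply: exec_case0; [rd; exact: E | exact: exec_skip].
          by rd; rewrite hph; seqc.
        by [].
      apply: exec_conv.
      - apply: exec_case1; first by rd; exact: E.
        lazy iota; xseq exact: exec_push.
        exact: exec_push.
      - by rd; rewrite hph; seqc; rewrite E.
      - by [].
    xseq exact: exec_push.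
    xseq exact: exec_push.
    rewrite hkb hl; exact: H.
  lia.
have [|//||||s2 [E2 R2 A2 K2 [L2 P2]]] := @exec_phase O P n bn adj kk [:: true] 0 (n + 6)
   (upd (upd s1 sPh (behead ph)) sLive [::]).
- by move: hr => [[? ? ? ? ?] [[? ? ? ? ?] [[? ? ? ? ?] [? ? ? ? ?]]]]; do !split; rd.
- by rd.
- by rd.
- by rewrite expn1; exact: query1.
rewrite -/r1 in A2 L2.
have H2 : exec (Case sLive Skip Skip (setup ;; mask_loop ;; phase_end)) (upd s1 sPh (behead ph)) s2
    (phase_time 0 (n + 6) 1).+1.
  by apply: exec_case1; [by rd | lazy iota; exact: E2].
have hP1 : s1 sPh = true :: behead ph by rewrite /s1 /ph; rd; case: eqP.
have P2' : s2 sPh = behead ph by rewrite P2; rd.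
have [k0|k0] := eqVneq kk [::].
  exists (n.+1 + size bn + 4), s2; split=> //.
  - apply: exec_le.
      apply: H1; apply: (EFor1 hP1 (exec_skip _) H2 (EFor0 _ _ _ _ _ _ (ltn0Sn 0))) (leqnn _).
      by rewrite P2' /ph k0.
    by rewrite /phases_time k0 andbF /=; lia.
  - by lia.
  - by rewrite k0 andbF.
rewrite andbT.
have P2'' : s2 sPh = true :: [::] by rewrite P2' /ph (negbTE k0).
case hv : (has id r1); last first.
  exists (n.+1 + size bn + 4), (upd s2 sPh [::]); split=> //.
  - apply: exec_le.
      apply: H1; apply: (EFor1 hP1 (exec_skip _) H2 (EFor1 P2'' (exec_skip _) _ (EFor0 _ _ _ _ _ _ (ltn0Sn 0)) (leqnn _))) (leqnn _).
        by apply: exec_case0; [by rd; rewrite L2 hv | exact: exec_skip].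
      by rd.
    by rewrite /phases_time hv /=; lia.
  - by lia.
  - by move=> E; rewrite E in k0.
have [|//||||s3 [E3 R3 A3 K3 [L3 P3]]] := @exec_phase O P n bn adj kk kk (n.+1 + size bn + 4) (n + 4 ^ size kk + 2)
   (upd (upd s2 sPh [::]) sLive [::]).
- by move: R2 => [[? ? ? ? ?] [[? ? ? ? ?] [[? ? ? ? ?] [? ? ? ? ?]]]]; do !split; rd.
- by rd.
- by rd.
- by apply: query2 => //; move/eqP: k0.
exists (n.+1 + size bn + 4 ^ size kk), s3; split=> //.
- apply: exec_le.
    apply: H1; apply: (EFor1 hP1 (exec_skip _) H2 (EFor1 P2'' (exec_skip _) _ (EFor0 _ _ _ _ _ _ (ltn0Sn 0)) (leqnn _))) (leqnn _).
      by apply: exec_case1; [by rd; rewrite L2 hv | lazy iota; exact: E3].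
    by rewrite P3; rd.
  by rewrite /phases_time hv k0 /=; lia.
- by lia.
- by move=> E; rewrite E in k0.
Qed.

(** If the second phase is skipped although [kk] is nonempty, then [r1] is zero. With the intended
    oracle so is the required count, the instance being malformed or without vertices. *)
Definition final_word : seq bool :=
  if kk == [::] then
    if n == 0 then nseq (~~ has id bn) true else nseq (has id r1) true
  else dropz (rev (if has id r1 then phase_result kk else r1)).

Lemma exec_output m (s : store) : ready m s -> head true kk ->
  s sAcc = (if has id r1 && (kk != [::]) then phase_result kk else r1) ->
  (kk = [::] -> s sLive = nseq (has id r1) true) ->
  exists s', exec output s s' (23 * m + 6 * size bn + 30) /\ s' 0 = final_word.
Proof.
clear adj_size query1 query2.
move=> [[h1 h2 h3 h4 h5] [[h6 h7 h8 h9 h10] [[h11 h12 h13 h14 h15] [h16 h17 h18 h19 h20]]]] hh hA hL.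
rewrite /final_word; move: (has id r1) hA hL => v hA hL.
move: (r1) (phase_result kk) hA => r2 r3 hA.
case: kk hh h15 hA hL => [|[] k'] // _ h15 hA hL; last first.
  rewrite andbT in hA; rewrite -hA; eexists; split.
    apply: exec_le.
      apply: exec_case1; first exact: h15.
      lazy iota; apply: exec_seq; first exact: exec_mv.
      by apply: exec_strip; rd.
    by rd; rewrite h1 cats0 size_rev; lia.
  by rd; rewrite h1 cats0.
have {}hL := hL erefl; rewrite eqxx.
case: (n) h2 => [|n'] h2; last first.
  eexists; split.
    apply: exec_le.
      apply: exec_case0; first exact: h15.
      apply: exec_case1; first exact: h2.
      lazy iota. 
      instantiate (1 := 3); instantiate (1 := upd (upd (upd s sU1 (nseq n' true)) sLive [::]) sO (nseq v true)).
      case: v hL hA => hL hA.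
        have {}hL : s sLive = [:: true] := hL.
        apply: exec_conv; [apply: exec_case1; [by rd; exact: hL | lazy iota; exact: exec_push] | rd; rewrite h1; seqc | by []].
      apply: exec_conv; [apply: exec_case0; [by rd; rewrite hL | exact: exec_skip] | seqc | by []].
    by lia.
  by rd.
pose e := nseq (count id bn) true.
have H : exec (For sN Skip (Push sErr true) Skip) s (upd (upd s sN [::]) sErr e) (3 * size bn + 1).
  apply: exec_conv2 (exec_for sN _ _ _ 2 (rev bn) (fun p l =>
      upd (upd s sN l) sErr (nseq (count id p) true)) _ _) _ _ _.
  - by move=> p l E; rd.
  - move=> p [] l E; rewrite -cats1 count_cat /= ?addn0 ?addn1.
      by apply: exec_conv; [apply: exec_seq; [exact: exec_push | exact: exec_skip] | rd; seqc | ].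
    by apply: exec_conv; [apply: exec_seq; [exact: exec_skip | exact: exec_skip] | rd; seqc | ].
  - by seqc.
  - by rewrite /e count_rev.
  - by rewrite size_rev.
rewrite has_count.
exists (if count id bn is c.+1 then upd (upd s sN [::]) sErr (nseq c true) 
        else upd (upd (upd s sN [::]) sErr [::]) sO [:: true]); split.
  apply: exec_le.
    apply: exec_case0; first exact: h15.
    apply: exec_case0; first exact: h2.
    apply: exec_seq H _.
    instantiate (1 := 3); rewrite /e; case: (count _ _) => [|c].
      apply: exec_conv; [apply: exec_case0; [by rd | exact: exec_push] | rd; rewrite h1; seqc | by []].
    apply: exec_conv; [apply: exec_case1; [by rd | lazy iota; exact: exec_skip] | rd; seqc | by []].
  by lia.
by case: (count _ _) => [|c]; rd.
Qed.
End Program.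

Lemma exec_parse n (dst T : nat) (s : store) : 
  T != dst -> T != sX -> T != sAct -> T != sErr -> dst != sX -> dst != sAct -> dst != sErr ->
  s T = nseq n true -> s sAct = [::] -> size (s sX) <= n ->
  match dec_sd (s sX) with
  | Some (p, r) => exec (parse dst T) s
      (upd (upd (upd (upd s T [::]) sX r) dst (rev p ++ s dst)) sAct [::]) (10 * n + 13)
  | None => exists s', [/\ exec (parse dst T) s s' (10 * n + 13), s' sErr <> [::] &
      (sO != T -> sO != dst -> s' sO = s sO)]
  end.
Proof.
move=> hTd hT1 hT5 hT6 hd1 hd5 hd6 hT h5 hX.
have hn m : 1 + (1 + (10 * m.+1 + 1)) <= 10 * m + 13 by lia.
have := @exec_parse_loop O P n.+1 dst T (upd (upd s sAct [:: true]) T (nseq n.+1 true)).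
do 7!(move/(_ ltac:(assumption))).
have -> : upd (upd s sAct [:: true]) T (nseq n.+1 true) sX = s sX by upds.
move=> /(_ _ _ _) H.
have {H} := H (updE _ _ _) _ _.
have H0 : upd (upd s sAct [:: true]) T (nseq n.+1 true) sAct = [:: true] by upds.
move=> /(_ H0 hX).
have Hp s' : exec (parse_loop dst T) (upd (upd s sAct [:: true]) T (nseq n.+1 true)) s' (10 * n.+1 + 1) ->
    exec (parse dst T) s s' (10 * n + 13).
  move=> H; apply: exec_le (hn n); apply: exec_seq; first exact: exec_push.
  apply: exec_seq; first exact: exec_push.
  by rewrite h5 upd_ne // hT.
case: (dec_sd _) => [[p r]|].
  by move=> H; apply: exec_conv (Hp _ H) _ _ => //; upds; steq.
move=> [s' [H1 H2 H3]]; exists s'; split=> //; first exact: Hp.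
by move=> a b; rewrite H3 //; upds.
Qed.

Lemma exec_guard_fail c (s : store) : s sErr <> [::] ->
  exists2 s', exec (Case sErr c Skip Skip) s s' 2 & s' 0 = s 0.
Proof.
case E: (s sErr) => [|b l] // _; exists (upd s sErr l); last by rd.
have hsk u : exec (if b then Skip else Skip) u u 1 by case: (b); exact: exec_skip.
exact: exec_case1 E (hsk _).
Qed.

Lemma exec_guard_ok c (s s' : store) t : s sErr = [::] -> exec c s s' t ->
  exec (Case sErr c Skip Skip) s s' t.+1.
Proof. exact: exec_case0. Qed.

(** These are the defects that the program detects itself. A wrong vertex number, an asymmetric
    matrix or a nonzero diagonal passes this stage and spoils the queries instead. *)
Lemma exec_main_fail x :
  (match dec_sd x with
   | Some (_, r) => if dec_sd r is Some (_, adj) then forall w, size adj <> w * w else True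
   | None => True end) ->
  exists s', exec main_prog (start_store x) s' (200 * (size x).+1 ^ 2) /\ s' 0 = [::].
Proof.
move=> hx.
pose s1 := upd (upd (upd (upd (start_store x) sO [::]) sX x) sT1 (nseq (size x) true))
   sT2 (nseq (size x) true).
have H1 : exec read_input (start_store x) s1 (4 * size x + 1).
  apply: exec_conv (exec_read_input _ _ _) _ _; rewrite /s1 /start_store; rd.
    by rewrite revK /empty_store !cats0 size_rev; seqc.
  by rewrite size_rev.
have := @exec_parse (size x) sN sT1 s1 isT isT isT isT isT isT isT.
rewrite /s1; rd; rewrite -/s1 => /(_ erefl erefl (leqnn _)).
have hsq : (size x).+1 ^ 2 = size x * size x + 2 * size x + 1 by rewrite expnS expn1; lia.
case E1: (dec_sd x) hx => [[bn r]|] hx; last first.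
  move=> [s' [H2 H3 H4]]; have [s3 H5 H6] := exec_guard_fail (parse sK sT2 ;; Case sErr (read_matrix ;; sqrt_loop ;;
     Case sErr (strip sK sD sCt ;; phases ;; output) Skip Skip) Skip Skip) H3.
  exists s3; split; last by rewrite H6 H4.
  by apply: exec_le; first apply: exec_seq H1 (exec_seq H2 H5); lia.
rewrite (_ : rev bn ++ _ = rev bn); last by rewrite /start_store; rd; rewrite cats0.
have hr := dec_sd_size (leqnn _) E1.
set s2 := upd _ 5 [::] => H2.
have E2 : s2 sErr = [::] by [].
have := @exec_parse (size x) sK sT2 s2 isT isT isT isT isT isT isT.
rewrite /s2 /s1; rd; rewrite -/s1 -/s2 => /(_ erefl erefl).
case E3: (dec_sd r) hx => [[bk adj]|] hx; last first.
  case; first by lia.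
  move=> s' [H3 H4 H5]; have [s3 H6 H7] := exec_guard_fail (read_matrix ;; sqrt_loop ;;
     Case sErr (strip sK sD sCt ;; phases ;; output) Skip Skip) H4.
  exists s3; split; last by rewrite H7 H5.
  apply: exec_le; first apply: exec_seq H1 (exec_seq H2 (exec_guard_ok E2 (exec_seq H3 H6))).
  lia.
have hadj := dec_sd_size (leqnn _) E3.
rewrite (_ : rev bk ++ _ = rev bk); last by rewrite /start_store; rd; rewrite cats0.
set s3 := upd _ 5 [::] => H3.
have {}H3 := H3 _; have {}H3 := H3 ltac:(lia).
have H4 := @exec_read_matrix O P s3.
set s4 := upd _ 4 _ in H4.
have [|||||||v [e' [H5 [_ H6 H7]]]] := @exec_sqrt O P (size adj) (size adj) 0 0 s4 (leqnn _);
  try by rewrite /s4 /s3 /s2 /s1 /start_store; rd; rewrite ?cats0.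
set s5 := upd _ 6 _ in H5.
have E5 : s5 sErr <> [::].
  rewrite /s5; rd; case: (e') H6 => // H6.
  by case: (hx v); have := H6 erefl; rewrite addn0 expnS expn1.
have [s6 H8 H9] := exec_guard_fail (strip sK sD sCt ;; phases ;; output) E5.
exists s6; split; last by rewrite H9 /s5 /s4 /s3 /s2 /s1; rd.
apply: exec_le; first apply: exec_seq H1 (exec_seq H2 (exec_guard_ok E2 (exec_seq H3 (exec_guard_ok _ (exec_seq H4 (exec_seq H5 H8)))))).
  by [].
have -> : s3 sX = adj by rewrite /s3; rd.
nia.
Qed.

Definition main_time n bn adj kk (x : seq bool) := 300 * (size x).+1 ^ 2 + phases_time n bn adj kk +
  23 * (n.+1 + size bn + 4 +
    (if has id (phase_result O n bn adj [:: true]) && (kk != [::]) then 4 ^ size kk else 0)).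

(** Leading zeros of the encoded k are stripped so that [size kk], and with it j, depends on the
    value of k alone, as the parameter does. *)
Lemma exec_main_ok x bn r bk adj n (kk := dropz (rev bk)) :
  dec_sd x = Some (bn, r) -> dec_sd r = Some (bk, adj) -> size adj = n * n ->
  (forall m, size m = 4 -> 
    P (phase_query n bn adj [:: true] m) /\ size (O (phase_query n bn adj [:: true] m)) <= n + 6) ->
  (has id (phase_result O n bn adj [:: true]) -> kk <> [::] -> forall m, size m = 4 ^ size kk -> 
    P (phase_query n bn adj kk m) /\ size (O (phase_query n bn adj kk m)) <= n + 4 ^ size kk + 2) ->
  exists s', exec main_prog (start_store x) s' (main_time n bn adj kk x) /\
    s' 0 = final_word n bn adj kk.
Proof.
move=> E1 E3 hadj q1 q2.
pose s1 := upd (upd (upd (upd (start_store x) sO [::]) sX x) sT1 (nseq (size x) true))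
   sT2 (nseq (size x) true).
have H1 : exec read_input (start_store x) s1 (4 * size x + 1).
  apply: exec_conv (exec_read_input _ _ _) _ _; rewrite /s1 /start_store; rd.
    by rewrite revK /empty_store !cats0 size_rev; seqc.
  by rewrite size_rev.
have := @exec_parse (size x) sN sT1 s1 isT isT isT isT isT isT isT.
rewrite /s1; rd; rewrite -/s1 => /(_ erefl erefl (leqnn _)).
have hsq : (size x).+1 ^ 2 = size x * size x + 2 * size x + 1 by rewrite expnS expn1; lia.
rewrite E1 (_ : rev bn ++ _ = rev bn); last by rewrite /start_store; rd; rewrite cats0.
have hr := dec_sd_size (leqnn _) E1.
set s2 := upd _ 5 [::] => H2.
have E2 : s2 sErr = [::] by [].
have := @exec_parse (size x) sK sT2 s2 isT isT isT isT isT isT isT.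
rewrite /s2 /s1; rd; rewrite -/s1 -/s2 => /(_ erefl erefl).
have hadj' := dec_sd_size (leqnn _) E3.
rewrite E3 (_ : rev bk ++ _ = rev bk); last by rewrite /start_store; rd; rewrite cats0.
set s3 := upd _ 5 [::] => H3.
have {}H3 := H3 ltac:(lia).
have H4 := @exec_read_matrix O P s3.
set s4 := upd _ 4 _ in H4.
have [|||||||v [e' [H5 [_ H6 H7]]]] := @exec_sqrt O P (size adj) (size adj) 0 0 s4 (leqnn _);
  try by rewrite /s4 /s3 /s2 /s1 /start_store; rd; rewrite ?cats0.
have e0 : e' = 0.
  case: (e') H7 => // k /(_ isT n); rewrite addn0 expnS expn1 hadj; by case.
have hv : v = n.
  by apply/eqP; rewrite -eqn_sqr -(H6 e0) hadj addn0 expnS expn1.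
rewrite {}e0 {}hv in H5.
set s5 := upd _ 6 _ in H5.
have H8 := @exec_strip O P sK sD sCt s5 isT isT isT erefl erefl.
set s6 := upd s5 sK _ in H8.
have [|||||m [s7 [H9 hm R7 A7 L7]]] := @exec_phases n bn adj kk hadj q1 q2 s6.
- do !split; rewrite /s6 /s5 /s4 /s3 /s2 /s1 /start_store; rd => //.
    by rewrite cats0.
- by rewrite /s6 /s5 /s4 /s3 /s2 /s1 /start_store; rd.
- by rewrite /s6 /s5 /s4 /s3 /s2 /s1 /start_store; rd.
- by rewrite /s6 /s5 /s4 /s3 /s2 /s1 /start_store; rd.
- by rewrite /kk; elim: (rev bk) => // -[].
have [|s8 [H10 E8]] := exec_output R7 _ A7 L7.
  by rewrite /kk; elim: (rev bk) => // -[].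
exists s8; split; last exact: E8.
have E3' : s3 sErr = [::] by rewrite /s3 /s2 /s1 /start_store; rd.
have E5 : s5 sErr = [::] by rewrite /s5; rd.
apply: exec_le; first apply: exec_seq H1 (exec_seq H2 (exec_guard_ok E2 (exec_seq H3 (exec_guard_ok E3'
  (exec_seq H4 (exec_seq H5 (exec_guard_ok E5 (exec_seq H8 (exec_seq H9 H10))))))))).
have -> : s3 sX = adj by rewrite /s3; rd.
have -> : size (s5 sK) = size bk by rewrite /s5 /s4 /s3; rd; rewrite size_rev.
rewrite /main_time hsq; nia.
Qed.
End MainProgram.

(** * Binary numbers and the time bound *)

Lemma bits_rec m : bits m = if m == 0 then [::] else odd m :: bits m./2.
Proof.
have fuel f : forall f' m, m <= f -> m <= f' -> bits_aux f m = bits_aux f' m.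
  elim: f => [|f IH] [|f'] [|k] //= h1 h2.
  congr cons; apply: IH; rewrite uphalf_half; lia.
case: m => // m; rewrite {1}/bits /=; congr cons.
by apply: fuel; rewrite uphalf_half; lia.
Qed.

Lemma bits_of_bits w : bits (of_bits w) = rev (dropz (rev w)).
Proof.
have of0 u : (dropz (rev u) == [::]) = (of_bits u == 0).
  elim: u => // b u IH; rewrite rev_cons dropz_rcons IH /=.
  have nr (v : seq bool) c : (rcons v c == [::]) = false by case: v.
  case: b => /=; first by rewrite nr; lia.
  by have [->|h] /= := eqVneq (of_bits u) 0; rewrite ?nr ?eqxx; lia.
elim: w => // b w IH.
rewrite rev_cons dropz_rcons bits_rec [of_bits _]/= of0.
have -> : (b + 2 * of_bits w == 0) = ~~ (b || (of_bits w != 0)) by case: b; case: eqP => /=; lia.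
case: (b || _) => //=.
rewrite rev_rcons -IH; congr (_ :: bits _).
  by rewrite oddD oddM /= addbF; case: (b).
by case: b; lia.
Qed.

Lemma of_bits_lt w : of_bits w < 2 ^ size w.
Proof. by elim: w => //= b w IH; rewrite expnS; case: b; lia. Qed.

Lemma of_bitsK m : of_bits (bits m) = m.
Proof.
elim/ltn_ind: m => m IH; rewrite bits_rec; case: eqP => [->|/eqP m0] //=.
by rewrite IH; lia.
Qed.

Lemma size_bits m s : m < 2 ^ s -> size (bits m) <= s.
Proof.
elim: s m => [|s IH] m hm; first by rewrite bits_rec; case: eqP => //; lia.
rewrite bits_rec; case: eqP => //= _; apply: IH; rewrite expnS in hm; lia.
Qed.

Lemma has_bits w : has id w = (of_bits w != 0).
Proof. by elim: w => // b w IH /=; rewrite IH; case: b => //=; lia. Qed.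

Lemma of_bits_cat u v : of_bits (u ++ v) = of_bits u + 2 ^ size u * of_bits v.
Proof. by elim: u => [|b u IH] /=; rewrite ?mul1n // IH expnS; lia. Qed.

Lemma of_bits_nseq n : of_bits (nseq n false) = 0.
Proof. by elim: n => //= n ->. Qed.

Lemma of_bits_inj u v : size u = size v -> of_bits u = of_bits v -> u = v.
Proof.
elim: u v => [|a u IH] [|b v] //= [hs] E.
by rewrite (IH v hs); [congr cons; case: a E; case: b => //=; lia | case: a E; case: b; lia].
Qed.

(** With l the binary length of [m], the exponent is 16 * 4^(l+1), which makes this the 16th power
    of [time_base l]. A power of two that depends on l only can be computed with unary counters. *)
Definition growth (m : nat) : nat := 2 ^ (64 * 4 ^ size (bits m)).

Definition growth_prog :=
  Mv sO sKB ;; Push sJ true ;; grow sJ 4 sKB sD2 ;; Mult sJ sD 64 ;;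
  Emit sJ sD sO [::] [:: false] ;; Push sO true.

Lemma computable_growth : computable growth.
Proof.
exists (machine_of 30 growth_prog) => m.
pose E := 64 * 4 ^ size (bits m).
have [s' [t [H Hs]]] : exists s' t,
   exec (fun _ => [::]) (fun _ => True) growth_prog (start_store (bits m)) s' t /\
   s' 0 = true :: nseq E false.
  eexists; eexists; split.
    rewrite /growth_prog.
    xseq exact: exec_mv.
    xseq exact: exec_push.
    xseq (apply: exec_grow; rd).
    xseq (apply: exec_mult; rd).
    xseq (apply: exec_emit_ticks; rd).
    exact: exec_push.
  rd; have -> : rev (start_store (bits m) 0) ++ start_store (bits m) 15 = bits m.
    by rewrite /start_store; rd; rewrite revK cats0.
  by rewrite cats0.
have -> : bits (growth m) = rev (s' 0).
  rewrite Hs (_ : growth m = of_bits (rev (true :: nseq E false))).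
    by rewrite bits_of_bits revK.
  by rewrite rev_cons rev_nseq -cats1 of_bits_cat of_bits_nseq size_nseq /= muln1.
have H2 := @machine_ok 30 growth_prog _ _ (bits m) s' t isT isT isT H.
by exists (machine_cost 30 * (size (bits m) + size (s' 0) + t).+1 ^ 2).
Qed.

(** * Inclusion-exclusion *)

Fixpoint low_bits (fl : bool) (n : nat) (Y : seq bool) : nat :=
  if n is n'.+1 then (head false Y (+) fl) + 2 * low_bits fl n' (behead Y) else 0.

Lemma addb_value fl c X Y :
  of_bits (addb fl c X Y) + 2 ^ size X * carry fl c X Y = of_bits X + low_bits fl (size X) Y + c.
Proof.
elim: X c Y => [|x X IH] c Y /=; first by rewrite mul1n.
have := IH (1 < (head false Y (+) fl) + x + c) (behead Y); rewrite expnS.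
by case: (head false Y (+) fl); case: x; case: c => /=; lia.
Qed.

Lemma low_bits_mod n Y : exists k, of_bits Y = low_bits false n Y + k * 2 ^ n.
Proof.
elim: n Y => [|n IH] Y; first by exists (of_bits Y); rewrite /= muln1.
have [k E] := IH (behead Y); exists k; rewrite expnS.
by case: Y E => [|b Y] /= E; rewrite ?addbF; lia.
Qed.

(** Two's complement: adding the complemented digits and 1 subtracts modulo [2 ^ n]. *)
Lemma low_bits_compl n Y : low_bits true n Y + low_bits false n Y + 1 = 2 ^ n.
Proof.
elim: n Y => // n IH Y /=; rewrite expnS -(IH (behead Y)).
by case: (head false Y) => /=; lia.
Qed.

Fixpoint mask_bits (j t : nat) : seq bool :=
  if j is j'.+1 then odd t :: mask_bits j' t./2 else [::].

Lemma size_mask_bits j t : size (mask_bits j t) = j.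
Proof. by elim: j t => //= j IH t; rewrite IH. Qed.

Lemma of_mask_bits j t : t < 2 ^ j -> of_bits (mask_bits j t) = t.
Proof.
elim: j t => [|j IH] t; first by case: t.
by rewrite expnS => h; rewrite /= IH; lia.
Qed.

Lemma sum_double N (F : nat -> nat) :
  \sum_(i < 2 * N) F i = \sum_(i < N) (F (2 * i) + F (2 * i).+1).
Proof.
elim: N => [|N IH]; first by rewrite !big_ord0.
by rewrite (_ : 2 * N.+1 = (2 * N).+2) ?mulnS // !big_ord_recr /= IH addnA.
Qed.

Lemma sum_mask_bits j (G : seq bool -> nat) :
  \sum_(t < 2 ^ j.+1) G (mask_bits j.+1 t) =
  \sum_(t < 2 ^ j) (G (false :: mask_bits j t) + G (true :: mask_bits j t)).
Proof.
rewrite expnS (sum_double _ (fun t => G (mask_bits j.+1 t))); apply: eq_bigr => t _ /=.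
rewrite !mul2n /= odd_double doubleK uphalf_double.
by [].
Qed.

Section LoopValue.
Variables (O : seq bool -> seq bool) (q : seq bool -> seq bool) (Q : seq bool -> nat).
Variables (j : nat) (a0 : seq bool).
Hypothesis a0_0 : of_bits a0 = 0.
Hypothesis oracle : forall m, size m = j -> O (q m) = bits (Q m).

Definition parity (m : seq bool) := odd (count id m).

(** The accumulator is the signed sum modulo [2 ^ size a0]. To stay in [nat], the odd masks are
    moved to the other side and multiples of the modulus are allowed on both. *)
Lemma loop_value t : t <= 2 ^ j ->
  let: (m, a) := loop_state O q (nseq j false) a0 t in
  [/\ size m = j, of_bits m = t %% 2 ^ j &
    exists x y, of_bits a + \sum_(i < t) parity (mask_bits j i) * Q (rev (mask_bits j i)) +
      x * 2 ^ size a0 =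
    \sum_(i < t) ~~ parity (mask_bits j i) * Q (rev (mask_bits j i)) + y * 2 ^ size a0].
Proof.
elim: t => [|t IH] ht /=.
  by rewrite size_nseq of_bits_nseq mod0n !big_ord0 a0_0; split=> //; exists 0, 0.
have := IH (ltnW ht); have := size_loop_state O q (nseq j false) a0 t.
case: (loop_state _ _ _ _ _) => m a /= [_ ha] [hm hmt [x [y hE]]].
rewrite /next_mask size_addb; split=> //.
  have := addb_value false true m [::]; rewrite hm hmt (modn_small ht).
  have -> : low_bits false j [::] = 0 by elim: (j) => //= k ->.
  have := of_bits_lt (addb false true m [::]); rewrite size_addb hm.
  (* The mask overflows only in the very last round, where it returns to 0. *)
  case: (carry _ _ _ _) => /= h1 h2.
    have E : t.+1 = 2 ^ j by move: h1 h2 ht; clear; lia.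
    by rewrite E modnn; move: h1 h2 E; clear; lia.
  by rewrite modn_small; move: h1 h2; clear; lia.
have -> : m = mask_bits j t.
  by apply: of_bits_inj; rewrite ?size_mask_bits // of_mask_bits // hmt modn_small.
rewrite !big_ord_recr /= /next_acc -/(parity _).
have hs := oracle (etrans (size_rev _) (size_mask_bits j t)).
set D := \sum_(i < t) _ in hE *; set E := \sum_(i < t) _ in hE *.
set M := mask_bits j t in hs *.
have [k hk] := low_bits_mod (size a) (O (q (rev M))).
rewrite {1}hs of_bitsK ha in hk.
case: (parity M); rewrite /= ?mul1n ?mul0n ?addn0.
  have h1 := addb_value true true a (O (q (rev M))).
  have h2 := low_bits_compl (size a) (O (q (rev M))).
  rewrite ha in h1 h2; move: h1 h2 hk hE; set c := carry _ _ _ _.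
  move: (2 ^ _) (of_bits _) (low_bits _ _ _) (low_bits _ _ _) (Q _) => N v l1 l2 z.
  (* [c] is the carry cut off, [k] collects the high digits of the answer, and 1 is the modulus
     contributed by the complement. *)
  by exists (x + c), (y + 1 + k); lia.
have h1 := addb_value false false a (O (q (rev M))).
rewrite ha in h1; move: h1 hk hE; set c := carry _ _ _ _.
move: (2 ^ _) (of_bits _) (low_bits _ _ _) (Q _) => N v l1 z.
by exists (x + c + k), y; lia.
Qed.
End LoopValue.

Fixpoint below (A m : seq bool) : bool :=
  match A, m with
  | a :: A', b :: m' => (a ==> b) && below A' m'
  | _, _ => true
  end.

(** The alternating sum over the masks containing [A], with negative terms moved across: it is the
    sign of [A] if [A] is everything, else 0. A true head forces a one in the mask and exchanges the
    two sides; a false head leaves that bit free, so the masks cancel in pairs. *)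
Lemma signed_masks (A : seq bool) :
  \sum_(t < 2 ^ size A) ~~ parity (mask_bits (size A) t) * below A (mask_bits (size A) t) +
    (all id A && odd (size A)) =
  \sum_(t < 2 ^ size A) parity (mask_bits (size A) t) * below A (mask_bits (size A) t) +
    (all id A && ~~ odd (size A)).
Proof.
elim: A => [|a A IH]; first by rewrite [size _]/= expn0 !big_ord1.
have hp b m : parity (b :: m) = b (+) parity m by rewrite /parity /= oddD oddb.
rewrite [size _]/= (sum_mask_bits _ (fun m => ~~ parity m * below (a :: A) m))
  (sum_mask_bits _ (fun m => parity m * below (a :: A) m)).
case: a => /=.
  rewrite (eq_bigr (fun t : 'I__ => parity (mask_bits (size A) t) * below A (mask_bits (size A) t)));
    last by move=> t _; rewrite !hp /= muln0 add0n negbK.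
  rewrite [in RHS](eq_bigr (fun t : 'I__ => ~~ parity (mask_bits (size A) t) * below A (mask_bits (size A) t)));
    last by move=> t _; rewrite !hp /= muln0 add0n.
  by rewrite negbK; apply/esym.
rewrite !addn0; apply: eq_bigr => t _; rewrite !hp /= negbK; lia.
Qed.

(** * The query graphs *)

Lemma nth_flatten_uniform (w : nat) (rows : seq (seq bool)) i c :
  all (fun r => size r == w) rows -> c < w ->
  nth false (flatten rows) (i * w + c) = nth false (nth [::] rows i) c.
Proof.
elim: rows i => [|r rows IH] i /=; first by rewrite !nth_nil.
case/andP=> /eqP hr hall hc; rewrite nth_cat hr.
case: i => [|i]; first by rewrite hc.
have -> : (i.+1 * w + c < w) = false by rewrite mulSn; lia.
by rewrite mulSn -addnA addKn IH.
Qed.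

Section ApexGraph.
Variables n j : nat.

Definition apex_graph (e : rel 'I_n) (m : seq bool) : rel 'I_(n + j) := fun u v =>
  match split u, split v with
  | inl a, inl b => e a b
  | inl _, inr b => nth false m b
  | inr a, inl _ => nth false m a
  | inr _, inr _ => false
  end.

Lemma split_l (a : 'I_n) : split (lshift j a) = inl a.
Proof. exact: (unsplitK (inl a)). Qed.
Lemma split_r (b : 'I_j) : split (rshift n b) = inr b.
Proof. exact: (unsplitK (inr b)). Qed.
Definition splitE := (split_l, split_r).

Lemma matrix_rows adj m : vertex_matrix n adj m ++ apex_matrix n m =
  flatten ([seq take n (drop (i * n) adj) ++ m | i <- iota 0 n] ++
           [seq nseq n b ++ nseq (size m) false | b <- m]).
Proof. by rewrite flatten_cat. Qed.

Section Matrix.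
Variables adj m : seq bool.
Hypotheses (adj_size : size adj = n * n) (m_size : size m = j).

Lemma all_row_size : all (fun r => size r == n + j)
  ([seq take n (drop (i * n) adj) ++ m | i <- iota 0 n] ++
           [seq nseq n b ++ nseq (size m) false | b <- m]).
Proof.
rewrite all_cat; apply/andP; split; apply/allP => r /mapP[x hx ->].
  rewrite size_cat m_size size_take size_drop adj_size.
  rewrite mem_iota in hx; apply/eqP; congr (_ + _).
  have : n <= n * n - x * n by rewrite -mulnBl leq_pmull; lia.
  by case: ltnP => //; lia.
by rewrite size_cat !size_nseq m_size.
Qed.

Lemma size_matrix : size (vertex_matrix n adj m ++ apex_matrix n m) = (n + j) * (n + j).
Proof.
rewrite matrix_rows size_flatten.
have := all_row_size; set rows := _ ++ _ => h.
have hs : size rows = n + j by rewrite size_cat !size_map size_iota m_size.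
have -> : shape rows = nseq (n + j) (n + j).
  rewrite -{1}hs -(size_map size rows); apply/all_pred1P.
  by rewrite all_map.
by rewrite sumn_nseq.
Qed.

Lemma adj_rel_matrix : adj_rel (n := n + j) (vertex_matrix n adj m ++ apex_matrix n m) =
  apex_graph (adj_rel adj) m.
Proof.
apply: functional_extensionality => u; apply: functional_extensionality => v.
rewrite /adj_rel matrix_rows nth_flatten_uniform ?all_row_size //.
rewrite nth_cat size_map size_iota /apex_graph.
case: (split_ordP u) => a ->; rewrite /= ?ltn_ord.
  rewrite (nth_map 0) ?size_iota // nth_iota // add0n nth_cat size_take size_drop adj_size.
  have h : n <= n * n - a * n by rewrite -mulnBl leq_pmull; have := ltn_ord a; lia.
  have -> : (if n < n * n - a * n then n else n * n - a * n) = n by case: ltnP => //; lia.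
  case: (split_ordP v) => b -> /=.
    by rewrite nth_take // nth_drop.
  by rewrite addKn.
rewrite addKn (nth_map false) ?m_size //.
rewrite nth_cat size_nseq !nth_nseq.
by case: (split_ordP v) => b Ev /=; rewrite ?if_same.
Qed.

(** The added rows and columns are symmetric with zero diagonal by construction, so a query inherits
    exactly the defects of [adj]. *)
Lemma valid_matrix : valid_graph (n + j) (vertex_matrix n adj m ++ apex_matrix n m) = valid_graph n adj.
Proof.
rewrite /valid_graph size_matrix adj_size !eqxx adj_rel_matrix /=.
apply/forallP/forallP => H.
  move=> a; apply/forallP => b.
  have /forallP/(_ (lshift j b)) := H (lshift j a).
  by rewrite /apex_graph !splitE.
move=> u; apply/forallP => v; rewrite /apex_graph.
case: (split_ordP u) => a _; case: (split_ordP v) => b _; rewrite ?eqxx ?andbT //.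
- by have /forallP/(_ b) := H a.
- by have /forallP/(_ a)/andP[_ ->] := H a.
Qed.
End Matrix.
End ApexGraph.

Lemma dec_sd_sd w r : dec_sd (sd w ++ r) = Some (w, r).
Proof.
by elim: w => // b w IH; rewrite /sd /sd_bits /= -/(sd_bits w) -/(sd w) IH.
Qed.

Lemma dec_query np kb adj m n : dec_inst (query_word np kb adj m n) =
  Some (of_bits np, 4 ^ size kb * of_bits (rev kb), vertex_matrix n adj m ++ apex_matrix n m).
Proof.
rewrite /dec_inst /query_word !dec_sd_sd of_bits_cat of_bits_nseq size_nseq add0n.
by rewrite expnM.
Qed.

(** No overflow occurs: the summands are below [2 ^ size bn] and [2 ^ (4 ^ l)], and the width is the
    sum of these exponents. *)
Lemma of_total_bits bn l : of_bits (total_bits bn l) = of_bits bn + 4 ^ l.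
Proof.
have := addb_value false false (bn ++ nseq (4 ^ l) false) (rcons (nseq (2 * l) false) true).
rewrite -/(total_bits bn l) addn0 of_bits_cat of_bits_nseq muln0 addn0.
set s := size _ => h.
have hl : 2 * l < 4 ^ l by elim: (l) => // k; rewrite expnS; lia.
have [k] := low_bits_mod s (rcons (nseq (2 * l) false) true).
have hY : of_bits (rcons (nseq (2 * l) false) true) = 4 ^ l.
  by rewrite -cats1 of_bits_cat of_bits_nseq size_nseq /= expnM !muln1 add0n.
have hb := of_bits_lt bn.
have hs : 2 ^ s = 2 ^ size bn * 2 ^ (4 ^ l) by rewrite /s size_cat size_nseq expnD.
have h4 : 4 ^ l < 2 ^ (4 ^ l) by exact: ltn_expl.
have b0 : 0 < 2 ^ size bn by rewrite expn_gt0.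
rewrite hY => hk.
have k0 : k = 0 by case: k hk => // k hk; nia.
rewrite k0 mul0n addn0 in hk; rewrite -hk in h.
case: (carry _ _ _ _) h => /= h; last by lia.
nia.
Qed.

Lemma below_rcons A m a b : size A = size m ->
  below (rcons A a) (rcons m b) = below A m && (a ==> b).
Proof.
elim: A m => [|x A IH] [|y m] //=; first by rewrite andbT.
by move=> [h]; rewrite IH // andbA.
Qed.

Lemma below_rev A m : size A = size m -> below (rev A) (rev m) = below A m.
Proof.
elim: A m => [|x A IH] [|y m] //= [h].
by rewrite !rev_cons below_rcons ?size_rev // IH // andbC.
Qed.

Lemma belowP A m : size A = size m ->
  reflect (forall i, i < size A -> nth false A i -> nth false m i) (below A m).
Proof.
elim: A m => [|x A IH] [|y m] //= => [_|[h]]; first by left.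
apply: (iffP andP) => [[/implyP hxy /(IH _ h) H] [|i] //=|H].
  exact: H.
split; first by apply/implyP; exact: (H 0 isT).
by apply/(IH _ h) => i; exact: (H i.+1).
Qed.

(** Applied with [x] = e(S) and [c] = |S|. If [c > k], the term [j * c] alone exceeds [j * k]; if
    [c < k], then [x >= j > k ^ 2], too much for [c] vertices. *)
Lemma weight_unique x c j k : k ^ 2 < j -> x + j * c = j * k -> x <= c ^ 2 -> c = k.
Proof.
move=> hk hE hx; have [h|h|//] := ltngtP c k.
  have h1 : c ^ 2 <= k ^ 2 by rewrite leq_exp2r // ltnW.
  have : j * c.+1 <= j * k by rewrite leq_mul2l h orbT.
  rewrite mulnS; move: h1 hk hE hx; move: (c ^ 2) (k ^ 2) (j * c) (j * k); lia.
have : j * k.+1 <= j * c by rewrite leq_mul2l h orbT.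
rewrite mulnS; move: hk hE; move: (k ^ 2) (j * c) (j * k); lia.
Qed.

(** * The vertex sets that survive inclusion-exclusion *)

Section Counting.
Variables (n j : nat) (e : rel 'I_n).
Hypotheses (e_sym : symmetric e) (e_irr : irreflexive e).
Notation full := (apex_graph (j := j) e (nseq j true)).

Definition good_sets (K : nat) : {set {set 'I_(n + j)}} :=
  [set S | [&& S != set0, induced_edges full S == K & no_isolated full S]].

Definition apexes (S : {set 'I_(n + j)}) : seq bool := [seq rshift n i \in S | i <- enum 'I_j].

Lemma size_apexes S : size (apexes S) = j.
Proof. by rewrite size_map size_enum_ord. Qed.

Lemma nth_apexes S (i : 'I_j) : nth false (apexes S) i = (rshift n i \in S).
Proof. by rewrite (nth_map i) ?size_enum_ord // nth_ord_enum. Qed.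

Lemma apex_graph_full m (S : {set 'I_(n + j)}) : size m = j -> below (apexes S) m ->
  {in S &, apex_graph e m =2 full}.
Proof.
move=> hm /belowP; rewrite size_apexes hm => /(_ erefl) H u v.
case: (split_ordP u) => a ->; case: (split_ordP v) => b ->; rewrite /apex_graph !splitE // => hu hv.
  by rewrite nth_nseq ltn_ord H // nth_apexes.
by rewrite nth_nseq ltn_ord H // nth_apexes.
Qed.

Lemma no_isolated_below m S : size m = j -> no_isolated (apex_graph e m) S -> below (apexes S) m.
Proof.
move=> hm /forall_inP H; apply/belowP; rewrite size_apexes ?hm // => i hi.
rewrite (nth_apexes S (Ordinal hi)) => /H /exists_inP[v hv].
by rewrite /apex_graph splitE; case: (split _).
Qed.

Lemma eq_induced (r r' : rel 'I_(n + j)) (S : {set 'I_(n + j)}) : {in S &, r =2 r'} ->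
  induced_edges r S = induced_edges r' S /\ no_isolated r S = no_isolated r' S.
Proof.
move=> E; split.
  apply: eq_card => p; rewrite !inE.
  by case: (boolP (p.1 \in S)) => //= h1; case: (boolP (p.2 \in S)) => //= h2; rewrite E.
apply: eq_forallb_in => u hu; apply: eq_existsb_in => v hv; exact: E.
Qed.

(** This compares all masks within one graph: a new vertex outside the mask is isolated, so a set
    without isolated vertices lies below the mask, and on such a set the masked graph agrees with
    [full]. *)
Lemma count_masked m K : size m = j ->
  count_edge_induced_star (apex_graph (j := j) e m) K = \sum_(S in good_sets K) below (apexes S) m.
Proof.
move=> hm; rewrite /count_edge_induced_star -sum1_card big_mkcond [RHS]big_mkcond /=.
apply: eq_bigr => S _; rewrite !inE.
case hb: (below (apexes S) m).
  have [-> ->] := eq_induced (apex_graph_full hm hb).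
  by case: ifP.
rewrite if_same; case: ifP => // /and3P[_ _ /(no_isolated_below hm)].
by rewrite hb.
Qed.

(** Interchanging the sums leaves, for each [S], the alternating sum of [signed_masks]: 1 if [S]
    contains all new vertices ([j] is even), and 0 otherwise. *)
Lemma signed_count K : ~~ odd j ->
  let Q m := count_edge_induced_star (apex_graph (j := j) e m) K in
  \sum_(t < 2 ^ j) ~~ parity (mask_bits j t) * Q (rev (mask_bits j t)) =
  \sum_(t < 2 ^ j) parity (mask_bits j t) * Q (rev (mask_bits j t)) +
  #|[set S in good_sets K | all id (apexes S)]|.
Proof.
move=> hj Q.
have hQ (F : seq bool -> nat) : \sum_(t < 2 ^ j) F (mask_bits j t) * Q (rev (mask_bits j t)) =
    \sum_(S in good_sets K) \sum_(t < 2 ^ j) F (mask_bits j t) * below (rev (apexes S)) (mask_bits j t).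
  rewrite exchange_big /=; apply: eq_bigr => t _.
  rewrite /Q count_masked ?size_rev ?size_mask_bits // big_distrr /=; apply: eq_bigr => S _.
  congr (_ * nat_of_bool _).
  by rewrite -[in RHS](revK (mask_bits j t)) below_rev // size_apexes size_rev size_mask_bits.
rewrite (hQ (fun m => ~~ parity m)) (hQ (fun m => parity m)) -sum1_card.
have -> : \sum_(S in [set S in good_sets K | all id (apexes S)]) 1 =
    \sum_(S in good_sets K) all id (apexes S).
  rewrite big_mkcond [RHS]big_mkcond; apply: eq_bigr => S _ /=.
  by rewrite inE; case: (S \in _); case: (all _ _).
rewrite -big_split /=; apply: eq_bigr => S hS.
have := signed_masks (rev (apexes S)).
by rewrite size_rev size_apexes all_rev (negbTE hj) andbF andbT addn0 => ->.
Qed.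

Definition with_apexes (S : {set 'I_n}) : {set 'I_(n + j)} :=
  [set u | if split u is inl a then a \in S else true].

Lemma with_apexes_inj : injective with_apexes.
Proof.
move=> S S' /setP E; apply/setP => a.
by have := E (lshift j a); rewrite !inE splitE.
Qed.

(** Edges are counted as pairs of increasing rank, and new vertices rank after all old ones. So each
    new edge occurs once, as (old, new), which gives a bijection with a disjoint sum. *)
Lemma induced_edges_with_apexes S :
  induced_edges full (with_apexes S) = induced_edges e S + j * #|S|.
Proof.
rewrite /induced_edges.
pose f (x : 'I_n * 'I_n + 'I_n * 'I_j) : 'I_(n + j) * 'I_(n + j) :=
  match x with inl p => (lshift j p.1, lshift j p.2) | inr p => (lshift j p.1, rshift n p.2) end.
have f_inj : injective f.
  move=> [[a b]|[a b]] [[c d]|[c d]] //= [].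
  - by move=> /val_inj -> /val_inj ->.
  - by move=> _ E; have := ltn_ord b; lia.
  - by move=> _ E; have := ltn_ord d; lia.
  - by move=> /val_inj -> /addnI /val_inj ->.
pose A := [set p : 'I_n * 'I_n | [&& p.1 \in S, p.2 \in S, enum_rank p.1 < enum_rank p.2 & e p.1 p.2]].
pose B := [set p : 'I_n * 'I_j | p.1 \in S].
have -> : j * #|S| = #|B|.
  have -> : B = setX S [set: 'I_j] by apply/setP => p; rewrite !inE andbT.
  by rewrite cardsX cardsT card_ord mulnC.
pose C := [set x : 'I_n * 'I_n + 'I_n * 'I_j | match x with inl p => p \in A | inr p => p \in B end].
have -> : #|A| + #|B| = #|C|.
  rewrite -!sum1_card big_mkcond [X in _ + X = _]big_mkcond [RHS]big_mkcond /= big_sumType /=.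
  by congr (_ + _); apply: eq_bigr => p _; rewrite !inE.
rewrite -(card_imset (mem C) f_inj); apply: eq_card => -[u v]; rewrite !inE /=.
rewrite !enum_rank_ord /=.
apply/and4P/imsetP.
  move=> [].
  case: (split_ordP u) => a -> ; case: (split_ordP v) => b ->; rewrite /apex_graph ?splitE //= => hu hv hlt huv.
  - exists (inl (a, b)) => //; rewrite !inE /= !enum_rank_ord /=; apply/and4P; split=> //.
  - by exists (inr (a, b)) => //; rewrite !inE.
  - by have := ltn_ord b; lia.
move=> [[[a b]|[a b]]]; rewrite !inE /= => H [-> ->]; rewrite /apex_graph !splitE /=.
  by move: H; rewrite !enum_rank_ord /= => /and4P[].
by split=> //; [have := ltn_ord a; lia | rewrite nth_nseq ltn_ord].
Qed.

Lemma induced_edges_le S : induced_edges e S <= #|S| ^ 2.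
Proof.
rewrite expnS expn1 -cardsX; apply: subset_leq_card; apply/subsetP => p.
by rewrite !inE => /and4P[-> ->].
Qed.

Lemma independentE S : independent e S = (induced_edges e S == 0).
Proof.
rewrite cards_eq0; apply/forall_inP/eqP => H.
  apply/setP => -[u v]; rewrite !inE /=; apply/negbTE; apply/and4P => -[hu hv _ huv].
  by have /forall_inP/(_ v hv) := H u hu; rewrite huv.
move=> u hu; apply/forall_inP => v hv; apply/negP => huv.
have [E|E|E] := ltngtP (enum_rank u) (enum_rank v).
- by have := in_set0 (u, v); rewrite -H !inE /= hu hv E huv.
- by have := in_set0 (v, u); rewrite -H !inE /= hu hv E e_sym huv.
- by move/val_inj/enum_rank_inj: E huv => ->; rewrite e_irr.
Qed.

(** No vertex is isolated once all new ones are present: [S] is nonempty as [k > 0], so each new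
    vertex has a neighbour in it, and [j > 0] provides a neighbour for each vertex of [S]. *)
Lemma count_full_apexes k : 0 < k -> k ^ 2 < j ->
  #|[set S in good_sets (j * k) | all id (apexes S)]| = count_indep e k.
Proof.
move=> k0 hk; have j0 : 0 < j by lia.
rewrite /count_indep -(card_imset _ with_apexes_inj); apply: eq_card => T; rewrite !inE.
apply/andP/imsetP.
  move=> [/and3P[hT0 /eqP hE hI] hall].
  have hT : T = with_apexes [set a | lshift j a \in T].
    apply/setP => u; rewrite !inE; case: (split_ordP u) => a ->; rewrite ?inE //.
    move/allP: hall => /(_ (rshift n a \in T)) /=.
    rewrite /apexes => -> //; by apply/mapP; exists a; rewrite ?mem_enum.
  exists [set a | lshift j a \in T]; last exact: hT.
  set S := [set a | _] in hT *; rewrite inE.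
  rewrite hT induced_edges_with_apexes in hE.
  have hle := induced_edges_le S.
  have hSk : #|S| = k.
    exact: (weight_unique hk hE (induced_edges_le _)).
  rewrite hSk eqxx independentE /=; rewrite hSk in hE; apply/eqP; lia.
move=> [S]; rewrite inE => /andP[/eqP hS hind] ->.
have /set0Pn[a ha] : S != set0 by rewrite -card_gt0 hS.
split.
  apply/and3P; split.
  - by apply/set0Pn; exists (lshift j a); rewrite inE splitE.
  - by rewrite induced_edges_with_apexes; move: hind; rewrite independentE hS => /eqP ->.
  apply/forall_inP => u; rewrite inE; case: (split_ordP u) => b -> hb; apply/exists_inP.
    by exists (rshift n (Ordinal j0)); rewrite ?inE /apex_graph !splitE // nth_nseq j0.
  by exists (lshift j a); rewrite ?inE /apex_graph ?splitE // nth_nseq ltn_ord.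
by apply/allP => x /mapP[i _ ->]; rewrite inE splitE.
Qed.
End Counting.

Definition star_oracle (w : seq bool) : seq bool := bits (p_count_EIS_star w).

(** * The reduction *)

Lemma valid_graph_sym n adj : valid_graph n adj ->
  symmetric (adj_rel (n := n) adj) /\ irreflexive (adj_rel (n := n) adj).
Proof.
move=> /andP[_ /forallP H]; split=> [a b|a].
  by have /forallP/(_ b)/andP[/eqP] := H a.
by have /forallP/(_ a)/andP[_ /negbTE] := H a.
Qed.

Section Query.
Variables (n : nat) (bn adj : seq bool).
Hypothesis adj_size : size adj = n * n.
Notation ok := ((of_bits bn == n) && valid_graph n adj).
Notation query_of := (phase_query n bn adj).
Notation result_of := (phase_result star_oracle n bn adj).

(** A wrong declared number of vertices stays wrong in the query: declared and true number are both
    increased by j, and the length of the matrix determines [n + j]. *)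
Lemma valid_query (kb m : seq bool) : size m = 4 ^ size kb ->
  valid_graph (of_bits bn + 4 ^ size kb) (vertex_matrix n adj m ++ apex_matrix n m) = ok.
Proof.
move=> hm; case: eqP => [->|ne] /=; first exact: valid_matrix.
apply/negbTE/negP => /andP[/eqP]; rewrite (size_matrix adj_size hm) => E _.
have /eqP : (n + 4 ^ size kb) ^ 2 = (of_bits bn + 4 ^ size kb) ^ 2 by rewrite -!mulnn.
by rewrite eqn_sqr eqn_add2r => /eqP /esym.
Qed.

Lemma query_value (kb m : seq bool) : size m = 4 ^ size kb -> p_count_EIS_star (query_of kb m) =
  if ok then count_edge_induced_star (apex_graph (j := 4 ^ size kb) (adj_rel (n := n) adj) m)
               (4 ^ size kb * of_bits (rev kb)) else 0.
Proof.
move=> hm; rewrite /p_count_EIS_star /graph_problem /phase_query dec_query of_total_bits.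
rewrite valid_query //; case: eqP => //= E; case: ifP => // _.
by rewrite -(adj_rel_matrix adj_size hm) E.
Qed.

Lemma query_param (kb m : seq bool) : size m = 4 ^ size kb -> graph_param (query_of kb m) =
  if ok then 4 ^ size kb * of_bits (rev kb) else 0.
Proof.
move=> hm; rewrite /graph_param /phase_query dec_query of_total_bits valid_query //.
Qed.

Lemma size_answer (kb m : seq bool) : size m = 4 ^ size kb ->
  size (star_oracle (query_of kb m)) <= n + 4 ^ size kb + 1.
Proof.
move=> hm; apply: size_bits; rewrite query_value //; case: ifP => _; last by rewrite expn_gt0.
rewrite expnD muln2 -addnn; apply: (@leq_ltn_trans (2 ^ (n + 4 ^ size kb))).
  rewrite -[X in 2 ^ X]card_ord -cardsT -card_powerset; apply: subset_leq_card.
  by apply/subsetP => S _; rewrite powersetE subsetT.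
by rewrite -addn1 leq_add2l expn_gt0.
Qed.

Lemma size_phase_result O kb : size (phase_result O n bn adj kb) = n.+1.
Proof. by have [_] := size_loop_state O (query_of kb) (nseq (4 ^ size kb) false) (nseq n.+1 false) (2 ^ (4 ^ size kb)) => ->; rewrite size_nseq. Qed.

(** Serves both phases; [kb] lists the target from its highest bit. For a malformed instance every
    answer is 0, and so is the signed sum. *)
Lemma phase_value kb : kb != [::] -> 0 < of_bits (rev kb) ->
  of_bits (result_of kb) =
  if ok then count_indep (adj_rel (n := n) adj) (of_bits (rev kb)) else 0.
Proof.
move=> hkb hk.
set j := 4 ^ size kb; set k := of_bits (rev kb).
set R := (RHS).
pose Q m := if ok then count_edge_induced_star (apex_graph (j := j) (adj_rel (n := n) adj) m)
               (j * k) else 0.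
have hO m : size m = j -> star_oracle (query_of kb m) = bits (Q m).
  by move=> hm; rewrite /star_oracle query_value.
have h0 : of_bits (nseq n.+1 false) = 0 by rewrite of_bits_nseq.
have := loop_value h0 hO (leqnn (2 ^ j)).
have := size_phase_result star_oracle kb; rewrite /phase_result -/j.
case: (loop_state _ _ _ _ _) => M a /= ha [_ _ [x [y]]].
have jo : ~~ odd j by rewrite /j oddX /= orbF; case: (kb) hkb.
(* This is the reason for the base 4: [k < 2 ^ size kb] gives [k ^ 2 < 4 ^ size kb]. *)
have kj : k ^ 2 < j.
  rewrite /j -[4]/(2 ^ 2) -expnM mulnC expnM ltn_exp2r // /k -(size_rev kb).
  exact: of_bits_lt.
have -> : \sum_(i < 2 ^ j) ~~ parity (mask_bits j i) * Q (rev (mask_bits j i)) =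
    \sum_(i < 2 ^ j) parity (mask_bits j i) * Q (rev (mask_bits j i)) + R.
  rewrite /R /Q; case: ifP => [/andP[_ hv]|_].
    have [hsym hirr] := valid_graph_sym hv.
    by rewrite signed_count // count_full_apexes.
  by rewrite addn0; apply: eq_bigr => i _; rewrite !muln0.
(* The sums over odd masks cancel; the accumulator and [R] then agree modulo [2 ^ n.+1], and both
   are smaller than that. *)
rewrite size_nseq -!addnA addnCA => /addnI E.
have hR : R < 2 ^ n.+1.
  rewrite /R; case: ifP => _; last by rewrite expn_gt0.
  rewrite expnS mul2n -addnn; apply: (@leq_ltn_trans (2 ^ n)).
    rewrite -[X in 2 ^ X](card_ord n) -cardsT -card_powerset; apply: subset_leq_card.
    by apply/subsetP => S _; rewrite powersetE subsetT.
  by rewrite -addn1 leq_add2l expn_gt0.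
have hA : of_bits a < 2 ^ n.+1 by rewrite -ha; exact: of_bits_lt.
have := congr1 (fun z => z %% 2 ^ n.+1) E; by rewrite ![_ + _ * _]addnC !modnMDl !modn_small.
Qed.
End Query.

Lemma count_indep0 n (e : rel 'I_n) : count_indep e 0 = 1.
Proof.
rewrite /count_indep (_ : [set S | _] = [set set0]) ?cards1 //.
apply/setP => S; rewrite !inE cards_eq0; case: eqP => //= ->.
by apply/forall_inP => u; rewrite inE.
Qed.

Lemma count_indep1_gt0 n (e : rel 'I_n) : irreflexive e -> 0 < n -> 0 < count_indep e 1.
Proof.
move=> he n0; apply/card_gt0P; exists [set Ordinal n0]; rewrite inE cards1 eqxx /=.
by apply/forall_inP => u /set1P ->; apply/forall_inP => v /set1P ->; rewrite he.
Qed.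

Lemma count_indep_empty (e : rel 'I_0) k : 0 < k -> count_indep e k = 0.
Proof.
move=> k0; apply: eq_card0 => S; rewrite inE.
have -> : #|S| = 0 by apply/eqP; rewrite -leqn0; apply: leq_trans (max_card _) _; rewrite card_ord.
by case: k k0.
Qed.

(** For [n > 0] the first phase yields [n] or 0, so it decides well-formedness. For [n = 0] it
    always yields 0, but then only the declared vertex number can be wrong. *)
Lemma final_word_value x bn r bk adj n (kk := dropz (rev bk)) :
  dec_sd x = Some (bn, r) -> dec_sd r = Some (bk, adj) -> size adj = n * n ->
  rev (final_word star_oracle n bn adj kk) = bits (p_count_IS x).
Proof.
move=> E1 E2 hs.
rewrite /p_count_IS /graph_problem /dec_inst E1 E2.
have hv : valid_graph (of_bits bn) adj = (of_bits bn == n) && valid_graph n adj.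
  case: eqP => [->|ne] //; apply/negbTE/negP => /andP[/eqP]; rewrite hs => E _.
  have /eqP : n ^ 2 = of_bits bn ^ 2 by rewrite -!mulnn.
  by rewrite eqn_sqr => /eqP /esym.
have hkk : of_bits (rev kk) = of_bits bk by rewrite -[in RHS](of_bitsK (of_bits bk)) bits_of_bits.
have hk0 : (kk == [::]) = (of_bits bk == 0).
  by rewrite -(inj_eq (can_inj revK)) /kk -bits_of_bits bits_rec; case: (_ == 0).
have -> : (if valid_graph (of_bits bn) adj then count_indep (adj_rel (n := of_bits bn) adj) (of_bits bk) else 0)
   = if (of_bits bn == n) && valid_graph n adj then count_indep (adj_rel (n := n) adj) (of_bits bk) else 0.
  by rewrite hv; case: eqP => //= ->.
have r1 := phase_value bn hs (kb := [:: true]) isT isT; rewrite [of_bits (rev [:: true])]/= in r1.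
have bitsb (b : bool) : bits b = nseq b true by case: b.
have revb (b : bool) : rev (nseq b true) = nseq b true by case: b.
rewrite /final_word hk0; case: eqP => [k0|/eqP k0].
  rewrite k0 count_indep0; set ok := (of_bits bn == n) && _ in r1 *.
  have -> : (if ok then 1 else 0) = (ok : nat) by case: (ok).
  rewrite bitsb; case: eqP => [n0|/eqP n0].
    rewrite revb has_bits negbK /ok n0; congr (nseq (nat_of_bool _) _).
    rewrite n0 in hs; rewrite /valid_graph hs eqxx /=.
    by case: eqP => //= _; symmetry; apply/forallP => -[].
  rewrite revb has_bits r1; congr (nseq (nat_of_bool _) _).
  case hok: (ok) => //; have [_ hirr] := valid_graph_sym (proj2 (andP hok)).
  by rewrite -lt0n count_indep1_gt0 // lt0n.
have kk0 : kk != [::] by rewrite hk0.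
have rk : 0 < of_bits (rev kk) by rewrite hkk lt0n.
have vk := phase_value bn hs kk0 rk; rewrite hkk in vk.
rewrite -bits_of_bits; congr bits; rewrite has_bits r1.
case: (boolP (_ && _)) vk r1 => [hok|_] vk r1; last by rewrite r1.
have [_ hirr] := valid_graph_sym (proj2 (andP hok)).
case: eqP => [h1|//]; rewrite r1 h1.
have n0 : n = 0.
  by apply/eqP; rewrite -leqn0 leqNgt; apply/negP => /(count_indep1_gt0 hirr); rewrite h1.
by clear -n0 k0; subst n; rewrite count_indep_empty // lt0n.
Qed.

(** * Bounds on the running time *)

Definition time_base (l : nat) := 2 ^ (4 ^ l.+1).

(** [J] dominates [l], [4 ^ l] and [2 ^ (4 ^ l)] at once, so a single monomial bounds every term.
    The condition [l <= L.+1] admits the first phase, where [l] is 1, even if [L] is 0. *)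
Lemma phase_time_le n (bn kk : seq bool) m R l L X :
  n <= X -> size bn <= X -> size kk <= X -> l <= L.+1 -> 0 < X ->
  let J := time_base L in
  m <= 6 * X -> R <= X + J + 6 -> phase_time n bn kk m R l <= 1000 * (X ^ 2 * J ^ 3).
Proof.
move=> hn hb hkk hl hX J hm hR; rewrite /phase_time; lazy zeta.
set j := 4 ^ l; set I := 2 ^ j; set b := size bn in hb *; set q := size kk in hkk *.
have jJ0 : j <= 4 ^ L.+1 by rewrite leq_exp2l.
have IJ : I <= J by rewrite leq_exp2l.
have jJ : j <= J by apply: leq_trans IJ; rewrite ltnW // ltn_expl.
have lJ : l <= J by apply: leq_trans jJ; rewrite ltnW // ltn_expl.
have J0 : 0 < J by rewrite expn_gt0.
move: (J) J0 jJ lJ IJ hR => {}J J0 jJ lJ IJ hR.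
have -> : X ^ 2 * J ^ 3 = X * X * J * J * J by rewrite !expnS !expn0; lia.
have h1 : X <= X * X by rewrite leq_pmulr.
have m1 a c : a <= c -> a <= c * J by move=> h; apply: leq_trans h _; rewrite leq_pmulr.
have XXJ : X * X <= X * X * J by exact: m1.
have XXJJ : X * X * J <= X * X * J * J by exact: m1.
have XXJJJ : X * X * J * J <= X * X * J * J * J by exact: m1.
have J1 : J <= X * X * J by rewrite leq_pmull // muln_gt0 hX.
have J2 : J * J <= X * X * J * J by rewrite leq_mul2r J1 orbT.
have XJ : X * J <= X * X * J by rewrite leq_mul2r h1 orbT.
have XJJ : X * J * J <= X * X * J * J by rewrite leq_mul2r XJ orbT.
have one : 0 < X * X by rewrite muln_gt0 hX.
have t1 : 26 * j * l <= 26 * (J * J) by rewrite -mulnA leq_mul2l leq_mul.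
have t2 : 18 * I * j <= 18 * (J * J) by rewrite -mulnA leq_mul2l leq_mul.
have t3 : (11 * (n + j) + 20) * j <= (42 * (X * J)) * J.
  apply: leq_mul => //; apply: (@leq_trans (11 * (X + J) + 20)); first by lia.
  have : X <= X * J by rewrite leq_pmulr.
  have : J <= X * J by rewrite leq_pmull.
  lia.
have t4 : (12 * j + 20 * n + 20) * n <= (52 * (X * J)) * X.
  apply: leq_mul => //; apply: (@leq_trans (12 * J + 20 * X + 20)); first by lia.
  have : X <= X * J by rewrite leq_pmulr.
  have : J <= X * J by rewrite leq_pmull.
  lia.
have t4' : X * J * X = X * X * J by rewrite mulnAC.
have t5 : (((11 * (n + j) + 20) * j + (12 * j + 20 * n + 20) * n + 40 * l + 30 * (b + j) +
      20 * n.+1 + 20 * j + 3 * R + 100) * I) <= 400 * (X * X * J * J) * J.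
  apply: leq_mul => //; rewrite -mulnA in t3; rewrite -mulnA t4' in t4; lia.
set W := X * X * J * J * J in XXJJJ *.
have e5 : 400 * (X * X * J * J) * J = 400 * W by rewrite -mulnA.
have XW : X <= W by lia.
have JW : J <= W by lia.
have J2W : J * J <= W by lia.
have W0 : 0 < W by lia.
rewrite e5 in t5; move: t1 t2 t5 J2W; clear XXJJJ e5.
move: (_ * I) (26 * j * l) (18 * I * j) (J * J) => A5 A1 A2 JJ t1 t2 t5 J2W.
move: W XW JW J2W W0 t5 => W *; lia.
Qed.

Lemma main_time_le n (bn adj kk x : seq bool) L :
  (if has id (phase_result star_oracle n bn adj [:: true]) && (kk != [::]) then size kk else 0) <= L ->
  n <= size x -> size bn <= size x -> size kk <= size x ->
  size x + n.+2 + main_time star_oracle n bn adj kk x <=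
    3000 * ((size x).+1 ^ 2 * time_base L ^ 3).
Proof.
move=> hL hn hb hk; rewrite /main_time /phases_time.
set X := (size x).+1; set J := time_base L; set W := X ^ 2 * J ^ 3.
have J0 : 4 <= J.
  by rewrite /J /time_base; apply: (@leq_trans (2 ^ 4)) => //; rewrite leq_exp2l // -{1}[4]expn1 leq_exp2l.
have XW : X ^ 2 <= W by rewrite leq_pmulr // expn_gt0; lia.
have JW : J <= W.
  by rewrite -{1}[J]expn1 -{1}[J ^ 1]mul1n leq_mul // ?expn_gt0 // leq_exp2l //; lia.
have XX : X <= X ^ 2 by rewrite expnS expn1 leq_pmulr.
have W0 : 0 < W by rewrite (leq_trans _ XW) // expn_gt0.
have p1 : phase_time n bn kk 0 (n + 6) 1 <= 1000 * W.
  by apply: phase_time_le; rewrite -/J /X //; lia.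
pose c := has id (phase_result star_oracle n bn adj [:: true]) && (kk != [::]).
have p2 : (if c then phase_time n bn kk (n.+1 + size bn + 4) (n + 4 ^ size kk + 2) (size kk) else 0)
     <= 1000 * W /\ (if c then 4 ^ size kk else 0) <= J.
  move: hL; rewrite -/c; case: c => // hL.
  have h4 : 4 ^ size kk <= J.
    apply: (@leq_trans (4 ^ L.+1)); first by rewrite leq_exp2l // ltnW.
    by rewrite /J /time_base ltnW // ltn_expl.
  by split=> //; apply: phase_time_le; rewrite -/J /X //; lia.
case: p2; rewrite /c; case: ifP => _ p2 p3.
  have : 300 * X ^ 2 <= 300 * W by rewrite leq_mul2l XW orbT.
  move: p1 p2 p3; set A1 := phase_time _ _ _ 0 _ _; set A2 := phase_time _ _ _ (_ + _) _ _.
  clearbody W A1 A2; clearbody J; move: XW XX JW W0; rewrite /X; lia.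
have : 300 * X ^ 2 <= 300 * W by rewrite leq_mul2l XW orbT.
move: p1; set A1 := phase_time _ _ _ 0 _ _.
clearbody W A1; clearbody J; move: XW XX JW W0; rewrite /X; lia.
Qed.

(** Powers of [J] absorb the constants: 230 <= 16^2 and 3000 <= 16^3. Squaring [X ^ 2 * J ^ 6] then
    gives [X ^ 4 * J ^ 14] in all, which the 16th power in [growth] and the exponent 4 of the input
    size accommodate. *)
Lemma machine_time_le V X J : 16 <= J -> V <= 3000 * (X ^ 2 * J ^ 3) ->
  machine_cost 30 * V ^ 2 <= J ^ 16 * X ^ 4.
Proof.
move=> hJ hV.
have J0 : 0 < J by lia.
have h1 : machine_cost 30 <= J ^ 2.
  by apply: (@leq_trans (16 ^ 2)); [rewrite /machine_cost /step_cost | rewrite leq_exp2r].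
have h2 : 3000 <= J ^ 3.
  by apply: (@leq_trans (16 ^ 3)); [ | rewrite leq_exp2r].
have h3 : V <= X ^ 2 * J ^ 6.
  apply: leq_trans hV _; rewrite mulnCA leq_mul2l -[6]/(3 + 3) expnD.
  by rewrite leq_mul2r h2 !orbT.
have h4 : V ^ 2 <= X ^ 4 * J ^ 12.
  by rewrite -[4]/(2 * 2) -[12]/(6 * 2) !expnM -expnMn leq_exp2r.
apply: leq_trans (leq_mul h1 h4) _.
rewrite mulnCA mulnC -expnD leq_mul2r leq_exp2l ?orbT //; lia.
Qed.

Theorem theorem6p2 :
  fpt_turing_reduction p_count_IS graph_param p_count_EIS_star graph_param.
Proof.
exists (machine_of 30 main_prog), growth, growth, 4.
split; first exact: computable_growth.
split; first exact: computable_growth.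
move=> x; have /andP[wf1 wf2] := main_prog_wf.
pose P y := graph_param y <= growth (graph_param x).
have growthE : growth (graph_param x) = time_base (size (bits (graph_param x))) ^ 16.
  rewrite /growth /time_base -expnM; congr (2 ^ _); rewrite expnS; lia.
have base16 l : 16 <= time_base l.
  by rewrite /time_base; apply: (@leq_trans (2 ^ 4)) => //; rewrite leq_exp2l // -{1}[4]expn1 leq_exp2l.
have finish s' t : exec star_oracle P main_prog (start_store x) s' t ->
   rev (s' 0) = bits (p_count_IS x) ->
   (size x + size (s' 0) + t).+1 <= 3000 * ((size x).+1 ^ 2 * time_base (size (bits (graph_param x))) ^ 3) ->
   runs_within (machine_of 30 main_prog) star_oracle x
     (growth (graph_param x) * (size x).+1 ^ 4) (bits (p_count_IS x)) P.
  move=> H E ht; rewrite -E; apply: (runs_within_le _ _ (@machine_ok 30 _ _ _ _ _ _ isT wf2 wf1 H)) => //.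
  by rewrite growthE; apply: machine_time_le.
have fail : p_count_IS x = 0 ->
  (match dec_sd x with
   | Some (_, r) => if dec_sd r is Some (_, adj) then forall w, size adj <> w * w else True
   | None => True end) ->
   runs_within (machine_of 30 main_prog) star_oracle x
     (growth (graph_param x) * (size x).+1 ^ 4) (bits (p_count_IS x)) P.
  move=> h0 hx; have [s' [H E]] := exec_main_fail star_oracle P hx.
  apply: finish H _ _; rewrite E ?h0 //=.
  set J := time_base _ ^ 3; have J0 : 0 < J by rewrite !expn_gt0.
  have : (size x).+1 ^ 2 <= (size x).+1 ^ 2 * J by rewrite leq_pmulr.
  have : (size x).+1 <= (size x).+1 ^ 2 by rewrite expnS expn1 leq_pmulr.
  lia.
case E1: (dec_sd x) => [[bn r]|]; last first.
  by apply: fail; rewrite /p_count_IS /graph_problem /dec_inst E1.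
case E2: (dec_sd r) => [[bk adj]|]; last first.
  by apply: fail; rewrite /p_count_IS /graph_problem /dec_inst E1 ?E2.
have [/existsP[n /eqP hs]|hns] := boolP [exists n : 'I_(size adj).+1, size adj == n * n]; last first.
  have hw w : size adj <> w * w.
    move=> E; move/existsP: hns; case.
    have hw : w < (size adj).+1 by rewrite ltnS E; case: (w) => // k; rewrite leq_pmulr.
    by exists (Ordinal hw); rewrite -E.
  apply: fail; rewrite /p_count_IS /graph_problem /dec_inst E1 E2 //.
  by rewrite /valid_graph; case: eqP => // /hw.
move: (nat_of_ord n) hs => {}n hs.
pose kk := dropz (rev bk).
have hkk : bits (of_bits bk) = rev kk by rewrite bits_of_bits.
pose ok := (of_bits bn == n) && valid_graph n adj.
have hparam : graph_param x = if ok then of_bits bk else 0.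
  rewrite /graph_param /dec_inst E1 E2 /ok; case: eqP => [->|ne] //=.
  case: ifP => // /andP[/eqP]; rewrite hs => E _; case: ne.
  have /eqP : n ^ 2 = of_bits bn ^ 2 by rewrite -!mulnn.
  by rewrite eqn_sqr => /eqP.
have v1 := phase_value bn hs (kb := [:: true]) isT isT; rewrite -/ok in v1.
(* The purpose of the first phase: its success certifies the instance, so k is the parameter and may
   enter the bounds. *)
have alive : has id (phase_result star_oracle n bn adj [:: true]) -> ok.
  by rewrite has_bits v1; case: (ok).
have q1 m : size m = 4 -> P (phase_query n bn adj [:: true] m) /\ size (star_oracle (phase_query n bn adj [:: true] m)) <= n + 6.
  move=> hm; split; last by apply: leq_trans (@size_answer n bn adj hs [:: true] m hm) _; rewrite expn1; lia.
  rewrite /P (query_param bn hs (kb := [:: true])) // growthE.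
  (* The first phase asks for 4 * 1 edges even if the parameter is 0, which [growth] allows. *)
  apply: (@leq_trans 4); first by case: ifP.
  apply: leq_trans (_ : time_base (size (bits (graph_param x))) ^ 1 <= _).
    by rewrite expn1; apply: leq_trans (base16 _).
  by rewrite leq_exp2l //; apply: leq_trans (base16 _).
have q2 : has id (phase_result star_oracle n bn adj [:: true]) -> kk <> [::] ->
   forall m, size m = 4 ^ size kk -> P (phase_query n bn adj kk m) /\ size (star_oracle (phase_query n bn adj kk m)) <= n + 4 ^ size kk + 2.
  move=> /alive hok _ m hm; split; last by apply: leq_trans (size_answer bn hs hm) _; lia.
  rewrite /P (query_param bn hs hm) -/ok hparam hok /growth hkk size_rev.
  (* Here j = 2^(2l) and k < 2^l with l = [size kk], so the queried number of edges is at most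
     2^(3l). *)
  apply: (@leq_trans (2 ^ (2 * size kk) * 2 ^ size kk)).
    rewrite expnM; apply: leq_mul => //; rewrite -(size_rev kk) ltnW //; exact: of_bits_lt.
  rewrite -expnD leq_exp2l //.
  have : size kk <= 4 ^ size kk by rewrite ltnW // ltn_expl.
  lia.
have [s' [H E]] := @exec_main_ok star_oracle P x bn r bk adj n E1 E2 hs q1 q2.
apply: finish H _ _; first by rewrite E; exact: (final_word_value E1 E2 hs).
have h1 := dec_sd_size (leqnn _) E1; have h2 := dec_sd_size (leqnn _) E2.
have hn : n <= size adj by rewrite hs; case: (n) => // k; rewrite leq_pmulr.
have hz : size kk <= size bk by rewrite /kk; apply: leq_trans (size_dropz _) _; rewrite size_rev.
have := @main_time_le n bn adj kk x (size (bits (graph_param x))).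
have hl : (if has id (phase_result star_oracle n bn adj [:: true]) && (kk != [::]) then size kk else 0)
    <= size (bits (graph_param x)).
  case: ifP => // /andP[/alive hok _].
  by rewrite hparam hok hkk size_rev.
move=> /(_ hl) T; apply: leq_trans (T _ _ _); try lia.
have : size (s' 0) <= n.+1.
  rewrite E /final_word; case: ifP => _.
    by case: ifP => _; rewrite size_nseq; case: (has _ _).
  apply: leq_trans (size_dropz _) _; rewrite size_rev.
  by case: ifP => _; rewrite size_phase_result.
rewrite -/kk; lia.
Qed.
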